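(* Let $X\in\mathrm{Ch}(R)$ and let $n\ge 0$ be an integer. Then the following are equivalent: (1) $D_C\text{-}\mathrm{pd}(X)\le n$. (2) $D_C\text{-}\mathrm{pd}(X)<\infty$ and $\mathrm{Ext}^m(X,H)=0$ for every $m>n$ and every $H\in\mathrm{Ch}(R)$ with $\mathcal{F}_C\text{-}\mathrm{pd}(H)<\infty$. (3) $D_C\text{-}\mathrm{pd}(X)<\infty$ and $\mathrm{Ext}^m(X,H)=0$ for every $m>n$ and every $H\in\widetilde{\mathcal{F}_C(R)}$. (4) For every exact sequence of complexes $\cdots\to G_n\to G_{n-1}\to\cdots\to G_0\to X\to 0$ with all $G_i$ $D_C$-projective, the complex $K_n=\mathrm{Ker}(G_{n-1}\to G_{n-2})$ is $D_C$-projective (where $G_{-1}=X$, and $K_0=X$). (5) For every integer $t$ with $0\le t\le n$, there is an exact sequence of complexes $$0\to Q_n\to\cdots\to Q_{t+1}\to G_t\to P_{t-1}\to\cdots\to P_0\to X\to 0$$ such that $G_t$ is $D_C$-projective, $Q_i\in\widetilde{\mathcal{P}_C(R)}$ for $i>t$ and $P_i\in\widetilde{\mathcal{P}(R)}$ for $i<t$.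
   Context: $R$ is a commutative ring with identity, all modules are unitary $R$-modules, and $C$ is a fixed semidualizing $R$-module, i.e. (i) $C$ admits a projective resolution by finitely generated projective modules, (ii) the homothety map $R\to\mathrm{Hom}_R(C,C)$ is an isomorphism, (iii) $\mathrm{Ext}^i_R(C,C)=0$ for all $i\ge 1$. $\mathcal{P}(R)$ and $\mathcal{F}(R)$ are the classes of projective and flat $R$-modules; $\mathcal{P}_C(R)=\{C\otimes_R P\mid P\in\mathcal{P}(R)\}$ and $\mathcal{F}_C(R)=\{C\otimes_R F\mid F\in\mathcal{F}(R)\}$. $\mathrm{Ch}(R)$ is the category of complexes $X=\cdots\to X^{n+1}\xrightarrow{\delta^{n+1}}X^n\xrightarrow{\delta^n}X^{n-1}\to\cdots$ of $R$-modules, and $Z_n(X)=\ker\delta^n$. For a class $\mathcal{X}$ of modules, $\widetilde{\mathcal{X}}$ is the class of exact complexes $X$ with $Z_i(X)\in\mathcal{X}$ for all $i\in\mathbb{Z}$. $\mathrm{Hom}(X,Y)$ is the group of morphisms of complexes, and $\mathrm{Ext}^i(X,Y)$ are the right derived functors of $\mathrm{Hom}$ in the abelian category $\mathrm{Ch}(R)$. An exact sequence $\mathbf{L}$ in an abelian category is $\mathrm{Hom}(-,\mathcal{B})$-exact if $\mathrm{Hom}(\mathbf{L},B)$ is exact for every $B\in\mathcal{B}$. A complex $X$ is $D_C$-projective if there is a $\mathrm{Hom}(-,\widetilde{\mathcal{F}_C(R)})$-exact exact sequence in $\mathrm{Ch}(R)$, $\cdots\to P_1\xrightarrow{f_1}P_0\xrightarrow{f_0}Q_{-1}\xrightarrow{f_{-1}}Q_{-2}\to\cdots$,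 with all $P_i\in\widetilde{\mathcal{P}(R)}$, all $Q_i\in\widetilde{\mathcal{P}_C(R)}$ and $X\cong\mathrm{Im}\,f_0$. $D_C\text{-}\mathrm{pd}(X)\le n$ means that there is an exact sequence $0\to G_n\to G_{n-1}\to\cdots\to G_0\to X\to 0$ in $\mathrm{Ch}(R)$ with every $G_i$ $D_C$-projective; $D_C\text{-}\mathrm{pd}(X)$ is the least such $n\ge 0$, and is $\infty$ if there is none. $\mathcal{F}_C\text{-}\mathrm{pd}(X)$ is defined in the same way, using exact sequences with all terms $G_i$ in $\widetilde{\mathcal{F}_C(R)}$. *)

(* Defs.v *)
From HB Require Import structures.
From mathcomp Require Import all_boot all_order all_algebra.
From mathcomp Require Import boolp.

Set Implicit Arguments.
Unset Strict Implicit.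
Unset Printing Implicit Defensive.

Import GRing.Theory.
Local Open Scope ring_scope.

Section KernelModule.
Context (R : pzRingType) (M N : lmodType R) (f : {linear M -> N}).

Definition in_ker : {pred M} := [pred x | f x == 0].

Lemma in_kerP x : reflect (f x = 0) (x \in in_ker).
Proof. exact: eqP. Qed.

Lemma in_ker_submod : submod_closed in_ker.
Proof.
split=> [|a x y /in_kerP fx0 /in_kerP fy0]; apply/in_kerP; first exact: raddf0.
by rewrite linearP fx0 fy0 scaler0 addr0.
Qed.

HB.instance Definition _ := GRing.isSubmodClosed.Build R M in_ker in_ker_submod.

Record ker : Type := Ker { ker_val :> M; ker_valP : ker_val \in in_ker }.

HB.instance Definition _ := [isSub for ker_val].
HB.instance Definition _ := [Choice of ker by <:].
HB.instance Definition _ := [SubChoice_isSubLmodule of ker by <:].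

End KernelModule.

Section KernelMap.
Context (R : pzRingType) (M N M' N' : lmodType R).
Context (f : {linear M -> N}) (f' : {linear M' -> N'}) (g : {linear M -> M'}).
Hypothesis fg : forall x, f x = 0 -> f' (g x) = 0.

Lemma ker_map_subproof (x : ker f) : g (ker_val x) \in in_ker f'.
Proof. by apply/in_kerP/fg/in_kerP/ker_valP. Qed.

Definition ker_map (x : ker f) : ker f' := Ker (ker_map_subproof x).

Lemma ker_map_linear : linear ker_map.
Proof.
by move=> a x y; apply: val_inj; exact: (linearP g a (ker_val x) (ker_val y)).
Qed.

HB.instance Definition _ :=
  GRing.isLinear.Build R (ker f) (ker f') *:%R ker_map ker_map_linear.

End KernelMap.

Section Modules.
Context (R : comPzRingType).

Definition exact_mod (M N P : lmodType R)
    (f : {linear M -> N}) (g : {linear N -> P}) : Prop :=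
  forall y, g y = 0 <-> exists x, f x = y.

Definition surjective (S T : Type) (f : S -> T) : Prop :=
  forall y, exists x, f x = y.

Definition projective_module (P : lmodType R) : Prop :=
  forall (M N : lmodType R) (g : {linear M -> N}) (f : {linear P -> N}),
    surjective g -> exists h : {linear P -> M}, forall x, g (h x) = f x.

Definition fin_gen (M : lmodType R) : Prop :=
  exists (k : nat) (g : 'I_k -> M),
    forall x, exists c : 'I_k -> R, x = \sum_(i < k) c i *: g i.

(* The library's {bilinear _ -> _ -> _} requires a nonzero ring. *)
Definition is_bilinear (M N T : lmodType R) (b : M -> N -> T) : Prop :=
  (forall x, linear (b x)) /\ (forall y, linear (b^~ y)).

(* (T, b) is a tensor product of M and N; see tensor_exists. *)
Definition is_tensor (M N T : lmodType R) (b : M -> N -> T) : Prop :=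
  is_bilinear b /\
  forall (U : lmodType R) (c : M -> N -> U), is_bilinear c ->
    (exists h : {linear T -> U}, forall x y, h (b x y) = c x y) /\
    (forall h h' : {linear T -> U},
       (forall x y, h (b x y) = c x y) -> (forall x y, h' (b x y) = c x y) ->
       forall t, h t = h' t).

(* h plays the role of id_F (x) f : F (x) M -> F (x) N. *)
Definition flat_module (F : lmodType R) : Prop :=
  forall (M N : lmodType R) (f : {linear M -> N}), injective f ->
  forall (S T : lmodType R) (b : F -> M -> S) (c : F -> N -> T),
    is_tensor b -> is_tensor c ->
  forall h : {linear S -> T},
    (forall x y, h (b x y) = c x (f y)) -> injective h.

Record mod_resolution (M : lmodType R) := ModResolution {
  mr_obj :> nat -> lmodType R;
  mr_d : forall k, {linear mr_obj k.+1 -> mr_obj k};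
  mr_aug : {linear mr_obj 0 -> M};
  mr_aug_surj : surjective mr_aug;
  mr_exact0 : exact_mod (mr_d 0) mr_aug;
  mr_exactS : forall k, exact_mod (mr_d k.+1) (mr_d k)
}.

(* H^i(Hom(P, N)) = 0. *)
Definition mod_cohom_zero (M : lmodType R) (P : mod_resolution M)
    (i : nat) (N : lmodType R) : Prop :=
  forall f : {linear P i -> N}, (forall x, f (mr_d P i x) = 0) ->
  match i return {linear P i -> N} -> Prop with
  | 0 => fun f => forall x, f x = 0
  | j.+1 => fun f =>
      exists g : {linear P j -> N}, forall x, f x = g (mr_d P j x)
  end f.

Definition mod_ext_zero (i : nat) (M N : lmodType R) : Prop :=
  forall P : mod_resolution M, (forall k, projective_module (P k)) ->
    mod_cohom_zero P i N.

Definition semidualizing (C : lmodType R) : Prop :=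
  [/\ exists P : mod_resolution C,
        forall k, projective_module (P k) /\ fin_gen (P k),
      (forall r s : R, (forall x : C, r *: x = s *: x) -> r = s) /\
      (forall f : {linear C -> C}, exists r : R, forall x, f x = r *: x)
    & forall i, (1 <= i)%N -> mod_ext_zero i C C].

Definition mod_class := lmodType R -> Prop.

(* { C (x) P | P in cX }, closed under isomorphism. *)
Definition tensor_class (C : lmodType R) (cX : mod_class) : mod_class :=
  fun M => exists (P : lmodType R) (b : C -> P -> M), cX P /\ is_tensor b.

Definition P_C (C : lmodType R) : mod_class := tensor_class C projective_module.
Definition F_C (C : lmodType R) : mod_class := tensor_class C flat_module.

End Modules.

(* Every bilinear map factors through the quotient of the formal sums of pairs
   by the relation "identified by all bilinear maps". *)
Section TensorExistence.
Local Open Scope quotient_scope.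
Context (R : comPzRingType) (M N : lmodType R).

Definition tsum (U : lmodType R) (b : M -> N -> U) (s : seq (M * N)) : U :=
  \sum_(p <- s) b p.1 p.2.

Definition tens_rel (s t : seq (M * N)) : bool :=
  `[< forall (U : lmodType R) (b : M -> N -> U), is_bilinear b ->
        tsum b s = tsum b t >].

Lemma tens_rel_equiv : equiv_class_of tens_rel.
Proof.
split.
- by move=> s; apply/asboolP.
- by move=> s t; apply/asboolP/asboolP => st U b /st.
- move=> t s u /asboolP st /asboolP tu; apply/asboolP => U b bb.
  by rewrite st // tu.
Qed.

Canonical tens_equiv := EquivRelPack tens_rel_equiv.

Definition tens := {eq_quot tens_equiv}.
HB.instance Definition _ := Choice.on tens.
HB.instance Definition _ := EqQuotient.on tens.

Definition tval (U : lmodType R) (b : M -> N -> U) (x : tens) : U :=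
  tsum b (repr x).

Lemma tval_pi (U : lmodType R) (b : M -> N -> U) s :
  is_bilinear b -> tval b (\pi_tens s) = tsum b s.
Proof.
move=> bb.
have: repr (\pi_tens s) = s %[mod tens] by rewrite reprK.
by move/eqmodP/asboolP; apply.
Qed.

Lemma tens_ext (x y : tens) :
  (forall (U : lmodType R) (b : M -> N -> U), is_bilinear b ->
     tval b x = tval b y) -> x = y.
Proof. by move=> xy; rewrite -[x]reprK -[y]reprK; apply/eqmodP/asboolP. Qed.

Definition tadd (x y : tens) : tens := \pi_tens (repr x ++ repr y).
Definition tzero : tens := \pi_tens [::].
Definition tscale (a : R) (x : tens) : tens :=
  \pi_tens [seq (a *: p.1, p.2) | p <- repr x].
Definition topp (x : tens) : tens := tscale (-1) x.

Section Values.
Context (U : lmodType R) (b : M -> N -> U).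
Hypothesis bb : is_bilinear b.

Lemma tval_add x y : tval b (tadd x y) = tval b x + tval b y.
Proof. by rewrite tval_pi // /tsum big_cat. Qed.

Lemma tval_zero : tval b tzero = 0.
Proof. by rewrite tval_pi // /tsum big_nil. Qed.

Lemma tval_scale a x : tval b (tscale a x) = a *: tval b x.
Proof.
rewrite tval_pi // /tsum big_map scaler_sumr; apply: eq_bigr => p _ /=.
have b0 : b 0 p.2 = 0.
  by have := bb.2 p.2 (-1) 0 0; rewrite scaler0 addr0 scaleN1r addNr.
by have := bb.2 p.2 a p.1 0; rewrite b0 !addr0.
Qed.

Lemma tval_opp x : tval b (topp x) = - tval b x.
Proof. by rewrite tval_scale scaleN1r. Qed.

End Values.

Lemma taddA : associative tadd.
Proof. by move=> x y z; apply: tens_ext => U b bb; rewrite !tval_add // addrA. Qed.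

Lemma taddC : commutative tadd.
Proof. by move=> x y; apply: tens_ext => U b bb; rewrite !tval_add // addrC. Qed.

Lemma tadd0 : left_id tzero tadd.
Proof.
by move=> x; apply: tens_ext => U b bb; rewrite tval_add // tval_zero // add0r.
Qed.

Lemma taddN : left_inverse tzero topp tadd.
Proof.
move=> x; apply: tens_ext => U b bb.
by rewrite tval_add // tval_opp // tval_zero // addNr.
Qed.

HB.instance Definition _ := GRing.isZmodule.Build tens taddA taddC tadd0 taddN.

Lemma tscaleA a c x : tscale a (tscale c x) = tscale (a * c) x.
Proof. by apply: tens_ext => U b bb; rewrite !tval_scale // scalerA. Qed.

Lemma tscale1 : left_id 1 tscale.
Proof. by move=> x; apply: tens_ext => U b bb; rewrite tval_scale // scale1r. Qed.

Lemma tscaleDr : right_distributive tscale +%R.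
Proof.
move=> a x y; apply: tens_ext => U b bb.
by rewrite !(tval_scale, tval_add) // scalerDr.
Qed.

Lemma tscaleDl x : {morph tscale^~ x : a c / a + c}.
Proof.
move=> a c; apply: tens_ext => U b bb.
by rewrite !(tval_scale, tval_add) // scalerDl.
Qed.

HB.instance Definition _ :=
  GRing.Zmodule_isLmodule.Build R tens tscaleA tscale1 tscaleDr tscaleDl.

Definition tpair (x : M) (y : N) : tens := \pi_tens [:: (x, y)].

Lemma tval_pair (U : lmodType R) (b : M -> N -> U) x y :
  is_bilinear b -> tval b (tpair x y) = b x y.
Proof. by move=> bb; rewrite tval_pi // /tsum big_seq1. Qed.

Lemma tens_ind (x : tens) : x = \sum_(p <- repr x) tpair p.1 p.2.
Proof.
apply: tens_ext => U b bb; rewrite {1}/tval /tsum.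
elim: (repr x) => [|p s IHs]; first by rewrite !big_nil tval_zero.
by rewrite !big_cons tval_add // tval_pair // IHs.
Qed.

Lemma tpair_bilinear : is_bilinear tpair.
Proof.
split=> [x a y z|y a x z]; apply: tens_ext => U b bb;
  rewrite tval_add // tval_scale // !tval_pair //;
  [exact: bb.1 | exact: bb.2].
Qed.

Lemma tval_linear (U : lmodType R) (b : M -> N -> U) :
  is_bilinear b -> linear (tval b).
Proof. by move=> bb a x y; rewrite tval_add // tval_scale. Qed.

Lemma tens_universal : is_tensor tpair.
Proof.
split=> [|U c cb]; first exact: tpair_bilinear.
split=> [|h h' hc h'c t].
  pose h := GRing.isLinear.Build R tens U *:%R (tval c) (tval_linear cb).
  pose H : {linear tens -> U} := HB.pack (tval c) h.
  by exists H => x y; exact: tval_pair.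
rewrite [t]tens_ind !linear_sum; apply: eq_bigr => p _.
by rewrite hc h'c.
Qed.

End TensorExistence.

Lemma tensor_exists (R : comPzRingType) (M N : lmodType R) :
  exists (T : lmodType R) (b : M -> N -> T), is_tensor b.
Proof. by exists (tens M N : lmodType R), (@tpair R M N); exact: tens_universal. Qed.

Section Complexes.
Context (R : comPzRingType).

(* c_d X i is the differential delta^(i+1) : X^(i+1) -> X^i; every integer is
   of the form i + 1, so this shape avoids casts between X^(i-1+1) and X^i. *)
Record complex := Complex {
  c_obj :> int -> lmodType R;
  c_d : forall i, {linear c_obj (i + 1) -> c_obj i};
  c_dd : forall i x, c_d i (c_d (i + 1) x) = 0
}.

Record chmap (X Y : complex) := ChMap {
  cm :> forall i, {linear X i -> Y i};
  cm_comm : forall i x, cm i (c_d X i x) = c_d Y i (cm (i + 1) x)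
}.

Definition ch_eq (X Y : complex) (f g : chmap X Y) : Prop :=
  forall i x, f i x = g i x.

Definition ch_null (X Y : complex) (f : chmap X Y) : Prop :=
  forall i x, f i x = 0.

Lemma ch_comp_subproof (X Y Z : complex) (g : chmap Y Z) (f : chmap X Y) i x :
  (g i \o f i) (c_d X i x) = c_d Z i ((g (i + 1) \o f (i + 1)) x).
Proof. by rewrite /= !cm_comm. Qed.

Definition ch_comp (X Y Z : complex) (g : chmap Y Z) (f : chmap X Y) :
    chmap X Z :=
  @ChMap X Z (fun i => (g i \o f i : {linear X i -> Z i}))
    (ch_comp_subproof g f).

Lemma ker_complex_subproof (X Y : complex) (f : chmap X Y) i x :
  f (i + 1) x = 0 -> f i (c_d X i x) = 0.
Proof. by move=> fx0; rewrite cm_comm fx0 raddf0. Qed.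

Definition ker_d (X Y : complex) (f : chmap X Y) i :
    {linear ker (f (i + 1)) -> ker (f i)} :=
  ker_map (@ker_complex_subproof X Y f i).
Arguments ker_d {X Y} f i.

Lemma ker_dd (X Y : complex) (f : chmap X Y) i x :
  ker_d f i (ker_d f (i + 1) x) = 0.
Proof. by apply: val_inj; exact: c_dd. Qed.
Arguments ker_dd {X Y} f i x.

Definition ker_complex (X Y : complex) (f : chmap X Y) : complex :=
  @Complex (fun i => ker (f i) : lmodType R) (ker_d f) (ker_dd f).

(* Epimorphisms, monomorphisms and exact sequences in Ch(R) are detected
   degreewise. *)
Definition ch_epi (X Y : complex) (f : chmap X Y) : Prop :=
  forall i, surjective (f i).

Definition ch_mono (X Y : complex) (f : chmap X Y) : Prop :=
  forall i, injective (f i).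

Definition ch_exact (X Y Z : complex) (f : chmap X Y) (g : chmap Y Z) : Prop :=
  forall i, exact_mod (f i) (g i).

Definition zero_complex (X : complex) : Prop := forall i (x : X i), x = 0.

Definition exact_complex (X : complex) : Prop :=
  forall i, exact_mod (c_d X (i + 1)) (c_d X i).

Definition complex_class := complex -> Prop.

(* ker (c_d X i) is Z_(i+1)(X). *)
Definition tilde (cX : mod_class R) : complex_class :=
  fun X => exact_complex X /\ forall i, cX (ker (c_d X i)).

Definition projective_complex (P : complex) : Prop :=
  forall (X Y : complex) (g : chmap X Y) (f : chmap P Y), ch_epi g ->
    exists h : chmap P X, ch_eq (ch_comp g h) f.

(* Exact sequences ... -> G_1 -> G_0 -> X -> 0 in Ch(R). *)
Record resolution (X : complex) := Resolution {
  r_obj :> nat -> complex;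
  r_d : forall k, chmap (r_obj k.+1) (r_obj k);
  r_aug : chmap (r_obj 0) X;
  r_aug_epi : ch_epi r_aug;
  r_exact0 : ch_exact (r_d 0) r_aug;
  r_exactS : forall k, ch_exact (r_d k.+1) (r_d k)
}.

(* Ker (G_(n-1) -> G_(n-2)), with G_(-1) = X and K_0 = X. *)
Definition syzygy (X : complex) (G : resolution X) (n : nat) : complex :=
  match n with
  | 0 => X
  | 1 => ker_complex (r_aug G)
  | k.+2 => ker_complex (r_d G k)
  end.

(* A resolution 0 -> G_n -> ... -> G_0 -> X -> 0. *)
Definition length_le (X : complex) (G : resolution X) (n : nat) : Prop :=
  forall k, (n < k)%N -> zero_complex (G k).

Definition dim_le (cG : complex_class) (X : complex) (n : nat) : Prop :=
  exists G : resolution X,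
    length_le G n /\ forall k, (k <= n)%N -> cG (G k).

Definition dim_finite (cG : complex_class) (X : complex) : Prop :=
  exists n, dim_le cG X n.

(* H^m(Hom(P, Y)) = 0. *)
Definition cohom_zero (X : complex) (P : resolution X) (m : nat)
    (Y : complex) : Prop :=
  forall f : chmap (P m) Y, ch_null (ch_comp f (r_d P m)) ->
  match m return chmap (P m) Y -> Prop with
  | 0 => fun f => ch_null f
  | k.+1 => fun f => exists g : chmap (P k) Y, ch_eq f (ch_comp g (r_d P k))
  end f.

(* Ext^m(X, Y) = 0, with Ext^m(X, Y) computed as H^m(Hom(P, Y)) for projective
   resolutions P of X in Ch(R). *)
Definition ext_zero (m : nat) (X Y : complex) : Prop :=
  forall P : resolution X, (forall k, projective_complex (P k)) ->
    cohom_zero P m Y.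

(* Sequences ... -> P_1 -> P_0 -> Q_(-1) -> Q_(-2) -> ... in Ch(R);
   dc_Q k is Q_(-k-1) and dc_f0 is f_0. *)
Record dc_seq := DcSeq {
  dc_P : nat -> complex;
  dc_Q : nat -> complex;
  dc_dP : forall k, chmap (dc_P k.+1) (dc_P k);
  dc_f0 : chmap (dc_P 0) (dc_Q 0);
  dc_dQ : forall k, chmap (dc_Q k) (dc_Q k.+1)
}.

Definition at_each_term (L : dc_seq)
    (E : forall X Y Z : complex, chmap X Y -> chmap Y Z -> Prop) : Prop :=
  [/\ forall k, E _ _ _ (dc_dP L k.+1) (dc_dP L k),
      E _ _ _ (dc_dP L 0) (dc_f0 L),
      E _ _ _ (dc_f0 L) (dc_dQ L 0)
    & forall k, E _ _ _ (dc_dQ L k) (dc_dQ L k.+1)].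

(* Exactness of Hom(Z, B) -> Hom(Y, B) -> Hom(X, B). *)
Definition hom_exact (B X Y Z : complex) (f : chmap X Y) (g : chmap Y Z) :
    Prop :=
  forall u : chmap Y B,
    ch_null (ch_comp u f) <-> exists v : chmap Z B, ch_eq (ch_comp v g) u.

(* j identifies X with Im f. *)
Definition iso_to_image (X P Q : complex) (f : chmap P Q) : Prop :=
  exists j : chmap X Q, ch_mono j /\
    forall i y, (exists x, j i x = y) <-> (exists p, f i p = y).

Definition D_projective (C : lmodType R) : complex_class :=
  fun X => exists L : dc_seq,
    [/\ at_each_term L ch_exact,
        forall B, tilde (F_C C) B -> at_each_term L (@hom_exact B),
        forall k, tilde (@projective_module R) (dc_P L k),
        forall k, tilde (P_C C) (dc_Q L k)
      & iso_to_image X (dc_f0 L)].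

End Complexes.

(* Main.v *)
(* Write W for the complexes X with Ext^i(X, B) = 0 for all i >= 1 and all B in
   tilde F_C. A complex is D_C-projective exactly when it lies in W and has a
   coresolution by objects of tilde P_C all of whose cosyzygies lie in W. Since
   tilde P_C is contained in tilde F_C, a horseshoe argument closes this class
   under extensions, and then under kernels of epimorphisms: if X -> Y -> Z is
   exact and Y embeds in Q with cokernel Y', then Q/X is an extension of Y' by Z.
   The equivalences follow from this by pullbacks and pushouts; direct summands
   are never needed, because a complement that occurs is itself D_C-projective.

   The input on C is that tilde P_C lies in W and that tilde P consists of
   D_C-projectives. Complexes in tilde P and tilde P_C are direct sums of disks, so
   both statements concern modules. Let F -> C be a resolution by finitely
   generated projectives. Finite dual bases identify Hom(F_k, M (x) C) with
   M (x) Hom(F_k, C) and Hom(Hom(F_k, C), M (x) C) with M (x) F_k, and for flat M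
   the functor M (x) - preserves the exactness of R -> Hom(F_., C) and of F -> C. *)
From HB Require Import structures.
Require Import Defs.
From mathcomp Require Import all_boot all_order all_algebra.
From mathcomp Require Import boolp functions.

Set Implicit Arguments.
Unset Strict Implicit.
Unset Printing Implicit Defensive.

Import GRing.Theory.
Local Open Scope ring_scope.

(** * Linear maps, cokernels and projective modules *)

Section LinearMaps.
Context (R : comPzRingType).
Implicit Types M N T X Y Z : lmodType R.

(** Only the vanishing of Ext occurs in the statement, so no Ext group is built: [extS_zero]
    expresses vanishing by an extension property and dimension shifting, and each piece of a long
    exact sequence becomes one lemma obtained from a pullback or from a change of projective cover.
    A second obstacle is that membership in tilde F_C controls the cycles of a complex, whereas maps
    out of a sum of disks see its terms. A term is an extension of two cycle modules. Instead of
    proving that F_C is closed under extensions, the proof passes to the larger class [acyclic_for],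
    for which closure is a diagram chase. Tensor products are known only through their universal
    property. The identifications with Hom modules are therefore stated as [is_tensor], so that
    flatness applies directly to complexes of Hom modules. *)

Definition lin M N (f : M -> N) (lf : linear f) : {linear M -> N} :=
  HB.pack f (GRing.isLinear.Build R M N *:%R f lf).

(** A set-theoretic section of [g] suffices, because [h] kills the difference of any two
    preimages. *)
Lemma factor_epi M N T (g : {linear M -> N}) (h : {linear M -> T}) :
  surjective g -> (forall x, g x = 0 -> h x = 0) ->
  exists k : {linear N -> T}, forall x, k (g x) = h x.
Proof.
move=> /choice[s sK] gh.
have hs x : h (s (g x)) = h x.
  by apply/subr0_eq; rewrite -linearB gh // linearB sK subrr.
have lk : linear (h \o s).
  move=> a x y /=; rewrite -{1}[x]sK -{1}[y]sK -linearP.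
  by rewrite hs linearP.
by exists (lin lk) => x; exact: hs.
Qed.

Lemma factor_mono X Y T (f : {linear X -> Y}) (h : {linear T -> Y}) :
  injective f -> (forall t, exists x, f x = h t) ->
  exists k : {linear T -> X}, forall t, f (k t) = h t.
Proof.
move=> fI /choice[k kK].
have lk : linear k by move=> a x y; apply: fI; rewrite linearP !kK linearP.
by exists (lin lk) => x; exact: kK.
Qed.

Lemma inj_ker0 M N (f : {linear M -> N}) :
  (forall x, f x = 0 -> x = 0) -> injective f.
Proof.
by move=> f0 x y fxy; apply/subr0_eq/f0; rewrite linearB fxy subrr.
Qed.

Lemma lin_inl_linear M N : linear (fun x : M => (x, 0) : M * N).
Proof. by move=> a x y; apply: (congr2 pair) => //=; rewrite scaler0 addr0. Qed.

Definition lin_inl M N : {linear M -> (M * N)%type} := lin (@lin_inl_linear M N).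

Lemma lin_inr_linear M N : linear (fun y : N => (0, y) : M * N).
Proof. by move=> a x y; apply: (congr2 pair) => //=; rewrite scaler0 addr0. Qed.

Definition lin_inr M N : {linear N -> (M * N)%type} := lin (@lin_inr_linear M N).

Lemma pair_inl_inr M N (x : M) (y : N) : (x, y) = lin_inl M N x + lin_inr M N y.
Proof. by apply: (congr2 pair); rewrite /= ?addr0 ?add0r. Qed.

End LinearMaps.

Section Cokernel.
Local Open Scope quotient_scope.
Context (R : comPzRingType) (M N : lmodType R) (f : {linear M -> N}).

Definition coker_rel (x y : N) : bool := `[< exists m, f m = x - y >].

Lemma coker_rel_equiv : equiv_class_of coker_rel.
Proof.
split.
- by move=> x; apply/asboolP; exists 0; rewrite raddf0 subrr.
- by move=> x y; apply/asboolP/asboolP => -[m fm]; exists (- m);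
    rewrite linearN /= fm opprB.
- move=> y x z /asboolP[m fm] /asboolP[k fk]; apply/asboolP; exists (m + k).
  by rewrite linearD /= fm fk subrKA.
Qed.

Canonical coker_equiv := EquivRelPack coker_rel_equiv.

Definition coker := {eq_quot coker_equiv}.
HB.instance Definition _ := Choice.on coker.
HB.instance Definition _ := EqQuotient.on coker.

Definition coker_pi (x : N) : coker := \pi_coker x.
Definition coker_add (x y : coker) := coker_pi (repr x + repr y).
Definition coker_opp (x : coker) := coker_pi (- repr x).
Definition coker_scale a (x : coker) := coker_pi (a *: repr x).

Lemma coker_piP x y : coker_pi x = coker_pi y <-> exists m, f m = x - y.
Proof.
split=> [xy|xy]; first by move/eqmodP/asboolP: xy.
by apply/eqmodP/asboolP.
Qed.

Lemma coker_repr x : coker_pi (repr x) = x.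
Proof. exact: reprK. Qed.

Lemma coker_addE x y : coker_add (coker_pi x) (coker_pi y) = coker_pi (x + y).
Proof.
have /coker_piP[a fa] := coker_repr (coker_pi x).
have /coker_piP[b fb] := coker_repr (coker_pi y).
by apply/coker_piP; exists (a + b); rewrite linearD /= fa fb opprD addrACA.
Qed.

Lemma coker_oppE x : coker_opp (coker_pi x) = coker_pi (- x).
Proof.
have /coker_piP[a fa] := coker_repr (coker_pi x).
by apply/coker_piP; exists (- a); rewrite linearN /= fa opprD.
Qed.

Lemma coker_scaleE a x : coker_scale a (coker_pi x) = coker_pi (a *: x).
Proof.
have /coker_piP[b fb] := coker_repr (coker_pi x).
by apply/coker_piP; exists (a *: b); rewrite linearZ /= fb scalerBr.
Qed.

Lemma coker_addA : associative coker_add.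
Proof.
move=> x y z; rewrite -[x]coker_repr -[y]coker_repr -[z]coker_repr.
by rewrite !coker_addE addrA.
Qed.

Lemma coker_addC : commutative coker_add.
Proof.
move=> x y; rewrite -[x]coker_repr -[y]coker_repr.
by rewrite !coker_addE addrC.
Qed.

Lemma coker_add0 : left_id (coker_pi 0) coker_add.
Proof. by move=> x; rewrite -[x]coker_repr coker_addE add0r. Qed.

Lemma coker_addN : left_inverse (coker_pi 0) coker_opp coker_add.
Proof.
by move=> x; rewrite -[x]coker_repr coker_oppE coker_addE addNr.
Qed.

HB.instance Definition _ :=
  GRing.isZmodule.Build coker coker_addA coker_addC coker_add0 coker_addN.

Lemma coker_scaleA a b x : coker_scale a (coker_scale b x) = coker_scale (a * b) x.
Proof. by rewrite -[x]coker_repr !coker_scaleE scalerA. Qed.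

Lemma coker_scale1 : left_id 1 coker_scale.
Proof. by move=> x; rewrite -[x]coker_repr coker_scaleE scale1r. Qed.

Lemma coker_scaleDr : right_distributive coker_scale +%R.
Proof.
move=> a x y; rewrite -[x]coker_repr -[y]coker_repr /=.
by rewrite /GRing.add /= !(coker_scaleE, coker_addE) scalerDr.
Qed.

Lemma coker_scaleDl x : {morph coker_scale^~ x : a b / a + b}.
Proof.
move=> a b; rewrite -[x]coker_repr /= [RHS]/GRing.add /=.
by rewrite !(coker_scaleE, coker_addE) scalerDl.
Qed.

HB.instance Definition _ := GRing.Zmodule_isLmodule.Build R coker
  coker_scaleA coker_scale1 coker_scaleDr coker_scaleDl.

Lemma coker_pi_linear : linear coker_pi.
Proof. by move=> a x y; rewrite -coker_addE -coker_scaleE. Qed.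

End Cokernel.

Section ProjectiveLifting.
Context (R : comPzRingType).

Lemma coker_exists (M N : lmodType R) (f : {linear M -> N}) :
  exists (Q : lmodType R) (g : {linear N -> Q}), surjective g /\ exact_mod f g.
Proof.
exists (coker f : lmodType R), (lin (@coker_pi_linear _ _ _ f)); split.
  by move=> y; exists (repr y); exact: coker_repr.
move=> y; split=> [/(coker_piP f y 0)|[x fx]]; first by rewrite subr0.
by apply/(coker_piP f y 0); exists x; rewrite subr0.
Qed.

(** The image of [g] contains that of [f] but may be smaller than [N]. It is realized as the kernel
    of the cokernel map of [g], and both maps are corestricted to it. *)
Lemma proj_lift (P M N : lmodType R) (g : {linear M -> N}) (f : {linear P -> N}) :
  projective_module P -> (forall x, exists m, g m = f x) ->
  exists h : {linear P -> M}, forall x, g (h x) = f x.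
Proof.
move=> prP gf.
have [Q [q [_ qE]]] := coker_exists g.
have kval_inj : injective (@ker_val R N Q q) by exact: val_inj.
have lkv : linear (@ker_val R N Q q) by [].
have qg x : q (g x) = 0 by apply/qE; exists x.
have [g' g'E] : exists g' : {linear M -> ker q}, forall x, lin lkv (g' x) = g x.
  apply: factor_mono => // t.
  by exists (Ker (introT (in_kerP q (g t)) (qg t))).
have [f' f'E] : exists f' : {linear P -> ker q}, forall x, lin lkv (f' x) = f x.
  apply: factor_mono => // t.
  have qf : q (f t) = 0 by have [m <-] := gf t; exact: qg.
  by exists (Ker (introT (in_kerP q (f t)) qf)).
have [|h hE] := prP _ _ g' f'; last first.
  by exists h => x; rewrite -g'E hE f'E.
move=> y; have /in_kerP/qE[x gx] := ker_valP y; exists x.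
by apply: kval_inj; rewrite -gx -g'E.
Qed.

End ProjectiveLifting.

(** * Free modules as finitely supported functions *)

Section FinSupp.
Context (R : comPzRingType) (X : choiceType).

Definition supp_in (s : seq X) (f : X -> R^o) := forall x, x \notin s -> f x = 0.

Definition fin_supp : {pred (X -> R^o)} := fun f => `[< exists s, supp_in s f >].

Lemma fin_suppP f : reflect (exists s, supp_in s f) (f \in fin_supp).
Proof. exact: asboolP. Qed.

Lemma fin_supp_submod : submod_closed fin_supp.
Proof.
split=> [|a f g /fin_suppP[s fs] /fin_suppP[t gt]]; apply/fin_suppP.
  by exists [::].
exists (s ++ t) => x; rewrite mem_cat negb_or => /andP[/fs fx /gt gx].
by rewrite addrfctE /= scalrfctE fx gx scaler0 addr0.
Qed.

HB.instance Definition _ :=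
  GRing.isSubmodClosed.Build R (X -> R^o) fin_supp fin_supp_submod.

Record free : Type :=
  FreeElt { free_val :> X -> R^o; free_valP : free_val \in fin_supp }.

HB.instance Definition _ := [isSub for free_val].
HB.instance Definition _ := [Choice of free by <:].
HB.instance Definition _ := [SubChoice_isSubLmodule of free by <:].

Lemma freeP a (f g : free) x : (a *: f + g) x = a * f x + g x.
Proof. by []. Qed.

Lemma delta_subproof x : (fun y => (y == x)%:R : R^o) \in fin_supp.
Proof. by apply/fin_suppP; exists [:: x] => y; rewrite inE => /negbTE->. Qed.

Definition delta x : free := FreeElt (delta_subproof x).

Section Lift.
Context (M : lmodType R) (phi : X -> M).

(** A chosen support, without repetitions so that a sum over it counts each point once; by
    [free_liftE] the choice is immaterial. *)
Definition free_supp (f : free) : seq X :=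
  undup (projT1 (cid (elimT (fin_suppP _) (free_valP f)))).

Lemma free_suppP f : supp_in (free_supp f) f.
Proof. by move=> x; rewrite mem_undup; case: (cid _) x. Qed.

Definition free_lift (f : free) : M := \sum_(x <- free_supp f) f x *: phi x.

Lemma sum_supp (F : X -> M) (s t : seq X) :
  uniq s -> uniq t -> {subset s <= t} -> (forall x, x \notin s -> F x = 0) ->
  \sum_(x <- s) F x = \sum_(x <- t) F x.
Proof.
move=> us ut st F0; rewrite [RHS](bigID (mem s)) /= [X in _ + X]big1 ?addr0.
  rewrite -[RHS]big_filter; apply: perm_big; apply: uniq_perm => //.
    exact: filter_uniq.
  by move=> x; rewrite mem_filter andb_idr //; exact: st.
by move=> x /F0.
Qed.

Lemma free_liftE (f : free) s : uniq s -> supp_in s f ->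
  free_lift f = \sum_(x <- s) f x *: phi x.
Proof.
move=> us fs; rewrite /free_lift.
have fE x t : supp_in t f -> x \notin t -> f x *: phi x = 0.
  by move=> tf xt; rewrite tf // scale0r.
rewrite (@sum_supp (fun x => f x *: phi x) _ (undup (s ++ free_supp f))) ?undup_uniq //.
- rewrite [RHS](@sum_supp (fun x => f x *: phi x) _ (undup (s ++ free_supp f))) ?undup_uniq //.
    by move=> x xs; rewrite mem_undup mem_cat xs.
  by move=> x; exact: fE.
- by move=> x xs; rewrite mem_undup mem_cat xs orbT.
- by move=> x; apply: fE; exact: free_suppP.
Qed.

Lemma free_lift_linear : linear free_lift.
Proof.
move=> a f g.
pose s := undup (free_supp f ++ free_supp g).
have sf : supp_in s f.
  move=> x; rewrite mem_undup mem_cat negb_or => /andP[xf _].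
  exact: free_suppP.
have sg : supp_in s g.
  move=> x; rewrite mem_undup mem_cat negb_or => /andP[_ xg].
  exact: free_suppP.
have us : uniq s by exact: undup_uniq.
have sfg : supp_in s (a *: f + g).
  by move=> x xs; rewrite freeP sf // sg // mulr0 addr0.
rewrite !(free_liftE us) // scaler_sumr -big_split /=; apply: eq_bigr => x _.
by rewrite -[X in X *: _]/(a * f x + g x) scalerDl scalerA.
Qed.

Lemma free_lift_delta x : free_lift (delta x) = phi x.
Proof.
rewrite (@free_liftE _ [:: x]) //; first by rewrite big_seq1 /= eqxx scale1r.
by move=> y; rewrite inE /= => /negbTE->.
Qed.

End Lift.

End FinSupp.

Section Projectives.
Context (R : comPzRingType).

Lemma free_projective (X : choiceType) : projective_module (free R X).
Proof.
move=> M N g f /choice[s sK].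
exists (lin (@free_lift_linear _ _ _ (fun x => s (f (delta R x))))) => p /=.
rewrite /free_lift linear_sum /=.
under eq_bigr => x _ do rewrite linearZ /= sK -linearZ.
rewrite -linear_sum; congr (f _); apply: val_inj; apply/funext => y /=.
have ev_lin : linear (fun q : free R X => q y : R^o) by [].
rewrite -[LHS]/(lin ev_lin _) linear_sum.
transitivity (\sum_(x <- free_supp p) p x * (y == x)%:R); first by [].
have [yp|yp] := boolP (y \in free_supp p).
  rewrite (bigD1_seq y) ?undup_uniq //= big1 ?addr0 ?eqxx ?mulr1 // => x xy.
  by rewrite eq_sym (negbTE xy) mulr0.
rewrite big_seq big1 ?(free_suppP yp) // => x xp.
rewrite (_ : y == x = false) ?mulr0 //.
by apply/eqP => yx; rewrite yx xp in yp.
Qed.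

Lemma enough_projectives (M : lmodType R) :
  exists (P : lmodType R) (g : {linear P -> M}), projective_module P /\ surjective g.
Proof.
exists (free R M : lmodType R), (lin (free_lift_linear (fun x : M => x))).
split; first exact: free_projective.
by move=> x; exists (delta R x); exact: free_lift_delta.
Qed.

(** The [chi x] are the coordinates of a splitting of the free cover on all elements of [P]. The
    expansion holds over every larger list, so that finitely many elements can be expanded over a
    common one. *)
Lemma dual_basis (P : lmodType R) : projective_module P ->
  exists chi : P -> {linear P -> R^o}, forall p, exists s : seq P,
    forall t, uniq t -> {subset s <= t} -> p = \sum_(x <- t) chi x p *: x.
Proof.
move=> prP; pose g := lin (free_lift_linear (fun x : P => x)).
have [|h hE] := prP _ _ g idfun.
  by move=> x; exists (delta R x); exact: free_lift_delta.
have lchi x : linear (fun p => h p x : R^o).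
  by move=> a p q; rewrite linearP.
exists (fun x => lin (lchi x)) => p; exists (free_supp (h p)) => t ut st.
rewrite -[LHS]hE /= (free_liftE _ ut) // => x xt.
by apply: free_suppP; apply: contra xt; exact: st.
Qed.

Definition dual_fin_basis (P : lmodType R) :=
  exists (k : nat) (g : 'I_k -> P) (chi : 'I_k -> {linear P -> R^o}),
    forall p, p = \sum_(i < k) chi i p *: g i.

Lemma fin_gen_dual_basis (P : lmodType R) :
  projective_module P -> fin_gen P -> dual_fin_basis P.
Proof.
move=> prP [k [g gen]].
pose e (c : {ffun 'I_k -> R^o}) := \sum_(i < k) c i *: g i.
have le : linear e.
  move=> a c d; rewrite /e scaler_sumr -big_split; apply: eq_bigr => i _ /=.
  by rewrite !ffunE scalerDl scalerA.
have [|h hE] := prP _ _ (lin le) idfun.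
  move=> x; have [c ->] := gen x; exists [ffun i => c i].
  by apply: eq_bigr => i _; rewrite ffunE.
have lchi i : linear (fun p => h p i : R^o).
  by move=> a p q; rewrite linearP !ffunE.
by exists k, g, (fun i => lin (lchi i)) => p; rewrite -[LHS]hE.
Qed.

End Projectives.

(** * Modules of homomorphisms and tensor products *)

Section HomModule.
Context (R : comPzRingType).
Implicit Types M N T P X Y Z U : lmodType R.

(** The failure of linearity, as an operator on the module of all functions. Its kernel is [Hom],
    which thereby inherits a module structure; commutativity of [R] enters in
    [lin_defect_linear]. *)
Definition lin_defect M N (f : M -> N) : R * M * M -> N :=
  fun p => f (p.1.1 *: p.1.2 + p.2) - (p.1.1 *: f p.1.2 + f p.2).

Lemma lin_defect_linear M N : linear (@lin_defect M N).
Proof.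
move=> a f g; apply/funext => p.
rewrite -[LHS]/(a *: f (p.1.1 *: p.1.2 + p.2) + g (p.1.1 *: p.1.2 + p.2) -
  (p.1.1 *: (a *: f p.1.2 + g p.1.2) + (a *: f p.2 + g p.2))).
rewrite -[RHS]/(a *: lin_defect f p + lin_defect g p) /lin_defect.
rewrite scalerBr !scalerDr !scalerA [a * _]mulrC.
by rewrite [X in _ - X]addrACA opprD addrACA.
Qed.

Definition Hom M N : lmodType R := ker (lin (@lin_defect_linear M N)).

Lemma Hom_linear M N (f : Hom M N) : linear (ker_val f).
Proof.
move=> a x y; have /in_kerP/(congr1 (fun h => h (a, x, y))) := ker_valP f.
by move/subr0_eq.
Qed.

Definition ofHom M N (f : Hom M N) : {linear M -> N} := lin (Hom_linear f).

Lemma toHom_subproof M N (f : {linear M -> N}) :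
  (f : M -> N) \in in_ker (lin (@lin_defect_linear M N)).
Proof.
by apply/in_kerP/funext => -[[a x] y]; rewrite /= /lin_defect /= linearP subrr.
Qed.

Definition toHom M N (f : {linear M -> N}) : Hom M N := Ker (toHom_subproof f).

Lemma Hom_ext M N (f g : Hom M N) : (forall x, ofHom f x = ofHom g x) -> f = g.
Proof. by move=> fg; apply: val_inj; apply/funext => x; exact: fg. Qed.

Lemma HomP M N a (f g : Hom M N) x :
  ofHom (a *: f + g) x = a *: ofHom f x + ofHom g x.
Proof. by []. Qed.

Lemma Hom_sum M N I (r : seq I) (f : I -> Hom M N) x :
  ofHom (\sum_(i <- r) f i) x = \sum_(i <- r) ofHom (f i) x.
Proof.
have ev_lin : linear (fun g : Hom M N => ofHom g x) by [].
exact: (linear_sum (lin ev_lin)).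
Qed.

Lemma Hom_eval_linear M N x : linear (fun g : Hom M N => ofHom g x).
Proof. by []. Qed.

Lemma toHom_linear T M N (f : T -> {linear M -> N}) :
  (forall x, linear (fun t => f t x)) -> linear (fun t => toHom (f t)).
Proof. by move=> lf a s t; apply: Hom_ext => x; exact: lf. Qed.

Definition precomp M M' N (f : {linear M' -> M}) (u : Hom M N) : Hom M' N :=
  toHom (ofHom u \o f).

Lemma precomp_linear M M' N (f : {linear M' -> M}) : linear (@precomp M M' N f).
Proof. by move=> a u v; apply: Hom_ext. Qed.

Definition pre M M' N (f : {linear M' -> M}) : {linear Hom M N -> Hom M' N} :=
  lin (@precomp_linear M M' N f).

Definition postcomp M N N' (f : {linear N -> N'}) (u : Hom M N) : Hom M N' :=
  toHom (f \o ofHom u).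

Lemma postcomp_linear M N N' (f : {linear N -> N'}) : linear (@postcomp M N N' f).
Proof. by move=> a u v; apply: Hom_ext => x /=; exact: linearP. Qed.

Definition post M N N' (f : {linear N -> N'}) : {linear Hom M N -> Hom M N'} :=
  lin (@postcomp_linear M N N' f).

Lemma scale_by_linear M (x : M) : linear (fun r : R^o => r *: x).
Proof. by move=> a r s; rewrite scalerDl scalerA. Qed.

(** The image of the elementary tensor of [chi] and [x] in [Hom P M]. *)
Definition rank1 P M (chi : {linear P -> R^o}) (x : M) : Hom P M :=
  toHom (lin (scale_by_linear x) \o chi).

Lemma rank1_linear P M (chi : {linear P -> R^o}) : linear (@rank1 P M chi).
Proof.
move=> a x y; apply: Hom_ext => p /=.
by rewrite -[RHS]/(a *: (chi p *: x) + chi p *: y) scalerDr !scalerA mulrC.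
Qed.

End HomModule.

Section Tensors.
Context (R : comPzRingType).
Implicit Types M N T P X Y Z U F : lmodType R.

Section Bilinear.
Context M N U (b : M -> N -> U) (bb : is_bilinear b).

Definition curry1 (x : M) : {linear N -> U} := lin (bb.1 x).
Definition curry2 (y : N) : {linear M -> U} := lin (bb.2 y).

Lemma curry_linear : linear (fun x => toHom (curry1 x)).
Proof. by apply: toHom_linear => y; exact: bb.2. Qed.

Definition curry : {linear M -> Hom N U} := lin curry_linear.

End Bilinear.

Lemma bilinear0r M N U (b : M -> N -> U) x : is_bilinear b -> b x 0 = 0.
Proof. by move=> bb; exact: (linear0 (curry1 bb x)). Qed.

Lemma bilinearZl M N U (b : M -> N -> U) r x y :
  is_bilinear b -> b (r *: x) y = r *: b x y.
Proof. by move=> bb; exact: (linearZZ (curry2 bb y) r x). Qed.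

Lemma bilinearZr M N U (b : M -> N -> U) r x y :
  is_bilinear b -> b x (r *: y) = r *: b x y.
Proof. by move=> bb; exact: (linearZZ (curry1 bb x) r y). Qed.

Lemma bilinear_suml M N U (b : M -> N -> U) I (s : seq I) (f : I -> M) y :
  is_bilinear b -> b (\sum_(i <- s) f i) y = \sum_(i <- s) b (f i) y.
Proof. by move=> bb; exact: (linear_sum (curry2 bb y)). Qed.

Lemma bilinear_sumr M N U (b : M -> N -> U) I (s : seq I) (f : I -> N) x :
  is_bilinear b -> b x (\sum_(i <- s) f i) = \sum_(i <- s) b x (f i).
Proof. by move=> bb; exact: (linear_sum (curry1 bb x)). Qed.

Lemma uncurry_bilinear M N U (f : {linear M -> Hom N U}) :
  is_bilinear (fun x y => ofHom (f x) y).
Proof.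
split=> [x a y z|y a x z]; first exact: linearP.
by rewrite linearP HomP.
Qed.

Lemma bilinear_comp M N U M' N' U' (b : M -> N -> U) (f : {linear M' -> M})
    (g : {linear N' -> N}) (h : {linear U -> U'}) :
  is_bilinear b -> is_bilinear (fun x y => h (b (f x) (g y))).
Proof.
move=> bb; split=> [x|y].
  exact: (linearP (h \o curry1 bb (f x) \o g)).
exact: (linearP (h \o curry2 bb (g y) \o f)).
Qed.

Lemma tensor_lift M N T U (b : M -> N -> T) (c : M -> N -> U) :
  is_tensor b -> is_bilinear c ->
  exists h : {linear T -> U}, forall x y, h (b x y) = c x y.
Proof. by move=> [_ tb] /tb[]. Qed.

Lemma tensor_eq M N T U (b : M -> N -> T) (h h' : {linear T -> U}) :
  is_tensor b -> (forall x y, h (b x y) = h' (b x y)) -> forall t, h t = h' t.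
Proof.
move=> [bb tb] hh'.
have cb : is_bilinear (fun x y => h' (b x y)).
  exact: (bilinear_comp idfun idfun h' bb).
by have [_] := tb _ _ cb; apply.
Qed.

Lemma tensor_eq0 M N T U (b : M -> N -> T) (h : {linear T -> U}) :
  is_tensor b -> (forall x y, h (b x y) = 0) -> forall t, h t = 0.
Proof.
move=> tb h0 t.
have l0 : linear (fun _ : T => 0 : U) by move=> a x y; rewrite scaler0 addr0.
exact: (@tensor_eq _ _ _ _ _ h (lin l0) tb).
Qed.

Lemma tensor_sym M N T (b : M -> N -> T) :
  is_tensor b -> is_tensor (fun y x => b x y).
Proof.
move=> [[b1 b2] tb]; split; first by split=> [y|x]; [exact: b2 | exact: b1].
move=> U c [c1 c2].
have /tb[[h hE] uE] : is_bilinear (fun x y => c y x).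
  by split=> [y|x]; [exact: c2 | exact: c1].
by split=> [|h1 h2 h1E h2E]; [exists h | apply: uE].
Qed.

Lemma tensor_map M N M' N' T T' (b : M -> N -> T) (b' : M' -> N' -> T')
    (f : {linear M -> M'}) (g : {linear N -> N'}) :
  is_tensor b -> is_tensor b' ->
  exists h : {linear T -> T'}, forall x y, h (b x y) = b' (f x) (g y).
Proof.
by move=> tb [bb' _]; apply: tensor_lift => //;
  exact: (bilinear_comp f g idfun bb').
Qed.

Lemma tensor_iso M N T T' (b : M -> N -> T) (f : {linear T -> T'})
    (g : {linear T' -> T}) :
  is_tensor b -> cancel f g -> cancel g f -> is_tensor (fun x y => f (b x y)).
Proof.
move=> tb fK gK; split; first exact: (bilinear_comp idfun idfun f tb.1).
move=> U c cb; split=> [|h h' hE h'E t].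
  have [h hE] := tensor_lift tb cb.
  by exists (h \o g) => x y /=; rewrite fK.
rewrite -[t]gK; apply: (tensor_eq (h := h \o f) (h' := h' \o f) tb) => x y /=.
by rewrite hE h'E.
Qed.

Lemma tensor_unit F : is_tensor (fun (x : F) (r : R^o) => r *: x).
Proof.
split=> [|U c cb].
  split=> [x a r s|r a x y]; first exact: scale_by_linear.
  by rewrite scalerDr !scalerA mulrC.
split=> [|h h' hE h'E t]; last by rewrite -[t]scale1r hE h'E.
exists (curry2 cb 1) => x r; rewrite /= (bilinearZl _ _ _ cb) -[in RHS](mulr1 r).
by rewrite -[r * 1]/(r *: (1 : R^o)) (bilinearZr _ _ _ cb).
Qed.

Section RightExact.
Context (F X Y Z SX SY SZ : lmodType R) (f : {linear X -> Y}) (g : {linear Y -> Z}).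
Context (bX : F -> X -> SX) (bY : F -> Y -> SY) (bZ : F -> Z -> SZ).
Context (tX : is_tensor bX) (tY : is_tensor bY) (tZ : is_tensor bZ).
Context (hf : {linear SX -> SY}) (hg : {linear SY -> SZ}).
Hypothesis hfE : forall a x, hf (bX a x) = bY a (f x).
Hypothesis hgE : forall a y, hg (bY a y) = bZ a (g y).

(** The cokernel map of [hg] kills all elementary tensors, hence vanishes. *)
Lemma tensor_surj : surjective g -> surjective hg.
Proof.
move=> gs; have [Q [q [_ qE]]] := coker_exists hg.
move=> t; apply/qE; apply: (tensor_eq0 (h := q) tZ) => a z.
by have [y <-] := gs z; rewrite -hgE; apply/qE; exists (bY a y).
Qed.

Lemma tensor_comp0 : (forall x, g (f x) = 0) -> forall t, hg (hf t) = 0.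
Proof.
move=> gf; apply: (tensor_eq0 (h := hg \o hf) tX) => a x /=.
by rewrite hfE hgE gf; exact: (bilinear0r _ tZ.1).
Qed.

(** The cokernel map [q] of [hf] factors through [hg]: for fixed [a], [q (bY a y)] depends only on
    [g y], and the resulting map on [F] and [Z] is bilinear. *)
Lemma tensor_right_exact : surjective g -> exact_mod f g -> exact_mod hf hg.
Proof.
move=> gs fg t; split=> [hgt|[s <-]]; last first.
  by apply: tensor_comp0 => x; apply/fg; exists x.
have [V [q [_ qE]]] := coker_exists hf; apply/qE.
have kP a : exists k : {linear Z -> V}, forall y, k (g y) = q (bY a y).
  apply: (factor_epi (h := q \o curry1 tY.1 a) gs) => y /fg[x <-] /=.
  by apply/qE; exists (bX a x); rewrite hfE.
pose k a := projT1 (cid (kP a)).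
have kE a y : k a (g y) = q (bY a y) by rewrite /k; case: cid.
have kb : is_bilinear k.
  split=> [a|z a x y]; first exact: linearP.
  have [w <-] := gs z; rewrite !kE -linearP; congr (q _); exact: tY.1.2.
have [h hE] := tensor_lift tZ kb.
have <- : h (hg t) = q t.
  apply: (tensor_eq (h := h \o hg) tY) => a y /=.
  by rewrite hgE hE kE.
by rewrite hgt linear0.
Qed.

End RightExact.

(** [g] factors through the cokernel [Q] of [f] by an injection [i]. Right exactness settles the
    part up to [Q], and flatness keeps [i] injective after tensoring. *)
Lemma flat_exact F X Y Z (SX SY SZ : lmodType R) (f : {linear X -> Y}) (g : {linear Y -> Z})
    (bX : F -> X -> SX) (bY : F -> Y -> SY) (bZ : F -> Z -> SZ)
    (hf : {linear SX -> SY}) (hg : {linear SY -> SZ}) :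
  flat_module F -> is_tensor bX -> is_tensor bY -> is_tensor bZ ->
  (forall a x, hf (bX a x) = bY a (f x)) ->
  (forall a y, hg (bY a y) = bZ a (g y)) ->
  exact_mod f g -> exact_mod hf hg.
Proof.
move=> flF tX tY tZ hfE hgE fg t; split=> [hgt|[s <-]]; last first.
  by apply: (tensor_comp0 tX tZ hfE hgE) => x; apply/fg; exists x.
have [Q [q [qs fq]]] := coker_exists f.
have [i iE] : exists i : {linear Q -> Z}, forall y, i (q y) = g y.
  by apply: factor_epi => // y /fq/fg.
have iI : injective i.
  apply: inj_ker0 => z; have [y <-] := qs z; rewrite iE => /fg/fq; exact.
have [SQ [bQ tQ]] := tensor_exists F Q.
have [hq hqE] := tensor_map idfun q tY tQ.
have [hi hiE] := tensor_map idfun i tQ tZ.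
apply/(tensor_right_exact tX tY tQ hfE hqE qs fq).
apply: (flF _ _ i iI _ _ _ _ tQ tZ hi hiE); rewrite linear0 -hgt.
apply: (tensor_eq (h := hi \o hq) tY) => a y /=.
by rewrite hqE hiE iE hgE.
Qed.

Lemma tensor_span M N T (b : M -> N -> T) t : is_tensor b ->
  exists s : seq (M * N), t = \sum_(p <- s) b p.1 p.2.
Proof.
move=> tb; have [f fE] := tensor_lift tb (@tpair_bilinear R M N).
have [g gE] := tensor_lift (@tens_universal R M N) tb.1.
exists (repr (f t)); transitivity (g (f t)).
  by apply: (tensor_eq (h := idfun) (h' := g \o f) tb) => x y /=; rewrite fE gE.
by rewrite [X in g X]tens_ind linear_sum; apply: eq_bigr => p _; rewrite gE.
Qed.

(** A dual basis gives coordinates [k x] on the tensor product that are compatible with [h], and [t]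
    is rebuilt from finitely many of them. If [h t = 0], injectivity of [f] kills all coordinates of
    [t]. *)
Lemma projective_flat (P : lmodType R) : projective_module P -> flat_module P.
Proof.
move=> prP M N f fI S T b c tb tc h hE; apply: inj_ker0 => t ht.
have [chi chiE] := dual_basis prP.
have prjP M' T' (b' : P -> M' -> T') x : is_tensor b' ->
    exists k : {linear T' -> M'}, forall p m, k (b' p m) = chi x p *: m.
  move=> tb'.
  have [k kE] := tensor_map (chi x) idfun tb' (tensor_sym (tensor_unit M')).
  by exists k.
pose k x := projT1 (cid (prjP _ _ _ x tb)).
have kE x p m : k x (b p m) = chi x p *: m by rewrite /k; case: cid.
have kt x : k x t = 0.
  have [l lE] := prjP _ _ _ x tc.
  apply: fI; rewrite linear0 -(linear0 l) -ht.
  apply: (tensor_eq (h := f \o k x) (h' := l \o h) tb) => p m /=.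
  by rewrite kE hE lE linearZ.
suff [r ->] : exists r, t = \sum_(x <- r) b x (k x t).
  by rewrite big1 // => x _; rewrite kt; exact: (bilinear0r _ tb.1).
have [s tE] := tensor_span t tb.
pose supp p := projT1 (cid (chiE p)).
have suppE p u : uniq u -> {subset supp p <= u} -> p = \sum_(x <- u) chi x p *: x.
  by rewrite /supp; case: cid => /= r; exact.
(* One index list that serves all left factors in the expansion of [t]. *)
pose r := undup (flatten [seq supp p.1 | p <- s]).
have ktE x : k x t = \sum_(p <- s) chi x p.1 *: p.2.
  by rewrite tE linear_sum; apply: eq_bigr => p _; rewrite kE.
exists r; transitivity (\sum_(x <- r) \sum_(p <- s) b x (chi x p.1 *: p.2)).
  rewrite exchange_big tE big_seq [RHS]big_seq /=; apply: eq_bigr => p ps.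
  rewrite {1}[p.1](suppE _ r) ?undup_uniq //; last first.
    by move=> x xp; rewrite mem_undup; apply/flattenP; exists (supp p.1) => //;
      exact: (map_f (fun p => supp p.1)).
  rewrite (bilinear_suml _ _ _ tb.1); apply: eq_bigr => x _ /=.
  by rewrite (bilinearZl _ _ _ tb.1) (bilinearZr _ _ _ tb.1).
by apply: eq_bigr => x _; rewrite ktE (bilinear_sumr _ _ _ tb.1).
Qed.

End Tensors.

Section HomExact.
Context (R : comPzRingType).
Implicit Types A C F M N P Q T U X Y Z : lmodType R.

(** The nontrivial inclusion in the exactness of Hom(Z, N) -> Hom(Y, N) -> Hom(X, N). For [f] zero
    it says that every map from [Y] to [N] factors through [g]. *)
Definition hexact N X Y Z (f : {linear X -> Y}) (g : {linear Y -> Z}) :=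
  forall u : {linear Y -> N}, (forall x, u (f x) = 0) ->
    exists v : {linear Z -> N}, forall y, u y = v (g y).

(** By adjunction, maps to [N] from a tensor product with [A] are maps from [A] to Hom(-, N), and a
    projective [A] lifts along [pre N g]. *)
Lemma proj_hexact A N X Y Z (SX SY SZ : lmodType R)
    (f : {linear X -> Y}) (g : {linear Y -> Z})
    (bX : A -> X -> SX) (bY : A -> Y -> SY) (bZ : A -> Z -> SZ)
    (hf : {linear SX -> SY}) (hg : {linear SY -> SZ}) :
  projective_module A -> is_tensor bX -> is_tensor bY -> is_tensor bZ ->
  (forall a x, hf (bX a x) = bY a (f x)) ->
  (forall a y, hg (bY a y) = bZ a (g y)) ->
  hexact N f g -> hexact N hf hg.
Proof.
move=> prA tX tY tZ hfE hgE fgN u uf.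
have [a|h hE] := proj_lift (g := pre N g) (f := post Y u \o curry tY.1) prA.
  have [x|v vE] := fgN (u \o curry1 tY.1 a); first by rewrite /= -hfE uf.
  by exists (toHom v); apply: Hom_ext => y; rewrite /= -vE.
have [v vE] := tensor_lift tZ (uncurry_bilinear h).
exists v; apply: (tensor_eq (h' := v \o hg) tY) => a y /=.
by rewrite hgE vE -[RHS]/(ofHom (pre N g (h a)) y) hE.
Qed.

Lemma tensor_projective A F T (b : A -> F -> T) :
  projective_module A -> projective_module F -> is_tensor b ->
  projective_module T.
Proof.
move=> prA prF tb M N g f gs.
have [a|h hE] := proj_lift (g := post F g) (f := post F f \o curry tb.1) prA.
  have [h hE] := prF _ _ g (f \o curry1 tb.1 a) gs.
  by exists (toHom h); apply: Hom_ext => y; rewrite /= hE.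
have [v vE] := tensor_lift tb (uncurry_bilinear h).
exists v; apply: (tensor_eq (h := g \o v) tb) => a y /=.
by rewrite vE -[LHS]/(ofHom (post F g (h a)) y) hE.
Qed.

(** The lifting hypothesis makes the lemma applicable to [Z = Hom (F k) C]. After subtracting a lift
    of the factorization found for [N2], the remainder lands in [N1]. *)
Lemma hexact_ext N1 N N2 (i : {linear N1 -> N}) (p : {linear N -> N2})
    (X Y Z : lmodType R) (f : {linear X -> Y}) (g : {linear Y -> Z}) :
  injective i -> exact_mod i p -> (forall x, g (f x) = 0) ->
  (forall u : {linear Z -> N2}, exists v : {linear Z -> N}, forall z, p (v z) = u z) ->
  hexact N1 f g -> hexact N2 f g -> hexact N f g.
Proof.
move=> iI ip gf lift ex1 ex2 u uf.
have [x|v2 v2E] := ex2 (p \o u); first by rewrite /= uf linear0.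
have [v vE] := lift v2.
have [t|w wE] := factor_mono (f := i) (h := u \- (v \o g)) iI.
  by apply/ip; rewrite /= linearB [p (u t)]v2E vE subrr.
have [x|w1 w1E] := ex1 w.
  by apply: iI; rewrite wE /= uf gf !linear0 addr0.
exists (v \+ (i \o w1) : {linear Z -> N}) => y /=.
by rewrite -w1E wE /= addrC subrK.
Qed.

(** Ext^1(M, N1) = 0 removes the obstruction: a lift on [P 0] is corrected by a cochain with values
    in [N1] so that it kills the image of [P 1]. *)
Lemma resolution_lift M (P : mod_resolution M) N1 N N2 (i : {linear N1 -> N})
    (p : {linear N -> N2}) :
  projective_module (P 0) -> mod_cohom_zero P 1 N1 ->
  injective i -> exact_mod i p -> surjective p ->
  forall u : {linear M -> N2}, exists v : {linear M -> N}, forall x, p (v x) = u x.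
Proof.
move=> prP ex iI ip ps u.
have aug0 x : mr_aug P (mr_d P 0 x) = 0 by apply/mr_exact0; exists x.
have [l lE] := prP _ _ p (u \o mr_aug P) ps.
have [t|w wE] := factor_mono (f := i) (h := l \o mr_d P 0) iI.
  by apply/ip; rewrite /= lE /= aug0 linear0.
have [x|w' w'E] := ex w.
  apply: iI; rewrite wE /=; suff -> : mr_d P 0 (mr_d P 1 x) = 0 by rewrite !linear0.
  by apply/mr_exactS; exists x.
have [x|v vE] := factor_epi (g := mr_aug P) (h := l \- (i \o w')) (@mr_aug_surj _ _ P).
  by move=> /mr_exact0[y <-]; rewrite /= -[w' _]w'E wE subrr.
exists v => x; have [y <-] := mr_aug_surj P x.
rewrite vE /= linearB lE /=; suff -> : p (i (w' y)) = 0 by rewrite subr0.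
by apply/ip; exists (w' y).
Qed.

Section FiniteDualBasis.
Context F (k : nat) (e : 'I_k -> F) (chi : 'I_k -> {linear F -> R^o}).
Hypothesis chiE : forall p, p = \sum_(i < k) chi i p *: e i.

Lemma Hom_rank1_sum M (h : Hom F M) : h = \sum_(i < k) rank1 (chi i) (ofHom h (e i)).
Proof.
apply: Hom_ext => x; rewrite Hom_sum {1}[x]chiE linear_sum.
by apply: eq_bigr => i _; rewrite linearZZ.
Qed.

(** Through the rank-one maps and evaluation at the [e i], [Hom F A] is a retract of a k-fold power
    of [A]; a lift is assembled from one lift per coordinate. [Hom_lift] rests on the same fact. *)
Lemma Hom_projective A : projective_module A -> projective_module (Hom F A).
Proof.
move=> prA M N g f gs.
have hP i : exists h : {linear A -> M}, forall a, g (h a) = f (rank1 (chi i) a).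
  exact: (prA _ _ g (f \o lin (@rank1_linear _ F A (chi i))) gs).
pose h i := projT1 (cid (hP i)).
have hE i a : g (h i a) = f (rank1 (chi i) a) by rewrite /h; case: cid.
have lh : linear (fun u : Hom F A => \sum_(i < k) h i (ofHom u (e i))).
  move=> a u v; rewrite scaler_sumr -big_split; apply: eq_bigr => i _.
  exact: (linearP (h i \o lin (@Hom_eval_linear _ F _ (e i)))).
exists (lin lh) => u; rewrite /= linear_sum [in RHS](Hom_rank1_sum u) linear_sum.
by apply: eq_bigr => i _; rewrite hE.
Qed.

Lemma Hom_lift N N2 (g : {linear N -> N2}) M :
  (forall u : {linear M -> N2}, exists v : {linear M -> N}, forall x, g (v x) = u x) ->
  forall u : {linear Hom F M -> N2},
    exists v : {linear Hom F M -> N}, forall x, g (v x) = u x.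
Proof.
move=> lift u.
have hP i : exists h : {linear M -> N}, forall a, g (h a) = u (rank1 (chi i) a).
  exact: (lift (u \o lin (@rank1_linear _ F M (chi i)))).
pose h i := projT1 (cid (hP i)).
have hE i a : g (h i a) = u (rank1 (chi i) a) by rewrite /h; case: cid.
have lh : linear (fun u : Hom F M => \sum_(i < k) h i (ofHom u (e i))).
  move=> a v w; rewrite scaler_sumr -big_split; apply: eq_bigr => i _.
  exact: (linearP (h i \o lin (@Hom_eval_linear _ F _ (e i)))).
exists (lin lh) => w; rewrite /= linear_sum [in RHS](Hom_rank1_sum w) linear_sum.
by apply: eq_bigr => i _; rewrite hE.
Qed.

(** A bilinear map out of [N] and [Hom F M] is determined by its values on rank-one maps, and there
    it reduces to a bilinear map on [N] and [M]. *)
Lemma Hom_tensor M N T (b : N -> M -> T) (tb : is_tensor b) :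
  is_tensor (fun (n : N) (h : Hom F M) => toHom (curry1 tb.1 n \o ofHom h)).
Proof.
set b' := fun n h => _.
have rank1E n i m : b' n (rank1 (chi i) m) = rank1 (chi i) (b n m).
  by apply: Hom_ext => x; exact: (bilinearZr _ _ _ tb.1).
split=> [|U c cb].
  split=> [n a h h'|h a n n']; apply: Hom_ext => x.
    exact: (tb.1.1 n a (ofHom h x) (ofHom h' x)).
  exact: (tb.1.2 (ofHom h x)).
have b'l i : linear (fun t => rank1 (chi i) t : Hom F T) by exact: rank1_linear.
split=> [|h h' hE h'E u]; last first.
  rewrite [u]Hom_rank1_sum !linear_sum; apply: eq_bigr => i _.
  apply: (tensor_eq (h := h \o lin (b'l i)) (h' := h' \o lin (b'l i)) tb) => n m /=.
  by rewrite -rank1E hE h'E.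
have cP i : exists d : {linear T -> U}, forall n m, d (b n m) = c n (rank1 (chi i) m).
  apply: tensor_lift => //.
  exact: (bilinear_comp idfun (lin (@rank1_linear _ F M (chi i))) idfun cb).
pose d i := projT1 (cid (cP i)).
have dE i n m : d i (b n m) = c n (rank1 (chi i) m) by rewrite /d; case: cid.
have lh : linear (fun u : Hom F T => \sum_(i < k) d i (ofHom u (e i))).
  move=> a v w; rewrite scaler_sumr -big_split; apply: eq_bigr => i _.
  exact: (linearP (d i \o lin (@Hom_eval_linear _ F _ (e i)))).
exists (lin lh) => n h /=.
rewrite [in RHS](Hom_rank1_sum h) (bilinear_sumr _ _ _ cb).
by apply: eq_bigr => i _; rewrite dE.
Qed.

(* For [M = Hom (C, N)], evaluation gives [M (x) F = Hom (Hom (F, C), N)]. *)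
Lemma Hom_Hom_tensor C M N (b : M -> C -> N) (bb : is_bilinear b) :
  injective (curry bb) -> (forall w : Hom C N, exists y, curry bb y = w) ->
  is_tensor (fun (y : M) (p : F) =>
    toHom (curry1 bb y \o lin (@Hom_eval_linear _ F C p))).
Proof.
move=> cI cs; set b' := fun y p => _.
split=> [|U c cb].
  split=> [y a p q|p a y z]; apply: Hom_ext => h /=.
    exact: (linearP (curry1 bb y \o ofHom h)).
  exact: bb.2.
(* The [i]-th coordinate of [w]: precomposed with the rank-one maps along [chi i], [w] becomes a map
   from [C] to [N], that is, an element of [M]. *)
have yP i : exists y : {linear Hom (Hom F C) N -> M}, forall w,
    curry bb (y w) = pre N (lin (@rank1_linear _ F C (chi i))) w.
  exact: factor_mono.
pose y i := projT1 (cid (yP i)).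
have yE i w z : b (y i w) z = ofHom w (rank1 (chi i) z).
  rewrite /y; case: cid => /= y' /(_ w)/(congr1 (fun h => ofHom h z)); exact.
split=> [|h h' hE h'E w]; last first.
  have -> : w = \sum_(i < k) b' (y i w) (e i).
    apply: Hom_ext => h0; rewrite Hom_sum {1}[h0]Hom_rank1_sum linear_sum.
    by apply: eq_bigr => i _; rewrite /= yE.
  by rewrite !linear_sum; apply: eq_bigr => i _; rewrite hE h'E.
have lh : linear (fun w => \sum_(i < k) c (y i w) (e i)).
  move=> a v w; rewrite scaler_sumr -big_split; apply: eq_bigr => i _ /=.
  by rewrite linearP; exact: cb.2.
exists (lin lh) => m p /=.
rewrite [in RHS](chiE p) (bilinear_sumr _ _ _ cb); apply: eq_bigr => i _.
rewrite (bilinearZr _ _ _ cb) -(bilinearZl _ _ _ cb); congr (c _ _).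
apply: cI; apply: Hom_ext => z; rewrite /= yE /=.
by rewrite (bilinearZr _ _ _ bb) (bilinearZl _ _ _ bb).
Qed.

End FiniteDualBasis.

End HomExact.

(** * Resolutions and coresolutions attached to a semidualizing module *)

Section SemidualizingResolution.
Context (R : comPzRingType) (C : lmodType R) (F : mod_resolution C).
Hypothesis prF : forall k, projective_module (F k).
Hypothesis dbF : forall k, dual_fin_basis (F k).
Hypothesis homC_inj : forall r s : R, (forall x : C, r *: x = s *: x) -> r = s.
Hypothesis homC_surj : forall f : {linear C -> C}, exists r : R, forall x, f x = r *: x.
Hypothesis extC : forall m, mod_cohom_zero F m.+1 C.

Implicit Types A N M T : lmodType R.

Local Notation d k := (mr_d F k).
Local Notation dual k := (pre C (mr_d F k)).

Lemma homothety_linear : linear (fun r : R^o =>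
  toHom (curry2 (tensor_unit C).1 r \o mr_aug F)).
Proof. by apply: toHom_linear => x; exact: scale_by_linear. Qed.

(** The coaugmentation R = Hom(C, C) -> Hom(F_0, C) induced by [mr_aug F]. *)
Definition unitH : {linear R^o -> Hom (F 0) C} := lin homothety_linear.

(** With [unitH_exact] and [dual_exact], this turns the homothety isomorphism and the vanishing of
    Ext^i(C, C) into exactness of 0 -> R -> Hom(F_0, C) -> Hom(F_1, C) -> ... *)
Lemma unitH_inj : injective unitH.
Proof.
apply: inj_ker0 => r r0; apply: homC_inj => x; have [p <-] := mr_aug_surj F x.
by rewrite scale0r; exact: (congr1 (fun h => ofHom h p) r0).
Qed.

Lemma unitH_exact : exact_mod unitH (dual 0).
Proof.
move=> y; split=> [y0|[r <-]]; last first.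
  apply: Hom_ext => p /=; suff -> : mr_aug F (d 0 p) = 0 by rewrite scaler0.
  by apply/mr_exact0; exists p.
have [w wE] : exists w : {linear C -> C}, forall p, w (mr_aug F p) = ofHom y p.
  apply: factor_epi; first exact: mr_aug_surj.
  move=> p /mr_exact0[q <-]; exact: (congr1 (fun h => ofHom h q) y0).
have [r rE] := homC_surj w; exists r.
by apply: Hom_ext => p; rewrite -wE rE.
Qed.

Lemma dual_exact k : exact_mod (dual k) (dual k.+1).
Proof.
move=> y; split=> [y0|[z <-]]; last first.
  apply: Hom_ext => p /=; suff -> : d k (d k.+1 p) = 0 by exact: (linear0 (ofHom z)).
  by apply/mr_exactS; exists p.
have [p|z zE] := extC (m := k) (f := ofHom y).
  exact: (congr1 (fun h => ofHom h p) y0).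
by exists (toHom z); apply: Hom_ext => p; rewrite zE.
Qed.

(* Vanishing of [Ext^i(C, N)] for [i >= 1], and exactness of
   [Hom(R -> Hom(F_0, C) -> Hom(F_1, C) -> ..., N)]. *)
Definition acyclic_for N :=
  [/\ forall m, hexact N (d m.+1) (d m),
      forall k, hexact N (dual k) (dual k.+1),
      hexact N unitH (dual 0)
    & forall u : {linear R^o -> N}, exists v : {linear Hom (F 0) C -> N},
        forall r, u r = v (unitH r)].

(** The first property comes from tensoring the complex of duals with [M], the other three from
    tensoring F -> C with [M]. The second identification requires M = Hom(C, N), which is read off
    the left end of the first complex. *)
Lemma F_C_acyclic_for N : F_C C N -> acyclic_for N.
Proof.
move=> [M [b0 [flM tb0]]]; have := tensor_sym tb0.
move: (fun y x => b0 x y) => b {b0 tb0} tb.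
have tH k : is_tensor (fun (y : M) (h : Hom (F k) C) => toHom (curry1 tb.1 y \o ofHom h)).
  by have [n [e [chi chiE]]] := dbF k; exact: (Hom_tensor chiE).
have exN k : exact_mod (pre N (d k)) (pre N (d k.+1)).
  by apply: (flat_exact flM (tH k) (tH k.+1) (tH k.+2) _ _ (@dual_exact k)) => y h;
    apply: Hom_ext.
pose eps := pre N (mr_aug F) \o curry tb.1.
have epsE y (r : R^o) : eps (r *: y) = toHom (curry1 tb.1 y \o ofHom (unitH r)).
  apply: Hom_ext => p /=.
  by rewrite (bilinearZl _ _ _ tb.1) (bilinearZr _ _ _ tb.1).
have eps_exact : exact_mod eps (pre N (d 0)).
  apply: (flat_exact flM (tensor_unit M) (tH 0) (tH 1) epsE _ unitH_exact) => y h.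
  exact: Hom_ext.
have eps_inj : injective eps.
  exact: (flM _ _ unitH unitH_inj _ _ _ _ (tensor_unit M) (tH 0) eps epsE).
(* [M] and [Hom C N] agree, both being the kernel of Hom(F_0, N) -> Hom(F_1, N). *)
have curry_inj : injective (curry tb.1).
  by move=> y z /(congr1 (pre N (mr_aug F))); exact: eps_inj.
have curry_surj (w : Hom C N) : exists y, curry tb.1 y = w.
  have [|y yE] := (eps_exact (pre N (mr_aug F) w)).1.
    apply: Hom_ext => p /=; suff -> : mr_aug F (d 0 p) = 0 by exact: (linear0 (ofHom w)).
    by apply/mr_exact0; exists p.
  exists y; apply: Hom_ext => x; have [p <-] := mr_aug_surj F x.
  exact: (congr1 (fun h => ofHom h p) yE).
have tHH k : is_tensor (fun (y : M) (p : F k) =>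
    toHom (curry1 tb.1 y \o lin (@Hom_eval_linear _ (F k) C p))).
  by have [n [e [chi chiE]]] := dbF k; exact: (Hom_Hom_tensor chiE).
(* Evaluation at the augmentation, which is [unitH 1]. Under the identification it is [mr_aug F]
   tensored with [M]. *)
pose om := lin (@Hom_eval_linear R (Hom (F 0) C) N (unitH 1)).
have unitH1 p : ofHom (unitH 1) p = mr_aug F p by exact: scale1r.
have omE y p : om (toHom (curry1 tb.1 y \o lin (@Hom_eval_linear _ (F 0) C p))) =
    b y (mr_aug F p) by rewrite -unitH1.
have preE k y p : pre N (dual k) (toHom (curry1 tb.1 y \o lin (@Hom_eval_linear _ (F k.+1) C p))) =
    toHom (curry1 tb.1 y \o lin (@Hom_eval_linear _ (F k) C (d k p))).
  exact: Hom_ext.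
split.
- move=> m u u0; have [|v vE] := (exN m (toHom u)).1.
    by apply: Hom_ext => x; exact: u0.
  by exists (ofHom v) => y; rewrite -[LHS]/(ofHom (toHom u) y) -vE.
- move=> k u u0.
  have [|v vE] := (flat_exact (hf := pre N (dual k.+1)) (hg := pre N (dual k)) flM
    (tHH k.+2) (tHH k.+1) (tHH k) (preE k.+1) (preE k) (@mr_exactS _ _ F k) (toHom u)).1.
    by apply: Hom_ext => x; exact: u0.
  by exists (ofHom v) => y; rewrite -[LHS]/(ofHom (toHom u) y) -vE.
- move=> u u0.
  have [|v vE] := (flat_exact (hf := pre N (dual 0)) (hg := om) flM
    (tHH 1) (tHH 0) tb (preE 0) omE (@mr_exact0 _ _ F) (toHom u)).1.
    exact: u0.
  by exists (ofHom v) => y; rewrite -[LHS]/(ofHom (toHom u) y) -vE.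
- move=> u.
  (* A map out of R is given by its value at 1, so the claim is surjectivity of [om]. *)
  have [v vE] := tensor_surj tb omE (mr_aug_surj F) (u 1).
  exists (ofHom v) => r; rewrite -[r]mulr1 -[r * 1]/(r *: (1 : R^o)) !linearZZ.
  by rewrite -vE.
Qed.

(** Maps out of [Hom (F k) C] have to lift along [p]. For [C] itself this follows from Ext^1(C, N1)
    = 0, and [Hom (F k) C] is a retract of a power of [C]. *)
Lemma acyclic_for_ext N1 N N2 (i : {linear N1 -> N}) (p : {linear N -> N2}) :
  injective i -> exact_mod i p -> surjective p ->
  acyclic_for N1 -> acyclic_for N2 -> acyclic_for N.
Proof.
move=> iI ip ps [a1 a2 a3 a4] [b1 b2 b3 b4].
have liftH k (u : {linear Hom (F k) C -> N2}) :
    exists v : {linear Hom (F k) C -> N}, forall x, p (v x) = u x.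
  have [n [e [chi chiE]]] := dbF k.
  by apply: (Hom_lift chiE); exact: (resolution_lift (@prF 0) (a1 0%N) iI ip ps).
split.
- move=> m; apply: (hexact_ext iI ip) => // [x|u].
    by apply/mr_exactS; exists x.
  by have [v vE] := prF u ps; exists v.
- move=> k; apply: (hexact_ext iI ip) => // x.
  by apply/dual_exact; exists x.
- by apply: (hexact_ext iI ip) => // x; apply/unitH_exact; exists x.
(* The fourth property is [hexact] with a zero map in front. *)
- move=> u; pose z : {linear R^o -> R^o} := \0.
  apply: (hexact_ext (f := z) (N1 := N1) iI ip) => // x; exact: linear0.
Qed.

Section TensorWithProjective.
Context A T (b : C -> A -> T).
Hypotheses (prA : projective_module A) (tb : is_tensor b).

(** Tensoring F -> C with the flat module [A] keeps it exact, and [proj_hexact] transfers the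
    vanishing of Ext(C, N). *)
Lemma projective_resolution_of_tensor : exists P : mod_resolution T,
  (forall k, projective_module (P k)) /\
  forall N, acyclic_for N -> forall m, mod_cohom_zero P m.+1 N.
Proof.
pose S k : lmodType R := tens A (F k).
pose bS k : A -> F k -> S k := @tpair R A (F k).
have tS k : is_tensor (bS k) by exact: tens_universal.
have dP k : exists h : {linear S k.+1 -> S k}, forall a x, h (bS k.+1 a x) = bS k a (d k x).
  exact: (tensor_map idfun (d k) (tS k.+1) (tS k)).
pose dS k := projT1 (cid (dP k)).
have dSE k a x : dS k (bS k.+1 a x) = bS k a (d k x) by rewrite /dS; case: cid.
have [aug augE] := tensor_map idfun (mr_aug F) (tS 0) (tensor_sym tb).
have flA := projective_flat prA.
pose P := @ModResolution R T S dS aug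
  (tensor_surj (tensor_sym tb) augE (@mr_aug_surj _ _ F))
  (flat_exact flA (tS 1) (tS 0) (tensor_sym tb) (dSE 0) augE (@mr_exact0 _ _ F))
  (fun k => flat_exact flA (tS k.+2) (tS k.+1) (tS k) (dSE k.+1) (dSE k) (@mr_exactS _ _ F k)).
exists P; split=> [k|N [exN _ _ _] m].
  exact: (tensor_projective prA (@prF k) (tS k)).
exact: (proj_hexact prA (tS m.+2) (tS m.+1) (tS m) (dSE m.+1) (dSE m) (exN m)).
Qed.

(** The module Hom(F_k, T) has two readings: as the tensor product of [A] with Hom(F_k, C) it makes
    the sequence exact, and as that of [C] with the projective module Hom(F_k, A) it lies in
    [P_C]. *)
Lemma P_C_coresolution : exists (Q : nat -> lmodType R)
    (e : {linear A -> Q 0}) (dQ : forall k, {linear Q k -> Q k.+1}),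
  [/\ forall k, P_C C (Q k),
      injective e,
      exact_mod e (dQ 0),
      forall k, exact_mod (dQ k) (dQ k.+1)
    & forall N, acyclic_for N ->
      [/\ forall u : {linear A -> N}, exists v : {linear Q 0 -> N}, forall x, u x = v (e x),
          hexact N e (dQ 0)
        & forall k, hexact N (dQ k) (dQ k.+1)]].
Proof.
have tb' := tensor_sym tb.
pose Q k : lmodType R := Hom (F k) T.
have tQ k : is_tensor (fun (y : A) (h : Hom (F k) C) =>
    toHom (curry1 tb'.1 y \o ofHom h) : Q k).
  by have [n [e [chi chiE]]] := dbF k; exact: (Hom_tensor chiE).
pose dQ k : {linear Q k -> Q k.+1} := pre T (d k).
have dQE k y h : dQ k (toHom (curry1 tb'.1 y \o ofHom h)) =
    toHom (curry1 tb'.1 y \o ofHom (dual k h)) by exact: Hom_ext.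
pose e : {linear A -> Q 0} := pre T (mr_aug F) \o curry tb'.1.
have eE y (r : R^o) : e (r *: y) = toHom (curry1 tb'.1 y \o ofHom (unitH r)).
  apply: Hom_ext => p /=.
  by rewrite (bilinearZl _ _ _ tb'.1) (bilinearZr _ _ _ tb'.1).
have flA := projective_flat prA.
have tU := tensor_unit A.
exists Q, e, dQ; split=> [k||||N [_ N1 N2 N3]].
- exists (Hom (F k) A), (fun c h => toHom (curry1 tb.1 c \o ofHom h)).
  have [n [g [chi chiE]]] := dbF k.
  by split; [exact: (Hom_projective chiE) | exact: (Hom_tensor chiE)].
- exact: (flA _ _ unitH unitH_inj _ _ _ _ tU (tQ 0) e eE).
- exact: (flat_exact flA tU (tQ 0) (tQ 1) eE (dQE 0) unitH_exact).
- move=> k.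
  exact: (flat_exact flA (tQ k) (tQ k.+1) (tQ k.+2) (dQE k) (dQE k.+1) (@dual_exact k)).
(* Zero maps in front again turn the extension of maps along [e] into an instance of
   [proj_hexact]. *)
pose z : {linear R^o -> R^o} := \0.
pose zA : {linear A -> A} := \0.
split=> [u||k].
- have zE (a : A) (x : R^o) : zA (x *: a) = z x *: a by rewrite scale0r.
  exact: (proj_hexact prA tU tU (tQ 0) zE eE (fun v _ => N3 v) (fun x => linear0 u)).
- exact: (proj_hexact prA tU (tQ 0) (tQ 1) eE (dQE 0) N2).
- exact: (proj_hexact prA (tQ k) (tQ k.+1) (tQ k.+2) (dQE k) (dQE k.+1) (N1 k)).
Qed.

End TensorWithProjective.

End SemidualizingResolution.

(** [good] is [acyclic_for F]. The passage to complexes uses these four properties only, so the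
    resolution [F] stays hidden. *)
Lemma semidualizing_acyclicity (R : comPzRingType) (C : lmodType R) :
  semidualizing C -> exists good : mod_class R,
  [/\ forall N, F_C C N -> good N,
      forall (N1 N N2 : lmodType R) (i : {linear N1 -> N}) (p : {linear N -> N2}),
        injective i -> exact_mod i p -> surjective p ->
        good N1 -> good N2 -> good N,
      forall T, P_C C T -> exists P : mod_resolution T,
        (forall k, projective_module (P k)) /\
        forall N, good N -> forall m, mod_cohom_zero P m.+1 N
    & forall A, projective_module A -> exists (Q : nat -> lmodType R)
        (e : {linear A -> Q 0}) (dQ : forall k, {linear Q k -> Q k.+1}),
      [/\ forall k, P_C C (Q k),
          injective e,
          exact_mod e (dQ 0),
          forall k, exact_mod (dQ k) (dQ k.+1)
        & forall N, good N ->
          [/\ forall u : {linear A -> N}, exists v : {linear Q 0 -> N},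
                forall x, u x = v (e x),
              hexact N e (dQ 0)
            & forall k, hexact N (dQ k) (dQ k.+1)]]].
Proof.
move=> [[F Ffg] [homI homS] extC].
have prF k : projective_module (F k) by have [] := Ffg k.
have dbF k : dual_fin_basis (F k) by have [? ?] := Ffg k; exact: fin_gen_dual_basis.
have extF m : mod_cohom_zero F m.+1 C by exact: extC.
exists (acyclic_for F); split=> [N|N1 N N2 i p|T [A [b [prA tb]]]|A prA].
- exact: F_C_acyclic_for.
- exact: acyclic_for_ext.
- exact: (projective_resolution_of_tensor prF prA tb).
have [T [b tb]] := tensor_exists C A.
exact: (P_C_coresolution dbF homI homS extF prA tb).
Qed.

(** * Short exact sequences of complexes *)

Section ComplexConstructions.
Context (R : comPzRingType).
Implicit Types X Y Z T W : complex R.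

Definition ses X Y Z (f : chmap X Y) (g : chmap Y Z) :=
  [/\ ch_mono f, ch_exact f g & ch_epi g].

Lemma ses_comp0 X Y Z (f : chmap X Y) (g : chmap Y Z) : ses f g ->
  forall i x, g i (f i x) = 0.
Proof. by move=> [_ ex _] i x; apply/ex; exists x. Qed.

Lemma id_comm X i x : (fun i => idfun : {linear X i -> X i}) i (c_d X i x) =
  c_d X i ((fun i => idfun : {linear X i -> X i}) (i + 1) x).
Proof. by []. Qed.

Definition ch_id X : chmap X X := ChMap (@id_comm X).

Lemma zero_comm X Y i x : (fun i => \0 : {linear X i -> Y i}) i (c_d X i x) =
  c_d Y i ((fun i => \0 : {linear X i -> Y i}) (i + 1) x).
Proof. by rewrite /= linear0. Qed.

Definition ch_zero X Y : chmap X Y := ChMap (@zero_comm X Y).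

Lemma add_comm X Y (f g : chmap X Y) i x :
  (fun i => f i \+ g i : {linear X i -> Y i}) i (c_d X i x) =
  c_d Y i ((fun i => f i \+ g i : {linear X i -> Y i}) (i + 1) x).
Proof. by rewrite /= !cm_comm linearD. Qed.

Definition ch_add X Y (f g : chmap X Y) : chmap X Y := ChMap (@add_comm X Y f g).

Lemma sub_comm X Y (f g : chmap X Y) i x :
  (fun i => f i \- g i : {linear X i -> Y i}) i (c_d X i x) =
  c_d Y i ((fun i => f i \- g i : {linear X i -> Y i}) (i + 1) x).
Proof. by rewrite /= !cm_comm linearB. Qed.

Definition ch_sub X Y (f g : chmap X Y) : chmap X Y := ChMap (@sub_comm X Y f g).

Lemma ch_factor_epi X Y T (g : chmap X Y) (h : chmap X T) :
  ch_epi g -> (forall i x, g i x = 0 -> h i x = 0) ->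
  exists k : chmap Y T, ch_eq (ch_comp k g) h.
Proof.
move=> ge gh; pose kP i := cid (factor_epi (ge i) (gh i)).
pose k i := projT1 (kP i); have kE i x : k i (g i x) = h i x by exact: (projT2 (kP i)).
have kc i x : k i (c_d Y i x) = c_d T i (k (i + 1) x).
  by have [y <-] := ge _ x; rewrite -cm_comm !kE cm_comm.
by exists (ChMap kc) => i x; exact: kE.
Qed.

Lemma ch_factor_mono X Y T (f : chmap X Y) (h : chmap T Y) :
  ch_mono f -> (forall i t, exists x, f i x = h i t) ->
  exists k : chmap T X, ch_eq (ch_comp f k) h.
Proof.
move=> fm fh; pose kP i := cid (factor_mono (fm i) (fh i)).
pose k i := projT1 (kP i); have kE i x : f i (k i x) = h i x by exact: (projT2 (kP i)).
have kc i x : k i (c_d T i x) = c_d X i (k (i + 1) x).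
  by apply: (fm i); rewrite cm_comm !kE cm_comm.
by exists (ChMap kc) => i x; exact: kE.
Qed.

Lemma ch_mono0 X Y (f : chmap X Y) :
  (forall i x, f i x = 0 -> x = 0) -> ch_mono f.
Proof. by move=> f0 i; apply: inj_ker0; exact: f0. Qed.

Section Product.
Context (X Y : complex R).

Definition prod_d_fun i (p : X (i + 1) * Y (i + 1)) : X i * Y i :=
  (c_d X i p.1, c_d Y i p.2).

Lemma prod_d_linear i : linear (@prod_d_fun i).
Proof. by move=> a p q; rewrite /prod_d_fun /= !linearP. Qed.

Lemma prod_dd i (p : X (i + 1 + 1) * Y (i + 1 + 1)) :
  lin (@prod_d_linear i) (lin (@prod_d_linear (i + 1)) p) = 0.
Proof. by rewrite /= /prod_d_fun /= !c_dd. Qed.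

Definition ch_prod : complex R :=
  @Complex R (fun i => (X i * Y i)%type) (fun i => lin (@prod_d_linear i)) prod_dd.

Lemma fst_comm i (x : ch_prod (i + 1)) : (fun i => fst : {linear ch_prod i -> X i}) i
  (c_d ch_prod i x) = c_d X i ((fun i => fst : {linear ch_prod i -> X i}) (i + 1) x).
Proof. by []. Qed.

Definition ch_fst : chmap ch_prod X := ChMap fst_comm.

Lemma snd_comm i (x : ch_prod (i + 1)) : (fun i => snd : {linear ch_prod i -> Y i}) i
  (c_d ch_prod i x) = c_d Y i ((fun i => snd : {linear ch_prod i -> Y i}) (i + 1) x).
Proof. by []. Qed.

Definition ch_snd : chmap ch_prod Y := ChMap snd_comm.

Lemma pair_linear T (f : chmap T X) (g : chmap T Y) i :
  linear (fun t => (f i t, g i t) : ch_prod i).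
Proof. by move=> a s t; rewrite !linearP. Qed.

Lemma pair_comm T (f : chmap T X) (g : chmap T Y) i x :
  (fun i => lin (pair_linear f g (i := i))) i (c_d T i x) =
  c_d ch_prod i ((fun i => lin (pair_linear f g (i := i))) (i + 1) x).
Proof. by rewrite /= /prod_d_fun /= !cm_comm. Qed.

Definition ch_pair T (f : chmap T X) (g : chmap T Y) : chmap T ch_prod :=
  @ChMap R T ch_prod (fun i => lin (pair_linear f g (i := i))) (pair_comm f g).

Definition ch_copair T (f : chmap X T) (g : chmap Y T) : chmap ch_prod T :=
  ch_add (ch_comp f ch_fst) (ch_comp g ch_snd).

Definition ch_inl : chmap X ch_prod := ch_pair (ch_id X) (ch_zero X Y).
Definition ch_inr : chmap Y ch_prod := ch_pair (ch_zero Y X) (ch_id Y).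

Lemma ses_inl_snd : ses ch_inl ch_snd.
Proof.
split=> i; first by move=> x y [].
- move=> [x y] /=; split=> [->|[z [_ <-]]] //; by exists x.
- by move=> y; exists (0, y).
Qed.

End Product.

Lemma ch_kernel X Y (g : chmap X Y) : exists f : chmap (ker_complex g) X,
  [/\ forall i x, f i x = ker_val x, ch_mono f & ch_exact f g].
Proof.
have lk i : linear (@ker_val R _ _ (g i)) by [].
have kc i (x : ker_complex g (i + 1)) :
    lin (lk i) (c_d (ker_complex g) i x) = c_d X i (lin (lk (i + 1)) x) by [].
exists (ChMap kc); split=> // i; first by move=> x y /val_inj.
move=> x; split=> [/in_kerP gx|[k <-]]; first by exists (Ker gx).
exact/in_kerP/ker_valP.
Qed.

Lemma ker_ses X Y (g : chmap X Y) : ch_epi g ->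
  exists f : chmap (ker_complex g) X, (forall i x, f i x = ker_val x) /\ ses f g.
Proof. by move=> ge; have [f [fE fm fg]] := ch_kernel g; exists f. Qed.

Lemma epi_ses X Y (g : chmap X Y) : ch_epi g -> exists K (f : chmap K X), ses f g.
Proof. by move=> /ker_ses[f [_ fg]]; exists (ker_complex g), f. Qed.

Lemma mono_ses X Y (f : chmap X Y) : ch_mono f -> exists Z (g : chmap Y Z), ses f g.
Proof.
move=> fm; pose Q i : lmodType R := coker (f i).
pose p i : {linear Y i -> Q i} := lin (@coker_pi_linear _ _ _ (f i)).
have pe i : surjective (p i) by move=> y; exists (repr y); exact: coker_repr.
have pE i : exact_mod (f i) (p i).
  move=> y; split=> [/(coker_piP (f i) y 0)|[x fx]]; first by rewrite subr0.
  by apply/(coker_piP (f i) y 0); exists x; rewrite subr0.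
have dP i : exists d : {linear Q (i + 1) -> Q i}, forall y, d (p _ y) = p i (c_d Y i y).
  apply: (factor_epi (h := p i \o c_d Y i) (pe _)) => y /pE[x <-].
  by apply/pE; exists (c_d X i x); rewrite cm_comm.
pose d i := projT1 (cid (dP i)).
have dE i y : d i (p _ y) = p i (c_d Y i y) by rewrite /d; case: cid.
have dd i x : d i (d (i + 1) x) = 0.
  by have [y <-] := pe _ x; rewrite !dE c_dd linear0.
have pc i x : p i (c_d Y i x) = c_d (@Complex R Q d dd) i (p (i + 1) x) by rewrite -dE.
by exists (@Complex R Q d dd), (@ChMap R Y (@Complex R Q d dd) p pc).
Qed.

Definition ch_iso X Y := exists (f : chmap X Y) (g : chmap Y X),
  (forall i, cancel (f i) (g i)) /\ (forall i, cancel (g i) (f i)).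

Lemma bij_ch_iso X Y (f : chmap X Y) : ch_mono f -> ch_epi f -> ch_iso X Y.
Proof.
move=> fm fe; have [g gE] := ch_factor_mono (h := ch_id Y) fm fe.
by exists f, g; split=> i x; [apply: fm; exact: (gE i (f i x)) | exact: gE].
Qed.

Lemma ch_iso_sym X Y : ch_iso X Y -> ch_iso Y X.
Proof. by move=> [f [g [fK gK]]]; exists g, f. Qed.

Lemma ch_iso_bij X Y : ch_iso X Y -> exists f : chmap X Y, ch_mono f /\ ch_epi f.
Proof.
move=> [f [g [fK gK]]]; exists f; split=> i; first exact: can_inj (fK i).
by move=> y; exists (g i y); exact: gK.
Qed.

Section Pullback.
Context E B Y Z (p : chmap E B) (q : chmap E Y) (b : chmap B Z) (g : chmap Y Z).

Definition is_pullback :=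
  [/\ ch_eq (ch_comp b p) (ch_comp g q),
      forall i x y, b i x = g i y -> exists e, p i e = x /\ q i e = y
    & forall i e, p i e = 0 -> q i e = 0 -> e = 0].

Hypothesis pb : is_pullback.

Lemma pullback_inj i e e' : p i e = p i e' -> q i e = q i e' -> e = e'.
Proof.
have [_ _ pb0] := pb; move=> pe qe; apply/subr0_eq/pb0.
  by rewrite linearB pe subrr.
by rewrite linearB qe subrr.
Qed.

Lemma pullback_factor T (x : chmap T B) (y : chmap T Y) :
  ch_eq (ch_comp b x) (ch_comp g y) ->
  exists e : chmap T E, ch_eq (ch_comp p e) x /\ ch_eq (ch_comp q e) y.
Proof.
have [_ pbE _] := pb; move=> xy.
have [|i t|e eE] := ch_factor_mono (f := ch_pair p q) (h := ch_pair x y).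
- by move=> i s t [ps qs]; exact: pullback_inj.
- by have [e [pe qe]] := pbE i _ _ (xy i t); exists e; rewrite /= pe qe.
- by exists e; split=> i t; have [] := eE i t.
Qed.

Lemma pullback_ses A (a : chmap A B) : ses a b ->
  exists a' : chmap A E, ses a' q /\ ch_eq (ch_comp p a') a.
Proof.
have [pbc pbE pb0] := pb; move=> ab; have [am abE be] := ab.
have [i x|a' [pa qa]] := @pullback_factor _ a (ch_zero A Y).
  by rewrite /= (ses_comp0 ab) linear0.
exists a'; split=> //; split=> i.
- by move=> x y xy; apply: (am i); rewrite -[LHS](pa i) -[RHS](pa i) /= xy.
- move=> e; split=> [e0|[x <-]]; last exact: qa.
  have /abE[x xE] : b i (p i e) = 0 by rewrite [LHS](pbc i e) /= e0 linear0.
  exists x; apply: pullback_inj; first by rewrite [LHS](pa i).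
  by rewrite [LHS](qa i) e0.
- by move=> y; have [x xE] := be i (g i y); have [e [_ eE]] := pbE i _ _ xE; exists e.
Qed.

End Pullback.

Lemma pullback_sym E B Y Z (p : chmap E B) (q : chmap E Y) (b : chmap B Z)
  (g : chmap Y Z) : is_pullback p q b g -> is_pullback q p g b.
Proof.
move=> [pc pE p0]; split=> [i e|i x y xy|i e qe pe]; last exact: p0.
  by rewrite [RHS]pc.
by have [e []] := pE i _ _ (esym xy); exists e.
Qed.

Lemma pullback_exists B Y Z (b : chmap B Z) (g : chmap Y Z) :
  exists E (p : chmap E B) (q : chmap E Y), is_pullback p q b g.
Proof.
pose k := ch_sub (ch_comp b (ch_fst B Y)) (ch_comp g (ch_snd B Y)).
have [c [_ c_mono cE]] := ch_kernel k.
exists (ker_complex k), (ch_comp (ch_fst B Y) c), (ch_comp (ch_snd B Y) c).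
split=> [i e|i x y xy|i e /= p0 q0].
- by apply/subr0_eq; apply/cE; exists e.
- have [|e eE] := (cE i (x, y)).1; first by rewrite /= xy subrr.
  by exists e; rewrite /= eE.
- by apply: (c_mono i); rewrite linear0; case: (c i e) p0 q0 => /= ? ? -> ->.
Qed.

(** [E] is the preimage under [b] of the subobject [X] of [Y]. *)
Lemma pullback_comp_ses E B X Y Z (p : chmap E B) (q : chmap E X) (b : chmap B Y)
    (f : chmap X Y) (g : chmap Y Z) :
  is_pullback p q b f -> ses f g -> ch_epi b -> ses p (ch_comp g b).
Proof.
move=> [pbc pbE pb0] [fm fgE ge] be; split=> i.
- apply: inj_ker0 => e p0; apply: (pb0 i) => //; apply: (fm i).
  by rewrite -[LHS](pbc i) /= p0 !linear0.
- move=> x; split=> [/fgE[k kx]|[e <-]].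
    by have [e [eu _]] := pbE i _ _ (esym kx); exists e.
  by apply/fgE; exists (q i e); rewrite -[LHS](pbc i).
- by move=> z; have [y <-] := ge i z; have [x <-] := be i y; exists x.
Qed.

(** The third isomorphism theorem: [W] is Q/X, with subobject Y/X and quotient Q/Y. *)
Lemma coker_comp_ses X Y Z Q Y' (f : chmap X Y) (g : chmap Y Z) (a : chmap Y Q)
    (p : chmap Q Y') : ses f g -> ses a p ->
  exists W (r : chmap Q W) (u : chmap Z W) (v : chmap W Y'),
    ses (ch_comp a f) r /\ ses u v.
Proof.
move=> fg ap; have [fm fgE ge] := fg; have [am apE pe] := ap.
have gf := ses_comp0 fg; have pa := ses_comp0 ap.
have af : ch_mono (ch_comp a f) by move=> i x y /(am i)/(fm i).
have [W [r cr]] := mono_ses af; have [_ crE re] := cr; have rc := ses_comp0 cr.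
have [i x /fgE[y <-]|u uE] := ch_factor_epi (h := ch_comp r a) ge; first exact: rc.
have [i x /crE[y <-]|v vE] := ch_factor_epi (h := p) re; first exact: pa.
exists W, r, u, v; split=> //; split=> i.
- apply: inj_ker0 => x; have [y <-] := ge i x.
  by rewrite [u i _](uE i y) => /crE[z /(am i) <-]; exact: gf.
- move=> x; split=> [|[y <-]]; last first.
    by have [z <-] := ge i y; rewrite [u i _](uE i z) [LHS](vE i).
  have [y <-] := re i x; rewrite [v i _](vE i) => /apE[z <-].
  by exists (g i z); exact: uE.
- by move=> y; have [x <-] := pe i y; exists (r i x); exact: vE.
Qed.

(** Projectivity of [P'] lifts [q] through [g]. The cover [P] is arbitrary; in [Ddim_ext] it is
    merely D_C-projective. *)
Lemma horseshoe X Y Z K P K' P' (f : chmap X Y) (g : chmap Y Z) (a : chmap K P)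
    (p : chmap P X) (b : chmap K' P') (q : chmap P' Z) :
  ses f g -> ses a p -> ses b q -> projective_complex P' ->
  exists L (c : chmap L (ch_prod P P')) (r : chmap (ch_prod P P') Y)
    (u : chmap K L) (v : chmap L K'), ses c r /\ ses u v.
Proof.
move=> fg ap bq prP'.
have [fm fgE ge] := fg; have [am apE pe] := ap; have [bm bqE qe] := bq.
have gf := ses_comp0 fg.
have [l lE] := prP' _ _ g q ge.
pose r := ch_copair (ch_comp f p) l.
have re : ch_epi r.
  move=> i y; have [z zE] := qe i (g i y).
  have /fgE[x xE] : g i (y - l i z) = 0 by rewrite linearB [g i (l i z)](lE i) zE subrr.
  by have [w wE] := pe i x; exists (w, z); rewrite /= wE xE subrK.
have [L [c cr]] := epi_ses re; have [c_mono crE _] := cr; have rc := ses_comp0 cr.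
have [i x|u uE] := ch_factor_mono (h := ch_comp (ch_inl P P') a) c_mono.
  by apply/crE; rewrite /= (ses_comp0 ap) !linear0 addr0.
have [i x|v vE] := ch_factor_mono (h := ch_comp (ch_snd P P') c) bm.
  apply/bqE; have /= := rc i x => /(congr1 (g i)).
  by rewrite linearD gf add0r linear0 [g i (l i _)](lE i).
exists L, c, r, u, v; split=> //; split=> i.
- by move=> x y /(congr1 (c i)); rewrite [LHS](uE i) [RHS](uE i) => -[/(am i)].
- move=> x; split=> [x0|[y <-]]; last first.
    by apply: (bm i); rewrite [LHS](vE i) /= [c i _](uE i) linear0.
  have c2 : (c i x).2 = 0 by rewrite -[LHS](vE i) /= x0 linear0.
  have /= := rc i x; rewrite c2 linear0 addr0 -(linear0 (f i)) => /(fm i)/apE[y yE].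
  exists y; apply: (c_mono i); rewrite [LHS](uE i) /= yE -[0]c2.
  by case: (c i x).
- move=> x; have /fgE[y yE] : g i (l i (b i x)) = 0.
    by rewrite [LHS](lE i); apply/bqE; exists x.
  have [z zE] := pe i (- y).
  have [|w wE] := (crE i (z, b i x)).1; first by rewrite /= zE linearN yE addNr.
  by exists w; apply: (bm i); rewrite [LHS](vE i) /= wE.
Qed.

Lemma pushout_ses X Y Z W V (f : chmap X Y) (g : chmap Y Z) (h : chmap X W)
    (k : chmap W V) : ses f g -> ses h k ->
  exists E (w : chmap W E) (e : chmap E Z) (y : chmap Y E) (v : chmap E V),
    ses w e /\ ses y v.
Proof.
(* The pushout, the quotient of Y x W by all (f x, - h x), is symmetric in [Y] and [W]; [half]
   yields one of the two sequences and is used twice with the roles exchanged. *)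
suff half X1 Y1 Z1 W1 (f1 : chmap X1 Y1) (g1 : chmap Y1 Z1) (h1 : chmap X1 W1) E1
    (y1 : chmap Y1 E1) (w1 : chmap W1 E1) : ses f1 g1 -> ch_mono h1 ->
    ch_epi (ch_copair y1 w1) ->
    (forall i s t, y1 i s + w1 i t = 0 <-> exists x, f1 i x = s /\ h1 i x = - t) ->
    exists e : chmap E1 Z1, ses w1 e.
  move=> fg hk; have [fm fgE ge] := fg; have [hm hkE ke] := hk.
  have [|E [p [_ pE pe]]] := @mono_ses _ _ (ch_pair f (ch_sub (ch_zero X W) h)).
    by move=> i s t [/(fm i)].
  pose y := ch_comp p (ch_inl Y W); pose w := ch_comp p (ch_inr Y W).
  have yw i s t : y i s + w i t = p i (s, t).
    by rewrite /= -linearD; congr (p i _); apply: (congr2 pair); rewrite ?addr0 ?add0r.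
  have yw0 i s t : y i s + w i t = 0 <-> exists x, f i x = s /\ h i x = - t.
    rewrite yw; split=> [/pE[x [<- <-]]|[x [<- hx]]].
      by exists x; rewrite sub0r opprK.
    by apply/pE; exists x; rewrite /= sub0r hx opprK.
  have [|e we] := half _ _ _ _ f g h E y w fg hm _ yw0.
    by move=> i x; have [[s t] st] := pe i x; exists (s, t); rewrite -st -yw.
  have [|i s t|v yv] := half _ _ _ _ h k f E w y hk fm.
  - by move=> i x; have [[s t] st] := pe i x; exists (t, s); rewrite -st -yw /= addrC.
  - rewrite addrC yw0; split=> [[x [<- hx]]|[x [hx fx]]].
      by exists (- x); rewrite !linearN hx opprK.
    by exists (- x); rewrite !linearN hx fx opprK.
  by exists E, w, e, y, v.
move=> [fm fgE ge] hm ye yw0.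
have gf i x : g1 i (f1 i x) = 0 by apply/fgE; exists x.
have [i [s t] /= /yw0[x [<- _]]|e eE] :=
  ch_factor_epi (h := ch_comp g1 (ch_fst Y1 W1)) ye; first exact: gf.
have ew i t : e i (w1 i t) = 0.
  have := eE i (0, t); by rewrite /= !linear0 add0r.
have ey i s : e i (y1 i s) = g1 i s.
  have := eE i (s, 0); by rewrite /= !linear0 addr0.
exists e; split=> i.
- apply: inj_ker0 => t t0; have [|x [x0 xt]] := (yw0 i 0 t).1.
    by rewrite linear0 add0r.
  have x00 : x = 0 by apply: (fm i); rewrite x0 linear0.
  by rewrite -[t]opprK -xt x00 linear0 oppr0.
- move=> z; split=> [|[t <-]]; last exact: ew.
  have [[s t] <-] := ye i z; rewrite /= linearD ew addr0 ey => /fgE[x xs].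
  exists (t + h1 i x); rewrite linearD addrC; congr (_ + _); apply/esym/subr0_eq.
  by rewrite -linearN; apply/yw0; exists x; rewrite opprK.
- by move=> z; have [s <-] := ge i z; exists (y1 i s).
Qed.

Definition zero_mod : lmodType R := ker (idfun : {linear R^o -> R^o}).

Lemma zero_modP (x : zero_mod) : x = 0.
Proof. by apply: val_inj; have /in_kerP := ker_valP x. Qed.

Definition zero_cx : complex R :=
  @Complex R (fun=> zero_mod) (fun=> \0) (fun _ _ => erefl).

Lemma zero_cxP : zero_complex zero_cx.
Proof. by move=> i x; exact: zero_modP. Qed.

End ComplexConstructions.

(** * Direct sums of disks *)

Section DiskSums.
Context (R : comPzRingType).
Implicit Types (X Y B : complex R) (A : int -> lmodType R).

(* [A i] sits in the degrees [i] and [i - 1], so that this is the direct sum of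
   the contractible complexes [A i = A i]. *)
Definition disk_d_fun A i (p : A (i + 1) * A (i + 1 + 1)) : A i * A (i + 1) :=
  (0, p.1).

Lemma disk_d_linear A i : linear (@disk_d_fun A i).
Proof.
move=> a p q; rewrite /disk_d_fun /=.
by apply: (congr2 pair) => //=; rewrite scaler0 addr0.
Qed.

Lemma disk_dd A i (p : A (i + 1 + 1) * A (i + 1 + 1 + 1)) :
  lin (@disk_d_linear A i) (lin (@disk_d_linear A (i + 1)) p) = 0.
Proof. by []. Qed.

Definition disks A : complex R :=
  @Complex R (fun i => (A i * A (i + 1)%R)%type) (fun i => lin (@disk_d_linear A i))
    (@disk_dd A).

Section Out.
Context A B (g : forall i, {linear A i -> B i}).

Lemma disk_out_linear i :
  linear (fun p : disks A i => g i p.1 + c_d B i (g (i + 1) p.2)).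
Proof. by move=> a p q; rewrite !linearP scalerDr addrACA. Qed.

Lemma disk_out_comm i (p : disks A (i + 1)) :
  lin (@disk_out_linear i) (c_d (disks A) i p) =
  c_d B i (lin (@disk_out_linear (i + 1)) p).
Proof. by rewrite /= linear0 add0r linearD c_dd addr0. Qed.

(** Chain maps out of [disks A] are families of linear maps from [A i] to [B i], with inverse
    correspondence [disk_in]. This reduces lifting and extension problems for disks to modules. *)
Definition disk_out : chmap (disks A) B := ChMap disk_out_comm.

End Out.

Definition disk_in A B (u : chmap (disks A) B) i : {linear A i -> B i} :=
  u i \o lin_inl (A i) (A (i + 1)).

Lemma disk_inK A B (u : chmap (disks A) B) : ch_eq (disk_out (disk_in u)) u.
Proof.
move=> i [x y] /=; rewrite -(@cm_comm _ _ _ u i) -linearD; congr (u i _).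
by apply: (congr2 pair) => /=; [exact: addr0 | exact: add0r].
Qed.

Section DiskMap.
Context A A' (f : forall i, {linear A i -> A' i}).

Lemma disk_map_linear i : linear (fun p : disks A i => (f i p.1, f (i + 1) p.2) : disks A' i).
Proof. by move=> a p q; rewrite !linearP. Qed.

Lemma disk_map_comm i (p : disks A (i + 1)) :
  lin (@disk_map_linear i) (c_d (disks A) i p) =
  c_d (disks A') i (lin (@disk_map_linear (i + 1)) p).
Proof. by apply: (congr2 pair) => //=; exact: linear0. Qed.

Definition disk_map : chmap (disks A) (disks A') :=
  @ChMap R (disks A) (disks A') (fun i => lin (@disk_map_linear i)) disk_map_comm.

Lemma disk_map_epi : (forall i, surjective (f i)) -> ch_epi disk_map.
Proof.
move=> fs i [x y]; have [a <-] := fs _ x; have [b <-] := fs _ y.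
by exists (a, b).
Qed.

Lemma disk_map_mono : (forall i, injective (f i)) -> ch_mono disk_map.
Proof. by move=> fi i [x y] [x' y'] [/fi -> /fi ->]. Qed.

End DiskMap.

Lemma disk_map_exact A A' A'' (f : forall i, {linear A i -> A' i})
    (g : forall i, {linear A' i -> A'' i}) :
  (forall i, exact_mod (f i) (g i)) -> ch_exact (disk_map f) (disk_map g).
Proof.
move=> fg i [x y]; split=> [[/fg[a <-] /fg[b <-]]|[[a b] [<- <-]]].
  by exists (a, b).
by apply: (congr2 pair) => /=; apply/fg; [exists a | exists b].
Qed.

Lemma disk_out_map A A' B (g : forall i, {linear A' i -> B i})
    (f : forall i, {linear A i -> A' i}) (v : chmap (disks A) B) :
  (forall i x, disk_in v i x = g i (f i x)) ->
  ch_eq v (ch_comp (disk_out g) (disk_map f)).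
Proof.
move=> vE i p; rewrite -(@disk_inK _ _ v i p).
by rewrite -[RHS]/(g i (f i p.1) + c_d B i (g _ (f _ p.2))) -!vE.
Qed.

Lemma disk_map_hexact A A' A'' B (f : forall i, {linear A i -> A' i})
    (g : forall i, {linear A' i -> A'' i}) :
  (forall i, hexact (B i) (f i) (g i)) ->
  forall u : chmap (disks A') B, ch_null (ch_comp u (disk_map f)) ->
    exists v : chmap (disks A'') B, ch_eq u (ch_comp v (disk_map g)).
Proof.
move=> ex u uf.
have vP i : exists v : {linear A'' i -> B i}, forall y, disk_in u i y = v (g i y).
  apply: ex => x; rewrite -[RHS](uf i ((x, 0) : disks A i)) /=.
  by congr (u i (_, _)); rewrite linear0.
exists (disk_out (fun i => projT1 (cid (vP i)))).
by apply: disk_out_map => i x; exact: (projT2 (cid (vP i))).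
Qed.

Lemma disks_projective A : (forall i, projective_module (A i)) ->
  projective_complex (disks A).
Proof.
move=> prA X Y g f ge.
have hP i : exists h : {linear A i -> X i}, forall x, g i (h x) = disk_in f i x.
  by apply: prA; exact: ge.
pose h i := projT1 (cid (hP i)).
have hE i x : g i (h i x) = disk_in f i x by exact: (projT2 (cid (hP i))).
exists (disk_out h) => i p.
rewrite -[RHS](@disk_inK _ _ f i p).
rewrite -[RHS]/(disk_in f i p.1 + c_d Y i (disk_in f _ p.2)) -!hE.
by rewrite /= linearD cm_comm.
Qed.

Definition iso_closed (cX : mod_class R) :=
  forall (M N : lmodType R) (f : {linear M -> N}), injective f -> surjective f ->
    cX M -> cX N.

Lemma bij_inverse (M N : lmodType R) (f : {linear M -> N}) :
  injective f -> surjective f ->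
  exists g : {linear N -> M}, cancel f g /\ cancel g f.
Proof.
move=> fi fs; have [g gE] := factor_mono (f := f) (h := idfun) fi fs.
by exists g; split=> x; [apply: fi; exact: gE | exact: gE].
Qed.

Lemma projective_iso_closed : iso_closed (@projective_module R).
Proof.
move=> M N f fi fs prM X Y g h gs; have [k [fK kK]] := bij_inverse fi fs.
have [l lE] := prM _ _ g (h \o f) gs.
by exists (l \o k) => x; rewrite /= lE /= kK.
Qed.

Lemma tensor_class_iso_closed C cX : iso_closed (tensor_class C cX).
Proof.
move=> M N f fi fs [P [b [cP tb]]]; have [k [fK kK]] := bij_inverse fi fs.
by exists P, (fun x y => f (b x y)); split=> //; exact: (tensor_iso tb fK kK).
Qed.

Lemma tilde_iso (cX : mod_class R) X Y :
  iso_closed cX -> ch_iso X Y -> tilde cX X -> tilde cX Y.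
Proof.
move=> icX /ch_iso_bij[f [fm fe]] [exX cZ]; split=> i.
  move=> y; split=> [|[z <-]]; last exact: c_dd.
  have [x <-] := fe _ y; rewrite -cm_comm -(linear0 (f i)) => /(fm i)/exX[w <-].
  by exists (f _ w); rewrite cm_comm.
have fk (x : X (i + 1)) : c_d X i x = 0 -> c_d Y i (f _ x) = 0.
  by move=> x0; rewrite -cm_comm x0 linear0.
apply: (icX _ _ (ker_map fk) _ _ (cZ i)).
  by move=> x y /(congr1 (@ker_val _ _ _ _))/(fm (i + 1))/val_inj.
move=> y; have [x xy] := fe _ (ker_val y).
have x0 : c_d X i x = 0.
  apply: (fm i); rewrite cm_comm xy linear0; apply/in_kerP; exact: ker_valP.
by exists (Ker (introT (in_kerP _ _) x0)); exact: val_inj.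
Qed.

(** The cycles in degree [i + 1] are the second summand, [A (i + 1 + 1)]. *)
Lemma disks_tilde (cX : mod_class R) A :
  iso_closed cX -> (forall i, cX (A i)) -> tilde cX (disks A).
Proof.
move=> icX cA; split=> i.
  by move=> [x y]; split=> [[/= ->]|[z <-]] //; exists (y, 0).
have kP y : (lin_inr (A (i + 1)) (A (i + 1 + 1)) y : disks A (i + 1)) \in
    in_ker (c_d (disks A) i) by apply/in_kerP.
have lk : linear (fun y => Ker (kP y)).
  by move=> a x y; apply: val_inj; exact: lin_inr_linear.
apply: (icX _ _ (lin lk) _ _ (cA (i + 1 + 1))).
  by move=> x y /(congr1 (@ker_val _ _ _ _)) [].
move=> [[x y] xyP]; have /in_kerP[/= x0] := xyP.
by exists y; apply: val_inj; rewrite /= x0.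
Qed.

(** [A i] is Z_(i-1)(X), which the splitting embeds in degree [i] as a complement of the cycles. *)
Lemma tilde_disks (cX : mod_class R) X :
  tilde cX X ->
  (forall i, exists s : {linear ker (c_d X i) -> X (i + 1 + 1)},
     forall a, c_d X (i + 1) (s a) = ker_val a) ->
  exists A, (forall i, cX (A i)) /\ ch_iso (disks A) X.
Proof.
move=> [exX cZ] split.
(* The splitting lives in degrees of the form [j + 1 + 1], but [A] needs a value at every [i].
   Quantifying over [e : i = j + 1] confines the transport to this statement: in degree [j + 1] one
   takes [e := erefl]. *)
have AP i : exists As : {A : lmodType R & {linear A -> X i}}, cX (projT1 As) /\
    forall j (e : i = j + 1),
      let s := eq_rect i (fun k => {linear projT1 As -> X k}) (projT2 As) (j + 1) e in
      (forall a, c_d X j (s a) = 0 -> a = 0) /\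
      (forall x, exists a, c_d X j (s a) = c_d X j x).
  have [j ->] : exists j, i = j + 1 + 1 by exists (i - 1 - 1); rewrite !subrK.
  have [s sE] := split j.
  exists (existT _ (ker (c_d X j) : lmodType R) s); split=> [|k e] /=; first exact: cZ.
  have jk := addIr _ e; subst k; rewrite (eq_irrelevance e erefl) /=; split=> [a|x].
    by rewrite sE => a0; exact: val_inj.
  by exists (Ker (introT (in_kerP _ _) (@c_dd _ X j x))); rewrite sE.
pose A i := projT1 (projT1 (cid (AP i))).
pose s i : {linear A i -> X i} := projT2 (projT1 (cid (AP i))).
have sP i := projT2 (cid (AP i)).
have s_inj i a : c_d X i (s (i + 1) a) = 0 -> a = 0.
  by have [_ /(_ i erefl)[+ _]] := sP (i + 1); apply.
have s_surj i x : exists a, c_d X i (s (i + 1) a) = c_d X i x.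
  by have [_ /(_ i erefl)[_]] := sP (i + 1); apply.
exists A; split=> [i|]; first by have [] := sP i.
apply: (@bij_ch_iso _ _ _ (disk_out s)).
  apply: ch_mono0 => i; have [j ->] : exists j, i = j + 1 by exists (i - 1); rewrite subrK.
  move=> [a b] /= ab0.
  have a0 : a = 0.
    apply: s_inj; have := congr1 (c_d X j) ab0.
    by rewrite linearD c_dd addr0 linear0.
  rewrite a0 linear0 add0r in ab0 *; by rewrite (s_inj _ _ ab0).
move=> i; have [j ->] : exists j, i = j + 1 by exists (i - 1); rewrite subrK.
move=> x; have [a ax] := s_surj _ x.
have /exX[y yx] : c_d X j (x - s (j + 1) a) = 0 by rewrite linearB ax subrr.
have [b by_] := s_surj _ y; exists (a, b) => /=.
by rewrite by_ yx; exact: etrans (addrC _ _) (subrK _ _).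
Qed.

Lemma enough_projective_complexes X : exists K P (f : chmap K P) (g : chmap P X),
  [/\ ses f g, projective_complex P & tilde (@projective_module R) P].
Proof.
have cP i : exists Pg : {P : lmodType R & {linear P -> X i}},
    projective_module (projT1 Pg) /\ surjective (projT2 Pg).
  by have [P [g [prP gs]]] := enough_projectives (X i); exists (existT _ P g).
pose A i := projT1 (projT1 (cid (cP i))).
pose g i : {linear A i -> X i} := projT2 (projT1 (cid (cP i))).
have prA i : projective_module (A i) by have [] := projT2 (cid (cP i)).
have gs i : surjective (g i) by have [] := projT2 (cid (cP i)).
have [|K [f fg]] := @epi_ses _ _ _ (disk_out g).
  by move=> i x; have [a <-] := gs i x; exists (a, 0); rewrite /= !linear0 addr0.
exists K, (disks A), f, (disk_out g); split=> //.
  exact: disks_projective.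
by apply: disks_tilde => //; exact: projective_iso_closed.
Qed.

Lemma tilde_projective_disks X : tilde (@projective_module R) X ->
  exists A, (forall i, projective_module (A i)) /\ ch_iso (disks A) X.
Proof.
move=> tX; have [exX prZ] := tX; apply: tilde_disks => // i.
have lk : linear (@ker_val R _ _ (c_d X i)) by [].
have [a|s sE] := proj_lift (g := c_d X (i + 1)) (f := lin lk) (prZ i).
  by apply/exX/in_kerP; exact: ker_valP.
by exists s.
Qed.

Lemma projective_complex_iso X Y : ch_iso X Y -> projective_complex X -> projective_complex Y.
Proof.
move=> [f [k [fK kK]]] prX M N g h ge.
have [l lE] := prX _ _ g (ch_comp h f) ge.
by exists (ch_comp l k) => i x; rewrite -[x in RHS]kK; exact: lE.
Qed.

Lemma tilde_projective X : tilde (@projective_module R) X -> projective_complex X.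
Proof.
move=> /tilde_projective_disks[A [prA /projective_complex_iso]]; apply.
exact: disks_projective.
Qed.

End DiskSums.

(** * Vanishing of Ext *)

Section Ext.
Context (R : comPzRingType).
Implicit Types X Y Z K P Q H : complex R.

(** Vanishing of the Yoneda Ext^1(X, Y): for [A = Y] and [u] the identity, it says that every
    extension of [X] by [Y] splits. *)
Definition ext1_zero X Y := forall A B (f : chmap A B) (g : chmap B X), ses f g ->
  forall u : chmap A Y, exists v : chmap B Y, ch_eq (ch_comp v f) u.

(* [Ext^(m+1)(X, Y) = 0]. *)
Fixpoint extS_zero m X Y : Prop :=
  if m is k.+1 then
    forall K P (f : chmap K P) (g : chmap P X), ses f g -> projective_complex P ->
      extS_zero k K Y
  else ext1_zero X Y.

Lemma ext1_zero_retraction K P X (f : chmap K P) (g : chmap P X) :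
  ext1_zero X K -> ses f g -> exists r : chmap P K, ch_eq (ch_comp r f) (ch_id K).
Proof. by move=> XK fg; exact: (XK _ _ _ _ fg). Qed.

Lemma retraction_section K P X (f : chmap K P) (g : chmap P X) (r : chmap P K) :
  ses f g -> ch_eq (ch_comp r f) (ch_id K) ->
  exists s : chmap X P, ch_eq (ch_comp g s) (ch_id X).
Proof.
move=> fg rf; have [fm ex ge] := fg.
have [i x /ex[y <-]|s sE] := ch_factor_epi (h := ch_sub (ch_id P) (ch_comp f r)) ge.
  by rewrite /= [r i _](rf i y) subrr.
exists s => i x; have [y <-] := ge i x; rewrite /= [s i _](sE i y) /=.
by rewrite linearB (ses_comp0 fg) subr0.
Qed.

Lemma section_retraction K P X (f : chmap K P) (g : chmap P X) (s : chmap X P) :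
  ses f g -> ch_eq (ch_comp g s) (ch_id X) ->
  exists r : chmap P K,
    ch_eq (ch_comp f r) (ch_sub (ch_id P) (ch_comp s g)) /\
    ch_eq (ch_comp r f) (ch_id K).
Proof.
move=> fg gs; have [fm ex ge] := fg.
have [i x|r rE] := ch_factor_mono (h := ch_sub (ch_id P) (ch_comp s g)) fm.
  by apply/ex; rewrite /= linearB [g i (s i _)](gs i _) subrr.
exists r; split=> // i x; apply: (fm i); rewrite [LHS](rE i) /=.
by rewrite (ses_comp0 fg) linear0 subr0.
Qed.

Lemma projective_ext1 X Y : projective_complex X -> ext1_zero X Y.
Proof.
move=> prX A B f g fg u; have [_ _ ge] := fg.
have [s sE] := prX _ _ g (ch_id X) ge.
have [r [_ rE]] := section_retraction fg sE.
by exists (ch_comp u r) => i x; rewrite /= [r i _](rE i x).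
Qed.

Lemma projective_retract X P (i : chmap X P) (r : chmap P X) :
  ch_eq (ch_comp r i) (ch_id X) -> projective_complex P -> projective_complex X.
Proof.
move=> ri prP M N g f ge; have [h hE] := prP _ _ g (ch_comp f r) ge.
exists (ch_comp h i) => j x; rewrite [LHS](hE j (i j x)) /=.
by rewrite [r j _](ri j x).
Qed.

Lemma projective_extS m X Y : projective_complex X -> extS_zero m X Y.
Proof.
elim: m X => [|m IHm] X prX; first exact: projective_ext1.
move=> K P f g fg prP; apply: IHm.
have [r rE] := ext1_zero_retraction (projective_ext1 prX) fg.
exact: (projective_retract rE).
Qed.

Lemma projective_prod X Y : projective_complex X -> projective_complex Y ->
  projective_complex (ch_prod X Y).
Proof.
move=> prX prY M N g f ge.
have [h hE] := prX _ _ g (ch_comp f (ch_inl X Y)) ge.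
have [k kE] := prY _ _ g (ch_comp f (ch_inr X Y)) ge.
exists (ch_copair h k) => i [x y] /=.
rewrite linearD [g i (h i x)](hE i x) [g i (k i y)](kE i y) /= -linearD.
by congr (f i _); apply: (congr2 pair) => /=; rewrite ?addr0 ?add0r.
Qed.

(** The map [u] is extended first to the preimage of [X] in [B], then to [B]. *)
Lemma ext1_ext X Y Z H (f : chmap X Y) (g : chmap Y Z) : ses f g ->
  ext1_zero X H -> ext1_zero Z H -> ext1_zero Y H.
Proof.
move=> fg XH ZH A B a b ab u.
have [E [p [q pb]]] := pullback_exists b f.
have [a' [aq pa]] := pullback_ses pb ab.
have [_ _ be] := ab.
have [v vE] := XH _ _ _ _ aq u.
have [w wE] := ZH _ _ _ _ (pullback_comp_ses pb fg be) v.
by exists w => i x; rewrite -[RHS](vE i) /= -[RHS](wE i) /= [p i _](pa i).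
Qed.

(** [B] is pulled back along [r]; through [s] it maps back into the pullback, where [u] extends. *)
Lemma ext1_retract X Y H (s : chmap X Y) (r : chmap Y X) :
  ch_eq (ch_comp r s) (ch_id X) -> ext1_zero Y H -> ext1_zero X H.
Proof.
move=> rs YH A B f g fg u.
have [E [p [q pb]]] := pullback_exists g r.
have [f' [fq pf]] := pullback_ses pb fg.
have [i x|k [pk qk]] := pullback_factor pb (x := ch_id B) (y := ch_comp s g).
  by rewrite /= [r i _](rs i).
have [v vE] := YH _ _ _ _ fq u.
exists (ch_comp v k) => i x; rewrite -[RHS](vE i x) /=; congr (v i _).
apply: (pullback_inj pb); first by rewrite [LHS](pk i) [RHS](pf i).
by rewrite [LHS](qk i) /= (ses_comp0 fg) linear0 (ses_comp0 fq).
Qed.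

(** Schanuel's lemma for a retract; for [X = Y] it compares two projective covers of one complex. *)
Lemma ses_cover_retract K P X K' P' Y (f : chmap K P) (g : chmap P X)
    (f' : chmap K' P') (g' : chmap P' Y) (s : chmap X Y) (r : chmap Y X) :
  ses f g -> ses f' g' -> projective_complex P -> projective_complex P' ->
  ch_eq (ch_comp r s) (ch_id X) ->
  exists (i : chmap K (ch_prod K' P)) (p : chmap (ch_prod K' P) K),
    ch_eq (ch_comp p i) (ch_id K).
Proof.
move=> fg fg' prP prP' rs; have [fm ex ge] := fg; have [fm' ex' ge'] := fg'.
have [a aE] := prP _ _ g' (ch_comp s g) ge'.
have [b bE] := prP' _ _ g (ch_comp r g') ge.
have [j x|k kE] := ch_factor_mono (h := ch_comp a f) fm'.
  by apply/ex'; rewrite [LHS](aE j) /= (ses_comp0 fg) linear0.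
have [j x|l lE] := ch_factor_mono (h := ch_comp b f') fm.
  by apply/ex; rewrite [LHS](bE j) /= (ses_comp0 fg') linear0.
(* [b] after [a] lifts the identity of [X] only up to a map into [K], which [t] records. *)
have [j x|t tE] := ch_factor_mono (h := ch_sub (ch_comp b a) (ch_id P)) fm.
  apply/ex; rewrite /= linearB [g j (b j _)](bE j) /= [g' j _](aE j) /=.
  by rewrite [r j _](rs j) subrr.
exists (ch_pair k f), (ch_sub (ch_comp l (ch_fst K' P)) (ch_comp t (ch_snd K' P))).
move=> j x; apply: (fm j); rewrite /= linearB [f j (l j _)](lE j) [f j (t j _)](tE j) /=.
by rewrite [f' j _](kE j) /= opprB addrC subrK.
Qed.

(** One projective cover tests all extensions of [X]: [B] is a quotient of A x P, so a map on [B] is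
    glued from maps on [A] and [P]. *)
Lemma cover_ext_zero K P X Y (f : chmap K P) (g : chmap P X) :
  ses f g -> projective_complex P ->
  (forall u : chmap K Y, exists v : chmap P Y, ch_eq (ch_comp v f) u) ->
  ext1_zero X Y.
Proof.
move=> [fm ex ge] prP lift A B a b [am ab be] u.
have [p pE] := prP _ _ b g be.
have [i x|k kE] := ch_factor_mono (h := ch_comp p f) am.
  by apply/ab; rewrite [LHS](pE i); apply/ex; exists x.
have [w wE] := lift (ch_comp u k).
have [||v vE] := ch_factor_epi (g := ch_copair a p) (h := ch_copair u w).
- move=> i x; have [y yx] := ge i (b i x).
  have /ab[z zE] : b i (x - p i y) = 0 by rewrite linearB [b i (p i y)](pE i) yx subrr.
  by exists (z, y); rewrite /= zE subrK.
- move=> i [x y] /= xy.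
  have /ex[z zE] : g i y = 0.
    rewrite -[LHS](pE i) /=; have := congr1 (b i) xy.
    by rewrite linearD linear0 (_ : b i (a i x) = 0) ?add0r //; apply/ab; exists x.
  rewrite -zE [w i _](wE i) /= -linearD (_ : x + k i z = 0) ?linear0 //.
  by apply: (am i); rewrite linearD [a i (k i z)](kE i) /= zE xy linear0.
exists v => i x; have := vE i (x, 0).
by rewrite /= !linear0 !addr0.
Qed.

(** The two claims are proved together because comparing covers always leaves a retract of a
    product: in degree [m.+1] each of them uses both in degree [m]. *)
Lemma extS_retract_ext m H :
  (forall X Y (s : chmap X Y) (r : chmap Y X),
     ch_eq (ch_comp r s) (ch_id X) -> extS_zero m Y H -> extS_zero m X H) /\
  (forall X Y Z (f : chmap X Y) (g : chmap Y Z), ses f g ->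
     extS_zero m X H -> extS_zero m Z H -> extS_zero m Y H).
Proof.
elim: m => [|m [IHr IHe]].
  by split=> *; [apply: ext1_retract; eassumption | apply: ext1_ext; eassumption].
have ret X Y (s : chmap X Y) (r : chmap Y X) :
    ch_eq (ch_comp r s) (ch_id X) -> extS_zero m.+1 Y H -> extS_zero m.+1 X H.
  move=> rs YH K P f g fg prP.
  have [K' [P' [f' [g' [fg' prP' _]]]]] := enough_projective_complexes Y.
  have [i [p pi]] := ses_cover_retract fg fg' prP prP' rs.
  apply: (IHr _ _ i p pi); apply: (IHe _ _ _ _ _ (ses_inl_snd K' P)).
    exact: (YH _ _ _ _ fg').
  exact: projective_extS.
split=> // X Y Z f g fg XH ZH.
have [K [P [a [p [ap prP _]]]]] := enough_projective_complexes X.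
have [K' [P' [b [q [bq prP' _]]]]] := enough_projective_complexes Z.
have [L [c [r [u [v [cr uv]]]]]] := horseshoe fg ap bq prP'.
have LH : extS_zero m L H.
  by apply: (IHe _ _ _ u v) => //; [exact: (XH _ _ _ _ ap) | exact: (ZH _ _ _ _ bq)].
move=> K1 P1 f1 g1 fg1 prP1.
have rs : ch_eq (ch_comp (ch_id Y) (ch_id Y)) (ch_id Y) by [].
have [i [s si]] := ses_cover_retract fg1 cr prP1 (projective_prod prP prP') rs.
apply: (IHr _ _ i s si); apply: (IHe _ _ _ _ _ (ses_inl_snd L P1)) => //.
exact: projective_extS.
Qed.

Lemma extS_retract m X Y H (s : chmap X Y) (r : chmap Y X) :
  ch_eq (ch_comp r s) (ch_id X) -> extS_zero m Y H -> extS_zero m X H.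
Proof. exact: (extS_retract_ext m H).1. Qed.

Lemma extS_ext m X Y Z H (f : chmap X Y) (g : chmap Y Z) : ses f g ->
  extS_zero m X H -> extS_zero m Z H -> extS_zero m Y H.
Proof. exact: (extS_retract_ext m H).2. Qed.

Lemma extS_iso m X Y H : ch_iso X Y -> extS_zero m X H -> extS_zero m Y H.
Proof.
move=> [f [g [fK gK]]]; apply: (extS_retract (s := g) (r := f)) => i x; exact: gK.
Qed.

Lemma extS_cover m K P X H (f : chmap K P) (g : chmap P X) :
  ses f g -> projective_complex P -> extS_zero m K H -> extS_zero m.+1 X H.
Proof.
move=> fg prP KH K' P' f' g' fg' prP'.
have rs : ch_eq (ch_comp (ch_id X) (ch_id X)) (ch_id X) by [].
have [i [r ri]] := ses_cover_retract fg' fg prP' prP rs.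
apply: (extS_retract ri); apply: (extS_ext (ses_inl_snd K P')) => //.
exact: projective_extS.
Qed.

(** The pullback of Y -> Z <- P, which is X x P since [P] is projective. Rotation trades [Z] for its
    syzygy [K], and thereby produces the pieces of the long exact sequence. *)
Lemma ses_rotate X Y Z K P (f : chmap X Y) (g : chmap Y Z) (a : chmap K P)
    (p : chmap P Z) : ses f g -> ses a p -> projective_complex P ->
  exists (u : chmap K (ch_prod X P)) (v : chmap (ch_prod X P) Y), ses u v.
Proof.
move=> [fm fg ge] [am aE pe] prP.
have [l lE] := prP _ _ g p ge.
have gf i x : g i (f i x) = 0 by apply/fg; exists x.
have [i x|k kE] := ch_factor_mono (h := ch_comp l a) fm.
  by apply/fg; rewrite [LHS](lE i); apply/aE; exists x.
exists (ch_sub (ch_comp (ch_inr X P) a) (ch_comp (ch_inl X P) k)), (ch_copair f l).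
split=> i.
- by move=> x y [_]; rewrite !subr0 => /(am i).
- move=> [x y] /=; split=> [xy|[z [<- <-]]]; last first.
    by rewrite sub0r subr0 linearN [f i _](kE i) /= addNr.
  have /aE[z zE] : p i y = 0.
    have := congr1 (g i) xy; by rewrite linearD gf add0r linear0 [g i _](lE i).
  exists z; apply: (congr2 pair); rewrite /= ?subr0 // sub0r; apply: (fm i).
  by rewrite linearN [f i (k i z)](kE i) /= zE; apply/esym/eqP; rewrite -addr_eq0 xy.
- move=> y; have [z zE] := pe i (g i y).
  have /fg[x xE] : g i (y - l i z) = 0 by rewrite linearB [g i (l i z)](lE i) zE subrr.
  by exists (x, z); rewrite /= xE subrK.
Qed.

(** The piece Ext^(m+1)(Y, H) -> Ext^(m+1)(X, H) -> Ext^(m+2)(Z, H). *)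
Lemma extS_ker m X Y Z H (f : chmap X Y) (g : chmap Y Z) : ses f g ->
  extS_zero m Y H -> extS_zero m.+1 Z H -> extS_zero m X H.
Proof.
move=> fg YH ZH.
have [K [P [a [p [ap prP _]]]]] := enough_projective_complexes Z.
have [u [v uv]] := ses_rotate fg ap prP.
have : extS_zero m (ch_prod X P) H by apply: (extS_ext uv) => //; exact: (ZH _ _ _ _ ap).
exact: (extS_retract (s := ch_inl X P) (r := ch_fst X P)).
Qed.

(** The piece Ext^(m+1)(X, H) -> Ext^(m+2)(Z, H) -> Ext^(m+2)(Y, H). *)
Lemma extS_coker m X Y Z H (f : chmap X Y) (g : chmap Y Z) : ses f g ->
  extS_zero m X H -> extS_zero m.+1 Y H -> extS_zero m.+1 Z H.
Proof.
move=> fg XH YH.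
have [K [P [a [p [ap prP _]]]]] := enough_projective_complexes Z.
have [u [v uv]] := ses_rotate fg ap prP.
apply: (extS_cover ap prP); apply: (extS_ker uv) => //.
apply: (extS_ext (ses_inl_snd X P)) => //; exact: projective_extS.
Qed.

(** The bottom piece Hom(Y, H) -> Hom(X, H) -> Ext^1(Z, H) -> Ext^1(Y, H). *)
Lemma ext1_coker X Y Z H (f : chmap X Y) (g : chmap Y Z) : ses f g ->
  (forall u : chmap X H, exists v : chmap Y H, ch_eq (ch_comp v f) u) ->
  ext1_zero Y H -> ext1_zero Z H.
Proof.
move=> fg lift YH A B a b ab u.
have [E [p [q pb]]] := pullback_exists b g.
have [a' [aq pa]] := pullback_ses pb ab.
have [f' [fp qf]] := pullback_ses (pullback_sym pb) fg.
have [w wE] := YH _ _ _ _ aq u.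
have [v vE] := lift (ch_comp w f').
have [_ fpE pe] := fp.
have [i x /fpE[y <-]|t tE] := ch_factor_epi (h := ch_sub w (ch_comp v q)) pe.
  by rewrite /= [q i _](qf i) -[w i _](vE i) subrr.
exists t => i x; rewrite -[RHS](wE i) /= -[a i x](pa i); have := tE i (a' i x).
by rewrite /= (ses_comp0 aq) linear0 subr0.
Qed.

Lemma ext1_zero_lift X H1 H2 H3 (a : chmap H1 H2) (b : chmap H2 H3) :
  ses a b -> ext1_zero X H1 -> forall u : chmap X H3,
  exists v : chmap X H2, ch_eq (ch_comp b v) u.
Proof.
move=> ab XH u.
have [E [p [q pb]]] := pullback_exists b u.
have [a' [aq pa]] := pullback_ses pb ab.
have [r rE] := ext1_zero_retraction XH aq.
have [s sE] := retraction_section aq rE.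
exists (ch_comp p s) => i x; have [pbc _ _] := pb.
by rewrite [LHS](pbc i) /= [q i _](sE i).
Qed.

(** The piece Ext^(m+1)(X, H2) -> Ext^(m+1)(X, H3) -> Ext^(m+2)(X, H1) in the second variable. *)
Lemma extS_second m X H1 H2 H3 (a : chmap H1 H2) (b : chmap H2 H3) :
  ses a b -> extS_zero m X H2 -> extS_zero m.+1 X H1 -> extS_zero m X H3.
Proof.
move=> ab; elim: m X => [|m IHm] X XH2 XH1; last first.
  by move=> K P f g fg prP; apply: IHm; [exact: (XH2 _ _ _ _ fg) | exact: (XH1 _ _ _ _ fg)].
have [K [P [f [g [fg prP _]]]]] := enough_projective_complexes X.
apply: (cover_ext_zero fg prP) => u.
have [u' u'E] := ext1_zero_lift ab (XH1 _ _ _ _ fg prP) u.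
have [v vE] := XH2 _ _ _ _ fg u'.
by exists (ch_comp b v) => i x; rewrite -[RHS](u'E i) /= -[u' i x](vE i).
Qed.

End Ext.

(** * Resolutions, syzygies and relative dimension *)

Section Resolutions.
Context (R : comPzRingType).
Implicit Types X Y Z K P Q H : complex R.

Section Tail.
Context X (G : resolution X).

Lemma corestrict_subproof i (x : G 1 i) : r_d G 0 i x \in in_ker (r_aug G i).
Proof. by apply/in_kerP/r_exact0; exists x. Qed.

Lemma corestrict_linear i :
  linear (fun x => Ker (@corestrict_subproof i x) : ker_complex (r_aug G) i).
Proof. by move=> a x y; apply: val_inj; exact: linearP. Qed.

Lemma corestrict_comm i x : lin (@corestrict_linear i) (c_d (G 1) i x) =
  c_d (ker_complex (r_aug G)) i (lin (@corestrict_linear (i + 1)) x).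
Proof. by apply: val_inj; exact: cm_comm. Qed.

Definition corestrict : chmap (G 1) (ker_complex (r_aug G)) :=
  @ChMap R (G 1) (ker_complex (r_aug G)) (fun i => lin (@corestrict_linear i))
    corestrict_comm.

Lemma corestrict_epi : ch_epi corestrict.
Proof.
move=> i [x xP]; have /in_kerP/r_exact0[y yE] := xP.
by exists y; apply: val_inj.
Qed.

Lemma corestrict_exact : ch_exact (r_d G 1) corestrict.
Proof.
move=> i x; split=> [/(congr1 (@ker_val _ _ _ _))/= x0|[y yE]].
  by apply/(@r_exactS _ _ G 0).
by apply: val_inj; apply/(@r_exactS _ _ G 0); exists y.
Qed.

Definition tail : resolution (ker_complex (r_aug G)) :=
  @Resolution R _ (fun k => G k.+1) (fun k => r_d G k.+1) corestrict
    corestrict_epi corestrict_exact (fun k => @r_exactS _ _ G k.+1).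

End Tail.

(** Dimension shifting is definitional: the cohomology of [tail P] in degree [m.+1] is that of [P]
    in degree [m.+2]. As the right side does not mention [P], the choice of resolution is
    irrelevant. *)
Lemma cohom_zeroP m X (P : resolution X) Y :
  (forall k, projective_complex (P k)) ->
  cohom_zero P m.+1 Y <-> extS_zero m X Y.
Proof.
elim: m X P => [|m IHm] X P prP.
  have [f [fE fg]] := ker_ses (@r_aug_epi _ _ P).
  split=> [ex|XY u /= u0].
    apply: (cover_ext_zero fg (prP 0)) => u.
    have [i x|v vE] := ex (ch_comp u (corestrict P)).
      rewrite -[LHS]/(u i (corestrict P i (r_d P 1 i x))).
      by rewrite (_ : corestrict P i _ = 0) ?linear0 //; apply/corestrict_exact; exists x.
    exists v => i x; have [y <-] := corestrict_epi x.
    by rewrite [RHS](vE i y) /= fE.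
  have [i x /corestrict_exact[y <-]|w wE] := ch_factor_epi (h := u) (@corestrict_epi _ P).
    exact: u0.
  have [v vE] := XY _ _ _ _ fg w.
  exists v => i x; rewrite -[LHS](wE i x) /= -[w i _](vE i) /= fE //.
have [f [fE fg]] := ker_ses (@r_aug_epi _ _ P).
have prT k : projective_complex (tail P k) by exact: prP.
split=> [ex|XY]; first by apply: (extS_cover fg (prP 0)); apply/(IHm _ _ prT).
by have /(IHm _ _ prT) := XY _ _ _ _ fg (prP 0).
Qed.

Lemma resolution_splice (K G : nat -> complex R)
    (f : forall k, chmap (K k.+1) (G k)) (g : forall k, chmap (G k) (K k)) :
  (forall k, ses (f k) (g k)) ->
  exists T : resolution (K 0), r_obj T = G.
Proof.
move=> fg; pose d k := ch_comp (f k) (g k.+1).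
have e0 : ch_exact (d 0) (g 0).
  move=> i x; have [fm ex ge] := fg 0; split=> [/ex[y <-]|[y <-]].
    by have [_ _ ge1] := fg 1; have [z <-] := ge1 i y; exists z.
  exact: (ses_comp0 (fg 0)).
have eS k : ch_exact (d k.+1) (d k).
  move=> i x; have [fm _ _] := fg k; have [_ ex _] := fg k.+1.
  have [_ _ ge] := fg k.+2; split=> [|[y <-]].
    rewrite -[RHS](linear0 (f k i)) => /(fm i)/ex[y <-].
    by have [z <-] := ge i y; exists z.
  by rewrite /= (ses_comp0 (fg k.+1)) linear0.
have [_ _ ge] := fg 0.
by exists (@Resolution R (K 0) G d (g 0) ge e0 eS).
Qed.

(** Dependent choice, where the state carried along is a complex together with a proof of [S]. *)
Lemma resolution_by (S cG : complex_class R) :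
  (forall X, S X -> exists K G (f : chmap K G) (g : chmap G X),
     [/\ ses f g, cG G & S K]) ->
  forall X, S X -> exists T : resolution X, forall k, cG (T k).
Proof.
move=> step X SX.
have stepP (Y : {Y | S Y}) : exists KG : {KG : {K | S K} * complex R &
    chmap (sval KG.1) KG.2 * chmap KG.2 (sval Y)}%type,
    ses (projT2 KG).1 (projT2 KG).2 /\ cG (projT1 KG).2.
  have [K [G [f [g [fg GG SK]]]]] := step _ (proj2_sig Y).
  by exists (existT (fun KG : {K | S K} * complex R =>
    chmap (sval KG.1) KG.2 * chmap KG.2 (sval Y))%type (exist _ K SK, G) (f, g)).
pose next s := projT1 (cid (stepP s)).
have nextP s := projT2 (cid (stepP s)).
pose K k := iter k (fun s => (projT1 (next s)).1) (exist _ X SX).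
have [|T TE] := @resolution_splice (fun k => sval (K k)) (fun k => (projT1 (next (K k))).2)
  (fun k => (projT2 (next (K k))).1) (fun k => (projT2 (next (K k))).2).
  by move=> k; have [] := nextP (K k).
by exists T => k; rewrite TE; have [] := nextP (K k).
Qed.

Lemma projective_resolution X : exists P : resolution X,
  forall k, projective_complex (P k) /\ tilde (@projective_module R) (P k).
Proof.
apply: (@resolution_by (fun=> True)
  (fun P => projective_complex P /\ tilde (@projective_module R) P)) => // Y _.
have [K [P [f [g [fg prP tP]]]]] := enough_projective_complexes Y.
by exists K, P, f, g.
Qed.

(** The quantification over resolutions in [ext_zero] is not vacuous, since a projective resolution
    exists. *)
Lemma ext_zeroP m X Y : ext_zero m.+1 X Y <-> extS_zero m X Y.
Proof.
split=> [ex|XY P prP]; last exact/cohom_zeroP.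
have [P prP] := projective_resolution X.
have prP' k : projective_complex (P k) by have [] := prP k.
exact: (cohom_zeroP m Y prP').1 (ex P prP').
Qed.

(** The class may depend on the position, so that the mixed resolutions of (5) are covered as
    well. *)
Fixpoint res_dim (cG : nat -> complex_class R) n X : Prop :=
  if n is k.+1 then
    exists K G (f : chmap K G) (g : chmap G X),
      [/\ ses f g, cG 0 G & res_dim (fun i => cG i.+1) k K]
  else cG 0 X.

Definition ch_iso_closed (cX : complex_class R) :=
  forall X Y, ch_iso X Y -> cX X -> cX Y.

Section Cons.
Context K G0 X (f : chmap K G0) (g : chmap G0 X) (fg : ses f g) (T : resolution K).

Definition cons_obj k := if k is j.+1 then T j else G0.

Definition cons_d k : chmap (cons_obj k.+1) (cons_obj k) :=
  match k with 0 => ch_comp f (r_aug T) | j.+1 => r_d T j end.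

Lemma cons_epi : ch_epi g. Proof. by have [] := fg. Qed.

Lemma cons_exact0 : ch_exact (cons_d 0) g.
Proof.
move=> i x; have [_ ex _] := fg; split=> [/ex[y <-]|[y <-]].
  by have [z <-] := @r_aug_epi _ _ T i y; exists z.
exact: (ses_comp0 fg).
Qed.

Lemma cons_exactS k : ch_exact (cons_d k.+1) (cons_d k).
Proof.
case: k => [|k]; last exact: r_exactS.
move=> i x; have [fm _ _] := fg; split=> [|[y <-]].
  by rewrite -[RHS](linear0 (f i)) => /(fm i)/r_exact0.
rewrite /= (_ : r_aug T i _ = 0) ?linear0 //.
by apply/r_exact0; exists y.
Qed.

Definition cons_resolution : resolution X :=
  @Resolution R X cons_obj cons_d g cons_epi cons_exact0 cons_exactS.

End Cons.

Lemma single_resolution X : exists T : resolution X, T 0 = X /\ length_le T 0.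
Proof.
pose obj k : complex R := if k is _.+1 then zero_cx R else X.
pose d k : chmap (obj k.+1) (obj k) := ch_zero _ _.
have ep : ch_epi (ch_id X) by move=> i x; exists x.
have e0 : ch_exact (d 0) (ch_id X).
  by move=> i x; split=> [/= ->|[y <-]] //; exists 0.
have eS k : ch_exact (d k.+1) (d k).
  by move=> i x; split=> // _; exists 0; exact/esym/zero_modP.
exists (@Resolution R X obj d (ch_id X) ep e0 eS); split=> // -[|k] // _.
exact: zero_cxP.
Qed.

Lemma res_dim_resolution cG n X : res_dim cG n X ->
  exists T : resolution X, length_le T n /\ forall i, (i <= n)%N -> cG i (T i).
Proof.
elim: n cG X => [|n IHn] cG X /=.
  move=> cX; have [T [T0 Tl]] := single_resolution X.
  by exists T; split=> // -[|i] // _; rewrite T0.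
move=> [K [G [f [g [fg cGG /IHn[T [Tl cT]]]]]]].
exists (cons_resolution fg T); split=> [[|k]|[|i]] //=; first exact: Tl.
exact: cT.
Qed.

(** A resolution of length 0 gives an isomorphism from [T 0] to [X], not an equality; hence the
    closure assumption. *)
Lemma resolution_res_dim (cG : nat -> complex_class R) n X (T : resolution X) :
  (forall i, ch_iso_closed (cG i)) -> length_le T n ->
  (forall i, (i <= n)%N -> cG i (T i)) -> res_dim cG n X.
Proof.
elim: n cG X T => [|n IHn] cG X T icG Tl cT /=.
  apply: (icG 0 (T 0)); last exact: cT.
  apply: (bij_ch_iso (f := r_aug T)); last exact: r_aug_epi.
  apply: ch_mono0 => i x /r_exact0[y <-].
  by rewrite (Tl 1 isT i y) linear0.
have [f [_ fg]] := ker_ses (@r_aug_epi _ _ T).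
exists (ker_complex (r_aug T)), (T 0), f, (r_aug T); split=> //; first exact: cT.
apply: (IHn _ _ (tail T)) => [i|k kn|i iin]; [exact: icG | exact: Tl | exact: cT].
Qed.

Lemma syzygy_ses X (G : resolution X) k :
  exists (f : chmap (syzygy G k.+1) (G k)) (g : chmap (G k) (syzygy G k)), ses f g.
Proof.
case: k => [|[|k]].
- have [f [_ fg]] := ker_ses (@r_aug_epi _ _ G).
  by exists f, (r_aug G).
- have [f [fE fm _]] := ch_kernel (r_d G 0).
  exists f, (corestrict G); split=> // [i x|]; last exact: corestrict_epi.
  split=> [/(congr1 (@ker_val _ _ _ _))/= x0|[y <-]].
    by exists (Ker (introT (in_kerP _ _) x0)); rewrite fE.
  by apply: val_inj; rewrite fE; apply/in_kerP; exact: ker_valP.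
- have [f [fE fm _]] := ch_kernel (r_d G k.+1).
  have [e [eE em _]] := ch_kernel (r_d G k).
  have [i x|g gE] := ch_factor_mono (h := r_d G k.+1) em.
    have x0 : r_d G k i (r_d G k.+1 i x) = 0 by apply/r_exactS; exists x.
    by exists (Ker (introT (in_kerP _ _) x0)); rewrite eE.
  have gv i x : ker_val (g i x) = r_d G k.+1 i x by rewrite -eE; exact: gE.
  exists f, g; split=> // i x.
  + split=> [/(congr1 (@ker_val _ _ _ _))/= x0|[y <-]].
      rewrite gv in x0.
      by exists (Ker (introT (in_kerP _ _) x0)); rewrite fE.
    by apply: val_inj; rewrite [LHS]gv fE; apply/in_kerP; exact: ker_valP.
  + have /in_kerP/r_exactS[y yE] := ker_valP x.
    by exists y; apply: val_inj; rewrite [LHS]gv.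
Qed.

End Resolutions.

(** * Complexes with cycles in P, [P_C] and [F_C] *)

Section BaseClasses.
Context (R : comPzRingType) (C : lmodType R).
Implicit Types X Y Z K P Q B : complex R.

Local Notation tP := (tilde (@projective_module R)).
Local Notation tPC := (tilde (P_C C)).
Local Notation tFC := (tilde (F_C C)).

Lemma tilde_sub (cX cY : mod_class R) X :
  (forall M, cX M -> cY M) -> tilde cX X -> tilde cY X.
Proof. by move=> sXY [exX cZ]; split=> // i; exact/sXY. Qed.

Lemma P_C_F_C M : P_C C M -> F_C C M.
Proof. by move=> [P [b [prP tb]]]; exists P, b; split=> //; exact: projective_flat. Qed.

Lemma tPC_tFC Q : tPC Q -> tFC Q.
Proof. exact: tilde_sub P_C_F_C. Qed.

Lemma cycle_ses X j : exact_complex X ->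
  exists (i : {linear ker (c_d X (j + 1)) -> X (j + 1 + 1)})
         (p : {linear X (j + 1 + 1) -> ker (c_d X j)}),
    [/\ injective i, exact_mod i p, surjective p
      & forall x, ker_val (p x) = c_d X (j + 1) x].
Proof.
move=> exX; have li k : linear (@ker_val R _ _ (c_d X k)) by [].
have vi k : injective (@ker_val R _ _ (c_d X k)) by exact: val_inj.
have [x|p pE] := factor_mono (f := lin (li j)) (h := c_d X (j + 1)) (@vi j).
  by exists (Ker (introT (in_kerP _ _) (@c_dd _ X j x))).
exists (lin (li (j + 1))), p; split=> [|x|y|x]; last exact: pE.
- exact: vi.
- split=> [x0|[y <-]].
    have dx : c_d X (j + 1) x = 0 by rewrite -pE x0 linear0.
    by exists (Ker (introT (in_kerP _ _) dx)).
  by apply: vi; rewrite [LHS]pE; apply/in_kerP; exact: ker_valP.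
- have /in_kerP/exX[x xy] := ker_valP y.
  by exists x; apply: vi; rewrite -[LHS]/(lin (li j) (p x)) pE.
Qed.

Lemma P_C_prod M N : P_C C M -> P_C C N -> P_C C (M * N)%type.
Proof.
move=> [P [b [prP tb]]] [Q [b' [prQ tb']]].
exists (P * Q)%type, (fun c p => (b c p.1, b' c p.2)); split.
  move=> U V g f gs.
  have [h hE] := prP _ _ g (f \o lin_inl P Q) gs.
  have [k kE] := prQ _ _ g (f \o lin_inr P Q) gs.
  exists ((h \o fst) \+ (k \o snd)) => -[x y].
  by rewrite [in RHS]pair_inl_inr /= !linearD hE kE.
split=> [|U c cb].
  split=> [x a y z|y a x z]; apply: (congr2 pair) => /=.
  - exact: tb.1.1.
  - exact: tb'.1.1.
  - exact: tb.1.2.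
  - exact: tb'.1.2.
split=> [|h h' hE h'E [t t']].
  have [h hE] := tensor_lift tb (bilinear_comp idfun (lin_inl P Q) idfun cb).
  have [k kE] := tensor_lift tb' (bilinear_comp idfun (lin_inr P Q) idfun cb).
  exists ((h \o fst) \+ (k \o snd)) => x [p q] /=.
  by rewrite hE kE [in RHS]pair_inl_inr -[RHS]/(curry1 cb x _) linearD.
rewrite pair_inl_inr !linearD; congr (_ + _).
  apply: (tensor_eq (h := h \o lin_inl M N) (h' := h' \o lin_inl M N) tb) => x p /=.
  by have := hE x (p, 0); have := h'E x (p, 0); rewrite /= (bilinear0r _ tb'.1) => -> ->.
apply: (tensor_eq (h := h \o lin_inr M N) (h' := h' \o lin_inr M N) tb') => x p /=.
by have := hE x (0, p); have := h'E x (0, p); rewrite /= (bilinear0r _ tb.1) => -> ->.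
Qed.

Lemma tPC_prod X Y : tPC X -> tPC Y -> tPC (ch_prod X Y).
Proof.
move=> [exX cX] [exY cY]; split=> i.
  move=> [x y]; split=> [[/exX[a <-] /exY[b <-]]|[[a b] [<- <-]]].
    by exists (a, b).
  by apply: (congr2 pair); rewrite /= c_dd.
have kP (p : ker (c_d X i) * ker (c_d Y i)) :
    ((ker_val p.1, ker_val p.2) : ch_prod X Y (i + 1)) \in in_ker (c_d (ch_prod X Y) i).
  case: p => -[x xP] [y yP]; apply/in_kerP; rewrite /= /prod_d_fun /=.
  by have /in_kerP-> := xP; have /in_kerP-> := yP.
have lk : linear (fun p => Ker (kP p)) by move=> a p q; apply: val_inj.
apply: (@tensor_class_iso_closed _ _ _ _ _ (lin lk) _ _ (P_C_prod (cX i) (cY i))).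
  move=> [x y] [x' y'] /(congr1 (@ker_val _ _ _ _)) [xx yy].
  by apply: (congr2 pair); exact: val_inj.
move=> [[x y] xyP]; have /in_kerP[x0 y0] := xyP.
exists (Ker (introT (in_kerP _ _) x0), Ker (introT (in_kerP _ _) y0)).
exact: val_inj.
Qed.

Lemma disks_resolution (A : int -> lmodType R) (F : forall i, mod_resolution (A i)) :
  (forall i k, projective_module (F i k)) ->
  exists P : resolution (disks A), (forall k, projective_complex (P k)) /\
    forall m B, (forall i, mod_cohom_zero (F i) m.+1 (B i)) -> cohom_zero P m.+1 B.
Proof.
move=> prF.
pose P := @Resolution R (disks A) (fun k => disks (fun i => F i k))
  (fun k => disk_map (fun i => mr_d (F i) k)) (disk_map (fun i => mr_aug (F i)))
  (disk_map_epi (fun i => @mr_aug_surj _ _ (F i)))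
  (disk_map_exact (fun i => @mr_exact0 _ _ (F i)))
  (fun k => disk_map_exact (fun i => @mr_exactS _ _ (F i) k)).
exists P; split=> [k|m B ex u u0]; first exact: disks_projective.
exact: (disk_map_hexact ex u0).
Qed.

Lemma D_projective_iso : ch_iso_closed (D_projective C).
Proof.
move=> X Y XY [L [ex hex tP tQ [j [jm jE]]]].
have [f [fm fe]] := ch_iso_bij (ch_iso_sym XY).
exists L; split=> //; exists (ch_comp j f); split=> [i|i y].
  by move=> a b /jm /fm.
rewrite -jE; split=> [[x <-]|[x <-]]; first by exists (f i x).
by have [z <-] := fe i x; exists z.
Qed.

Hypothesis hC : semidualizing C.

Lemma tFC_good (good : mod_class R) B :
  (forall N, F_C C N -> good N) ->
  (forall (N1 N N2 : lmodType R) (i : {linear N1 -> N}) (p : {linear N -> N2}),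
     injective i -> exact_mod i p -> surjective p -> good N1 -> good N2 -> good N) ->
  tFC B -> forall i, good (B i).
Proof.
move=> gF gext [exB cB] i.
have [j ->] : exists j, i = j + 1 + 1 by exists (i - 1 - 1); rewrite !subrK.
have [a [p [ai ap ps _]]] := cycle_ses j exB.
by apply: (gext _ _ _ a p) => //; apply: gF; exact: cB.
Qed.

Lemma tPC_ext_tFC m Q B : tPC Q -> tFC B -> extS_zero m Q B.
Proof.
have [good [gF gext gres _]] := semidualizing_acyclicity hC; move=> tQ tB.
have [exQ cQ] := tQ.
have gB := tFC_good gF gext tB.
(* [Q] splits into disks because Ext^1 between cycles in [P_C] vanishes; Ext(Q, B) is then computed
   degreewise. *)
have [i|A [cA AQ]] := tilde_disks tQ.
  have [a [p [ai ap ps pE]]] := cycle_ses i exQ.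
  have [P [prP cohP]] := gres _ (cQ i).
  have gN : good (ker (c_d Q (i + 1))) by apply: gF; apply: P_C_F_C; exact: cQ.
  have [s sE] := resolution_lift (prP 0%N) (cohP _ gN 0%N) ai ap ps idfun.
  by exists s => x; rewrite -pE sE.
apply: (extS_iso AQ).
pose F i := projT1 (cid (gres _ (cA i))).
have prF i k : projective_module (F i k) by exact: (projT2 (cid (gres _ (cA i)))).1.
have cohF i N : good N -> forall m, mod_cohom_zero (F i) m.+1 N.
  exact: (projT2 (cid (gres _ (cA i)))).2.
have [P [prP cohP]] := disks_resolution prF.
by apply/(cohom_zeroP m B prP); apply: cohP => i; exact: cohF.
Qed.

Lemma tP_D_projective X : tP X -> D_projective C X.
Proof.
have [good [gF gext _ gcores]] := semidualizing_acyclicity hC.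
move=> /tilde_projective_disks[A [prA AX]]; apply: (D_projective_iso AX).
pose S i := gcores _ (prA i).
pose Q i := projT1 (cid (S i)).
have S1 i := projT2 (cid (S i)).
pose e i : {linear A i -> Q i 0} := projT1 (cid (S1 i)).
have S2 i := projT2 (cid (S1 i)).
pose dQ i k : {linear Q i k -> Q i k.+1} := projT1 (cid (S2 i)) k.
have S3 i : [/\ forall k, P_C C (Q i k), injective (e i), exact_mod (e i) (dQ i 0%N),
    forall k, exact_mod (dQ i k) (dQ i k.+1)
  & forall N, good N ->
    [/\ forall u : {linear A i -> N}, exists v : {linear Q i 0 -> N},
          forall x, u x = v (e i x),
        hexact N (e i) (dQ i 0)
      & forall k, hexact N (dQ i k) (dQ i k.+1)]] := projT2 (cid (S2 i)).
pose f0 := disk_map e.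
pose dd k := disk_map (fun i => dQ i k).
(* The left half is [disks A] followed by zero complexes; the right half consists of disks on the
   module coresolutions. *)
pose PP k : complex R := if k is _.+1 then zero_cx R else disks A.
pose L := @DcSeq R PP (fun k => disks (fun i => Q i k)) (fun k => ch_zero _ _) f0 dd.
have ex0 : ch_exact f0 (dd 0%N) by apply: disk_map_exact => i; have [] := S3 i.
have exS k : ch_exact (dd k) (dd k.+1) by apply: disk_map_exact => i; have [] := S3 i.
have f0m : ch_mono f0 by apply: disk_map_mono => i; have [] := S3 i.
exists L; split.
- split=> // [k|] i x; split=> //.
  + by move=> _; exists 0; exact/esym/zero_modP.
  + by move=> x0; exists 0; apply: (f0m i); rewrite [RHS]x0; exact: linear0.
  + by move=> [y <-]; exact: linear0.
- move=> B tB; have gB := tFC_good gF gext tB; split=> [k|||k] u; split.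
  + by move=> _; exists (ch_zero _ _) => i x; rewrite [x]zero_modP !linear0.
  + by move=> [v vE] i x; rewrite -[LHS](vE i) /= !linear0.
  (* The map into [P_0] is zero, so exactness at [P_0] means that every map to [B] extends along
     [f0]. *)
  + move=> _; have hP i : hexact (B i) (\0 : {linear A i -> A i}) (e i).
      by move=> w _; have [_ _ _ _ /(_ _ (gB i))[+ _ _]] := S3 i; apply.
    have [|v vE] := disk_map_hexact hP (u := u).
      by move=> i x; rewrite /= linear0.
    by exists v => i x; rewrite vE.
  + by move=> [v vE] i x; rewrite -[LHS](vE i) /= !linear0.
  + move=> u0; have hP i : hexact (B i) (e i) (dQ i 0%N).
      by have [_ _ _ _ /(_ _ (gB i))[]] := S3 i.
    by have [v vE] := disk_map_hexact hP u0; exists v => i x; rewrite vE.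
  + move=> [v vE] i x; rewrite -[LHS](vE i).
    by rewrite -[RHS](linear0 (v i)); congr (v i _); apply/ex0; exists x.
  + move=> u0; have hP i : hexact (B i) (dQ i k) (dQ i k.+1).
      by have [_ _ _ _ /(_ _ (gB i))[]] := S3 i.
    by have [v vE] := disk_map_hexact hP u0; exists v => i x; rewrite vE.
  + move=> [v vE] i x; rewrite -[LHS](vE i).
    by rewrite -[RHS](linear0 (v i)); congr (v i _); apply/exS; exists x.
- case=> [|k]; first by apply: disks_tilde => //; exact: projective_iso_closed.
  split=> i; first by move=> x; split=> // _; exists 0; exact/esym/zero_modP.
  move=> M N g f gs; exists (\0) => -[x xP] /=.
  rewrite linear0; apply/esym; rewrite (_ : Ker xP = 0) ?linear0 //.
  by apply: val_inj; exact: zero_modP.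
- move=> k; apply: disks_tilde => [|i]; first exact: tensor_class_iso_closed.
  by have [] := S3 i.
- by exists f0; split.
Qed.

End BaseClasses.

(** * D_C-projective complexes *)

Section DProjective.
Context (R : comPzRingType) (C : lmodType R).
Hypothesis hC : semidualizing C.
Implicit Types X Y Z K G P Q B : complex R.

Local Notation tP := (tilde (@projective_module R)).
Local Notation tPC := (tilde (P_C C)).
Local Notation tFC := (tilde (F_C C)).
Local Notation D := (D_projective C).

Definition left_perp X := forall m B, tFC B -> extS_zero m X B.

Definition D_step (S : complex_class R) X := left_perp X /\
  exists Q X' (f : chmap X Q) (g : chmap Q X'), [/\ ses f g, tPC Q & S X'].

(* The greatest solution of [S X <-> D_step S X]; a class [S] of complexes replaces
   the choice of a whole coresolution in the closure properties below. *)
Definition D_coind X := exists S : complex_class R,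
  S X /\ forall Y, S Y -> D_step S Y.

Lemma D_coind_step X : D_coind X -> D_step D_coind X.
Proof.
move=> [S [SX stepS]]; have [WX [Q [X' [f [g [fg tQ SX']]]]]] := stepS _ SX.
by split=> //; exists Q, X', f, g; split=> //; exists S.
Qed.

Lemma D_coind_fold X : D_step D_coind X -> D_coind X.
Proof.
move=> DX; exists (fun Y => Y = X \/ D_coind Y); split; first by left.
move=> Y YX; have [W [Q [Y' [f [g [fg tQ DY']]]]]] : D_step D_coind Y.
  by case: YX => [->|/D_coind_step].
by split=> //; exists Q, Y', f, g; split=> //; right.
Qed.

(** Higher Ext shifts to [X], but Ext^1(X', B) is the cokernel of Hom(Q, B) -> Hom(X, B); this is
    where Hom-exactness of the coresolution is used. *)
Lemma left_perp_coker X Q X' (f : chmap X Q) (g : chmap Q X') :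
  ses f g -> left_perp X -> left_perp Q ->
  (forall B, tFC B -> forall u : chmap X B, exists v : chmap Q B, ch_eq (ch_comp v f) u) ->
  left_perp X'.
Proof.
move=> fg WX WQ lift [|m] B tB.
  by apply: (ext1_coker fg (lift B tB)); exact: (WQ 0%N).
by apply: (extS_coker fg); [exact: WX | exact: WQ].
Qed.

Lemma tPC_left_perp Q : tPC Q -> left_perp Q.
Proof. by move=> tQ m B; exact: tPC_ext_tFC. Qed.

(** The right half of a [dc_seq], started at the inclusion of the image of f_0. This form passes to
    the cosyzygy, as the coinduction requires. *)
Definition has_coresolution X := exists (Q : nat -> complex R) (e : chmap X (Q 0))
    (d : forall k, chmap (Q k) (Q k.+1)),
  [/\ ch_mono e, ch_exact e (d 0) /\ (forall k, ch_exact (d k) (d k.+1)),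
      forall k, tPC (Q k)
    & forall B, tFC B ->
      [/\ forall u : chmap X B, exists v : chmap (Q 0) B, ch_eq (ch_comp v e) u,
          forall u : chmap (Q 0) B, ch_null (ch_comp u e) ->
            exists v : chmap (Q 1) B, ch_eq (ch_comp v (d 0)) u
        & forall k (u : chmap (Q k.+1) B), ch_null (ch_comp u (d k)) ->
            exists v : chmap (Q k.+2) B, ch_eq (ch_comp v (d k.+1)) u]].

Lemma coresolution_D_coind X : left_perp X -> has_coresolution X -> D_coind X.
Proof.
move=> WX cX; exists (fun X => left_perp X /\ has_coresolution X); split=> // {WX cX}X.
move=> [WX [Q [e [d [em [ex0 exS] tQ hex]]]]]; split=> //.
(* The cosyzygy Q_0/X, realized inside [Q 1] as the kernel of [d 1]. *)
have [f [_ fm fP]] := ch_kernel (d 1%N).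
have [i x|g gE] := ch_factor_mono (h := d 0%N) fm.
  by apply/fP/exS; exists x.
have ge : ch_epi g.
  move=> i y; have /exS[x xE] : d 1%N i (f i y) = 0 by apply/fP; exists y.
  by exists x; apply: (fm i); rewrite -xE; exact: gE.
have eg : ses e g.
  split=> // i x; rewrite -(ex0 i x) -[d 0%N i x](gE i x) /=.
  split=> [-> |]; first exact: linear0.
  by rewrite -[RHS](linear0 (f i)) => /(fm i).
exists (Q 0%N), (ker_complex (d 1%N)), e, g; split=> //; split.
  apply: (left_perp_coker eg WX (tPC_left_perp (tQ 0%N))) => B tB.
  by have [] := hex B tB.
exists (fun k => Q k.+1), f, (fun k => d k.+1); split=> //.
move=> B tB; have [h0 h1 h2] := hex B tB; split=> [u|u u0|k]; last exact: (h2 k.+1).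
  have [i x|v vE] := h1 (ch_comp u g).
    have -> : ch_comp (ch_comp u g) e i x = u i (g i (e i x)) by [].
    by rewrite (ses_comp0 eg) linear0.
  exists v => i y; have [x <-] := ge i y.
  by rewrite -[RHS](vE i x) /= -[d 0%N i x](gE i x).
apply: (h2 0%N) => i x; rewrite -[RHS](u0 i (g i x)) /=.
by rewrite [f i _](gE i x).
Qed.

(** The left half is a projective resolution of [X], so its Hom-exactness is the vanishing of Ext;
    the right half is the coresolution. *)
Lemma D_D_coind X : D X -> D_coind X.
Proof.
move=> [L [[ex1 ex2 ex3 ex4] hex tPL tQL [j [jm jE]]]].
have [i t|p pE] := ch_factor_mono (h := dc_f0 L) jm; first by apply/jE; exists t.
have pe : ch_epi p.
  move=> i x; have /jE[t tE] : exists y, j i y = j i x by exists x.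
  by exists t; apply: (jm i); rewrite -tE; exact: pE.
have pex : ch_exact (dc_dP L 0) p.
  move=> i x; rewrite -(ex2 i x) -[dc_f0 L i x](pE i x) /=.
  split=> [-> |]; first exact: linear0.
  by rewrite -[RHS](linear0 (j i)) => /(jm i).
pose P := @Resolution R X (dc_P L) (dc_dP L) p pe pex ex1.
apply: coresolution_D_coind => [m B tB|].
  have prP k : projective_complex (P k) by apply: tilde_projective; exact: tPL.
  apply/(cohom_zeroP m B prP) => u u0.
  have [h1 _ _ _] := hex B tB; have [v vE] := (h1 m u).1 u0.
  by exists v => i x; rewrite vE.
exists (dc_Q L), j, (dc_dQ L); split=> //.
  by split=> // i x; rewrite (ex3 i x) -jE.
move=> B tB; have [_ h2 h3 h4] := hex B tB; split=> [u|u u0|k u u0].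
- have [i x|v vE] := (h2 (ch_comp u p)).1.
    by rewrite /= (_ : p i _ = 0) ?linear0 //; apply/pex; exists x.
  exists v => i x; have [t <-] := pe i x.
  by rewrite -[RHS](vE i t) /= -[dc_f0 L i t](pE i t).
- by apply: (h3 u).1 => i x; rewrite -[RHS](u0 i (p i x)) /= [j i _](pE i x).
- exact: (h4 k u).1.
Qed.

(** A projective resolution of [X] is spliced with a coresolution chosen step by step. Hom-exactness
    is the vanishing of Ext for [X] on the left and of Ext^1 for the cosyzygies on the right. *)
Lemma D_coind_D X : D_coind X -> D X.
Proof.
move=> DX.
have stepP (s : {Y | D_coind Y}) : exists T : {KQ : {K | D_coind K} * complex R &
    chmap (sval s) KQ.2 * chmap KQ.2 (sval KQ.1)}%type,
    ses (projT2 T).1 (projT2 T).2 /\ tPC (projT1 T).2.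
  have [_ [Q [K [f [g [fg tQ DK]]]]]] := D_coind_step (proj2_sig s).
  by exists (existT (fun KQ : {K | D_coind K} * complex R =>
    chmap (sval s) KQ.2 * chmap KQ.2 (sval KQ.1))%type (exist _ K DK, Q) (f, g)).
pose next s := projT1 (cid (stepP s)).
have nextP s : ses (projT2 (next s)).1 (projT2 (next s)).2 /\ tPC (projT1 (next s)).2.
  exact: projT2 (cid (stepP s)).
pose sY k := iter k (fun s => (projT1 (next s)).1) (exist _ X DX).
pose Y k := sval (sY k).
pose Q k := (projT1 (next (sY k))).2.
pose f k : chmap (Y k) (Q k) := (projT2 (next (sY k))).1.
pose g k : chmap (Q k) (Y k.+1) := (projT2 (next (sY k))).2.
have fg k : ses (f k) (g k) by have [] := nextP (sY k).
have tQ k : tPC (Q k) by have [] := nextP (sY k).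
have WY k : left_perp (Y k) by have [] := D_coind_step (proj2_sig (sY k)).
have [P prP] := projective_resolution X.
have prP' k : projective_complex (P k) by have [] := prP k.
pose f0 := ch_comp (f 0%N) (r_aug P); pose d k := ch_comp (f k.+1) (g k).
have fm k : ch_mono (f k) by have [] := fg k.
have ge k : ch_epi (g k) by have [] := fg k.
have fgE k : ch_exact (f k) (g k) by have [] := fg k.
have f_eq0 k i x : f k i x = 0 <-> x = 0.
  split=> [|->]; last exact: linear0.
  by rewrite -[RHS](linear0 (f k i)) => /(fm k i).
have ae := @r_aug_epi _ _ P.
have E2 : ch_exact (r_d P 0) f0.
  by move=> i x; rewrite /= (f_eq0 0%N); exact: r_exact0.
have E3 : ch_exact f0 (d 0%N).
  move=> i x; rewrite /= (f_eq0 1%N) (fgE 0%N i x); split=> [[y <-]|[y <-]].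
    by have [z <-] := ae i y; exists z.
  by exists (r_aug P i y).
have E4 k : ch_exact (d k) (d k.+1).
  move=> i x; rewrite /= (f_eq0 k.+2) (fgE k.+1 i x); split=> [[y <-]|[y <-]].
    by have [z <-] := ge k i y; exists z.
  by exists (g k i y).
have comp0 X1 X2 X3 B (a : chmap X1 X2) (b : chmap X2 X3) (u : chmap X2 B) :
    ch_exact a b -> (exists v : chmap X3 B, ch_eq (ch_comp v b) u) ->
    ch_null (ch_comp u a).
  move=> ab [v vE] i x; rewrite /= -[u i _](vE i) /= (_ : b i (a i x) = 0) ?linear0 //.
  by apply/ab; exists x.
exists (@DcSeq R P Q (r_d P) f0 d); split=> //.
- by split=> //= k; exact: r_exactS.
- move=> B tB.
  (* A map killed on [Y k] descends to [Y k.+1] and extends to [Q k.+1], since Ext^1 of [Y k.+2]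
     vanishes. *)
  have lift k (u : chmap (Q k) B) : ch_null (ch_comp u (f k)) ->
      exists v : chmap (Q k.+1) B, ch_eq (ch_comp v (d k)) u.
    move=> u0; have [i x /fgE[y <-]|w wE] := ch_factor_epi (h := u) (ge k).
      exact: u0.
    have [v vE] := WY k.+2 0%N B tB _ _ _ _ (fg k.+1) w.
    by exists v => i x; rewrite -[RHS](wE i x) -[RHS](vE i).
  split=> [k|||k] u; (split; last by apply: comp0 => //; exact: r_exactS).
  + move=> u0; have [v vE] := (cohom_zeroP k B prP').2 (WY 0%N k B tB) u u0.
    by exists v => i x; rewrite vE.
  + move=> u0; have [i x /r_exact0[y <-]|w wE] := ch_factor_epi (h := u) ae.
      exact: u0.
    have [v vE] := WY 1%N 0%N B tB _ _ _ _ (fg 0%N) w.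
    by exists v => i x; rewrite -[RHS](wE i x) -[RHS](vE i).
  + move=> u0; apply: lift => i x; have [y <-] := ae i x; exact: u0.
  + move=> u0; apply: lift => i x; have [y <-] := ge k i x; exact: u0.
- by move=> k; have [] := prP k.
- exists (f 0%N); split=> [|i y]; first exact: fm.
  split=> [[x <-]|[x <-]].
    by have [z <-] := ae i x; exists z.
  by exists (r_aug P i x).
Qed.

Lemma D_left_perp X : D X -> left_perp X.
Proof. by move=> /D_D_coind/D_coind_step[]. Qed.

Lemma D_cosyzygy X : D X -> exists Q X' (f : chmap X Q) (g : chmap Q X'),
  [/\ ses f g, tPC Q & D X'].
Proof.
move=> /D_D_coind/D_coind_step[_ [Q [X' [f [g [fg tQ /D_coind_D DX']]]]]].
by exists Q, X', f, g.
Qed.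

Lemma D_intro X Q X' (f : chmap X Q) (g : chmap Q X') :
  left_perp X -> ses f g -> tPC Q -> D X' -> D X.
Proof.
move=> WX fg tQ /D_D_coind DX'; apply/D_coind_D/D_coind_fold; split=> //.
by exists Q, X', f, g.
Qed.

(** The split embedding of [Q] in Q x Q has cokernel [Q], so tilde P_C itself serves as the class of
    the coinduction. *)
Lemma tPC_D Q : tPC Q -> D Q.
Proof.
move=> tQ; apply: D_coind_D; exists tPC; split=> // {tQ}Q tQ.
split; first exact: tPC_left_perp.
exists (ch_prod Q Q), Q, (ch_inl Q Q), (ch_snd Q Q); split=> //.
  exact: ses_inl_snd.
exact: tPC_prod.
Qed.

(** Coinduction on the class of all extensions: [Y] embeds in Q x Q' and its cokernel is again such
    an extension. *)
Lemma D_ext X Y Z (f : chmap X Y) (g : chmap Y Z) : ses f g -> D X -> D Z -> D Y.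
Proof.
move=> fg DX DZ; apply: D_coind_D.
exists (fun Y => exists X Z (f : chmap X Y) (g : chmap Y Z), [/\ ses f g, D X & D Z]).
split=> [|{X Y Z f g fg DX DZ}Y [X [Z [f [g [fg DX DZ]]]]]]; first by exists X, Z, f, g.
split=> [m B tB|].
  by apply: (extS_ext fg); exact: D_left_perp.
have [Q [X' [a [p [ap tQ DX']]]]] := D_cosyzygy DX.
have [Q' [Z' [b [q [bq tQ' DZ']]]]] := D_cosyzygy DZ.
(* The embedding of [X] in [Q] extends to [Y], because Ext^1(Z, Q) = 0. *)
have [l lE] := D_left_perp DZ 0%N (tPC_tFC tQ) _ _ _ _ fg a.
have [fm fgE ge] := fg; have [am apE pe] := ap; have [bm bqE qe] := bq.
have gf := ses_comp0 fg; have pa := ses_comp0 ap; have qb := ses_comp0 bq.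
pose c := ch_pair l (ch_comp b g).
have cf i x : c i (f i x) = (a i x, 0).
  by apply: (congr2 pair); [exact: lE | rewrite /= gf linear0].
have c_mono : ch_mono c.
  apply: ch_mono0 => i y cy.
  have /fgE[x xy] : g i y = 0.
    by apply: (bm i); rewrite linear0; exact: (congr1 snd cy).
  have : a i x = 0 by have := congr1 fst cy; rewrite -xy cf.
  by rewrite -(linear0 (a i)) -xy => /(am i) ->; rewrite linear0.
have [Y' [r cr]] := mono_ses c_mono; have [_ crE re] := cr; have rc := ses_comp0 cr.
exists (ch_prod Q Q'), Y', c, r; split=> //; first exact: tPC_prod.
have [i x /apE[y <-]|u uE] := ch_factor_epi (h := ch_comp r (ch_inl Q Q')) pe.
  by rewrite /= -[RHS](rc i (f i y)) cf.
have [i x /crE[y <-]|v vE] := ch_factor_epi (h := ch_comp q (ch_snd Q Q')) re.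
  exact: qb.
exists X', Z', u, v; split=> //; split=> i.
- apply: inj_ker0 => x; have [y <-] := pe i x.
  rewrite [u i _](uE i y) => /crE[z zE].
  have /fgE[t tz] : g i z = 0.
    by apply: (bm i); rewrite linear0; exact: (congr1 snd zE).
  by have := congr1 fst zE; rewrite -tz cf /= => <-; exact: pa.
- move=> x; split=> [|[y <-]]; last first.
    by have [z <-] := pe i y; rewrite [u i _](uE i z) [LHS](vE i) /= linear0.
  have [[y y'] <-] := re i x; rewrite [v i _](vE i) /= => /bqE[z zy'].
  (* Subtracting [c i t] from (y, y') clears the second coordinate without changing the class. *)
  have [t tz] := ge i z; exists (p i (y - l i t)).
  rewrite [LHS](uE i) /=; apply/subr0_eq; rewrite -linearB -[RHS](rc i (- t)).
  congr (r i _); apply: (congr2 pair); rewrite /= !linearN.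
    by rewrite addrAC subrr sub0r.
  by rewrite tz zy' sub0r.
- move=> z; have [y <-] := qe i z; exists (r i (0, y)); exact: vE.
Qed.

Lemma D_ker X Y Z (f : chmap X Y) (g : chmap Y Z) : ses f g -> D Y -> D Z -> D X.
Proof.
move=> fg DY DZ; have [Q [Y' [a [p [ap tQ DY']]]]] := D_cosyzygy DY.
have [W [r [u [v [cr uv]]]]] := coker_comp_ses fg ap.
apply: (D_intro _ cr tQ (D_ext uv DZ DY')) => m B tB.
by apply: (extS_ker fg); exact: D_left_perp.
Qed.

Lemma D_prod X Y : D X -> D Y -> D (ch_prod X Y).
Proof. exact: D_ext (ses_inl_snd X Y). Qed.

Lemma tP_D X : tP X -> D X.
Proof. exact: tP_D_projective. Qed.

Local Notation Ddim := (res_dim (fun=> D)).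

Lemma Ddim_ext n K E G (f : chmap K E) (g : chmap E G) :
  ses f g -> Ddim n K -> D G -> Ddim n E.
Proof.
elim: n K E G f g => [|n IHn] K E G f g fg /= DK DG; first exact: (D_ext fg).
have [L [H [a [p [ap DH DL]]]]] := DK.
have [K' [P [b [q [bq prP tP]]]]] := enough_projective_complexes G.
have DK' : D K' by apply: (D_ker bq) => //; exact: tP_D.
have [M [c [r [u [v [cr uv]]]]]] := horseshoe fg ap bq prP.
exists M, (ch_prod H P), c, r; split=> //; first by apply: D_prod => //; exact: tP_D.
exact: (IHn _ _ _ u v).
Qed.

(** The preimage [E'] of [K] in the cover [H] of [E] is the kernel of an epimorphism from [H] to
    [G], hence D_C-projective; it covers [K] with the same kernel [L]. *)
Lemma Ddim_ker n K E G (f : chmap K E) (g : chmap E G) :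
  ses f g -> Ddim n E -> D G -> Ddim n K.
Proof.
case: n => [|n] fg /= DE DG; first exact: (D_ker fg).
have [L [H [a [p [ap DH DL]]]]] := DE.
have [E' [u [v pb]]] := pullback_exists p f.
have [a' [a'v _]] := pullback_ses pb ap.
exists L, E', a', v; split=> //.
have [_ _ pe] := ap; exact: (D_ker (pullback_comp_ses pb fg pe)).
Qed.

(** A Schanuel argument with covers that are only D_C-projective: the pullback [E] of the two covers
    is an extension of [G] by [K'] and of [G'] by [K]. *)
Lemma Ddim_cover n K G X (f : chmap K G) (g : chmap G X) :
  ses f g -> D G -> Ddim n.+1 X -> Ddim n K.
Proof.
move=> fg DG [K' [G' [f' [g' [fg' DG' DK']]]]].
have [E [p [q pb]]] := pullback_exists g' g.
have [a [aq _]] := pullback_ses pb fg'.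
have [b [bp _]] := pullback_ses (pullback_sym pb) fg.
exact: (Ddim_ker bp (Ddim_ext aq DK' DG) DG').
Qed.

(** Pushing out along the embedding of [K] in [Q] gives a D_C-projective extension [E] of [X] by
    [Q], which splits because Ext^1(X, Q) = 0. *)
Lemma D_of_short K G X (f : chmap K G) (g : chmap G X) :
  ses f g -> D K -> D G -> (forall B, tFC B -> ext1_zero X B) -> D X.
Proof.
move=> fg DK DG X0; have [Q [K' [a [p [ap tQ DK']]]]] := D_cosyzygy DK.
have [E [w [e [y [v [we yv]]]]]] := pushout_ses fg ap.
have DE : D E by exact: (D_ext yv).
have [r rE] := ext1_zero_retraction (X0 _ (tPC_tFC tQ)) we.
have [s sE] := retraction_section we rE.
have [t [wt tw]] := section_retraction we sE.
have [wm weE ee] := we.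
(* [X] is the kernel of the retraction of [E] onto [Q], so [D_ker] applies in place of closure under
   summands. *)
apply: (D_ker (f := s) (g := t)) => //; last exact: tPC_D.
split=> i.
- by move=> x x' xx; rewrite -[x](sE i) -[x'](sE i) /= xx.
- move=> x; split=> [x0|[z <-]].
    exists (e i x); apply/esym/subr0_eq.
    by rewrite -[LHS](wt i x) /= x0 linear0.
  apply: (wm i); rewrite [LHS](wt i) linear0 /= [e i _](sE i) subrr //.
- by move=> x; exists (w i x); exact: tw.
Qed.

Lemma Ddim_D N X : Ddim N X -> left_perp X -> D X.
Proof.
elim: N X => [//|N IHN] X [K [G [f [g [fg DG DK]]]]] WX.
apply: (D_of_short fg _ DG (fun B tB => WX 0%N B tB)).
by apply: IHN => // m B tB; apply: (extS_ker fg); [exact: D_left_perp | exact: WX].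
Qed.

(** Each syzygy of a projective cover lowers [n] by one, until [Ddim_D] applies. *)
Lemma Ddim_ext_zero N n X : Ddim N X ->
  (forall m B, (n <= m)%N -> tFC B -> extS_zero m X B) -> Ddim n X.
Proof.
elim: n N X => [|n IHn] N X DX WX.
  by apply: (Ddim_D DX) => m B; exact: WX.
have [K [P [f [g [fg prP tP]]]]] := enough_projective_complexes X.
have DP := tP_D tP.
exists K, P, f, g; split=> //.
(* Only finiteness has to be kept; the bound comes from [WX]. *)
have [N' DK] : exists N', Ddim N' K.
  case: N DX => [|N] DX; first by exists 0%N; exact: (D_ker fg).
  by exists N; exact: (Ddim_cover fg DP DX).
apply: (IHn _ _ DK) => m B nm tB.
exact: (WX m.+1 B nm tB _ _ _ _ fg prP).
Qed.

(** [extS_zero m] is Ext^(m+1), so [n <= m] means degrees above [n]. Induction on [k] shifts the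
    second variable; terms in tilde F_C are handled by induction on [n], which shifts the first
    variable down to [D_left_perp]. *)
Lemma FC_dim_ext_zero k n X H : Ddim n X -> res_dim (fun=> tFC) k H ->
  forall m, (n <= m)%N -> extS_zero m X H.
Proof.
move=> DX; elim: k H => [|k IHk] H /=.
  elim: n X DX => [|n IHn] X /= DX tH m nm; first exact: D_left_perp.
  have [K [G [f [g [fg DG DK]]]]] := DX.
  case: m nm => // m nm; apply: (extS_coker fg); first exact: (IHn K).
  exact: D_left_perp.
move=> [L [F [f [g [fg tF FL]]]]] m nm.
apply: (extS_second fg); last by apply: IHk => //; exact: leqW.
clear IHk FL fg f g.
elim: n X DX m nm => [|n IHn] X /= DX m nm; first exact: D_left_perp.
have [K [G [f [g [fg DG DK]]]]] := DX.
case: m nm => // m nm; apply: (extS_coker fg); first exact: (IHn K).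
exact: D_left_perp.
Qed.

(** As in Auslander-Buchweitz approximation, D_C-projective terms are moved to the front by
    embedding them in tilde P_C and pushing out. *)
Lemma Ddim_P_C_tail n X : Ddim n X ->
  res_dim (fun i => if i is 0 then D else tPC) n X.
Proof.
case: n => [//|n].
suff main m Y : Ddim m.+1 Y -> exists K G (f : chmap K G) (g : chmap G Y),
    [/\ ses f g, D G & res_dim (fun=> tPC) m K] by exact: main.
elim: m Y => [|m IHm] Y [K [G [f [g [fg DG DK]]]]].
  have [Q [K' [a [p [ap tQ DK']]]]] := D_cosyzygy DK.
  have [E [w [e [y [v [we yv]]]]]] := pushout_ses fg ap.
  by exists Q, E, w, e; split=> //; exact: (D_ext yv).
have [L [G' [a [b [ab DG' tL]]]]] := IHm K DK.
(* [G'] is replaced by [Q], which enlarges [K] to K'' = Q/L. The cokernel [G''] of this enlargement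
   is D_C-projective, so the pushout [E] of [G] is too. *)
have [Q [G'' [c [p [cp tQ DG'']]]]] := D_cosyzygy DG'.
have [K'' [r [u [v [cr uv]]]]] := coker_comp_ses ab cp.
have [E [w [e [y [v' [we yv]]]]]] := pushout_ses fg uv.
exists K'', E, w, e; split=> //; first exact: (D_ext yv).
by exists L, Q, (ch_comp c a), r.
Qed.

(** The first [t] terms are projective covers; the [t]-th syzygy still has dimension at most [n - t]
    and takes the resolution of [Ddim_P_C_tail]. *)
Lemma Ddim_mixed t n X : (t <= n)%N -> Ddim n X ->
  res_dim (fun i => if (i < t)%N then tP else if (i == t)%N then D else tPC) n X.
Proof.
elim: t n X => [|t IHt] n X tn DX.
  have := Ddim_P_C_tail DX; congr (res_dim _ _ _).
  by apply/funext => -[|i].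
case: n tn DX => // n tn DX.
have [K [P [f [g [fg prP tP]]]]] := enough_projective_complexes X.
exists K, P, f, g; split=> //.
exact: IHt (Ddim_cover fg (tP_D tP) DX).
Qed.

End DProjective.

(** * The cycle (1) => (2) => (3) => (4) => (5) => (1) *)

Theorem theorem3p3 (R : comPzRingType) (C : lmodType R)
    (hC : semidualizing C) (X : complex R) (n : nat) :
  [<-> dim_le (D_projective C) X n;
       dim_finite (D_projective C) X /\
         forall m (H : complex R), (n < m)%N -> dim_finite (tilde (F_C C)) H ->
           ext_zero m X H;
       dim_finite (D_projective C) X /\
         forall m (H : complex R), (n < m)%N -> tilde (F_C C) H ->
           ext_zero m X H;
       forall G : resolution X, (forall k, D_projective C (G k)) ->
         D_projective C (syzygy G n);
       forall t, (t <= n)%N ->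
         exists T : resolution X,
           [/\ length_le T n,
               D_projective C (T t),
               forall i, (t < i <= n)%N -> tilde (P_C C) (T i)
             & forall i, (i < t)%N -> tilde (@projective_module R) (T i)]].
Proof.
have Ddim_dim_le k : dim_le (D_projective C) X k <-> res_dim (fun=> D_projective C) k X.
  split=> [[T [Tl DT]]|/res_dim_resolution[T TP]]; last by exists T.
  exact: (resolution_res_dim (fun=> @D_projective_iso R C) Tl DT).
have FC_iso : ch_iso_closed (tilde (F_C C)).
  by move=> Y Z; apply: tilde_iso; exact: tensor_class_iso_closed.
have FC_dim k H : dim_le (tilde (F_C C)) H k -> res_dim (fun=> tilde (F_C C)) k H.
  by move=> [T [Tl FT]]; exact: (resolution_res_dim (fun=> FC_iso) Tl FT).
tfae.
(* Since [m > n], [m] is a successor, and the strict bound becomes the weak one of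
   [FC_dim_ext_zero]. *)
- move=> DX; split=> [|[//|m] H nm [k /FC_dim FH]]; first by exists n.
  by apply/ext_zeroP; exact: (FC_dim_ext_zero hC ((Ddim_dim_le n).1 DX) FH nm).
- move=> [DX ext]; split=> // m H nm FH; apply: ext => //.
  exists 0%N; have [T [T0 Tl]] := single_resolution H.
  by exists T; split=> // -[|k] // _; rewrite T0.
- move=> [[N /Ddim_dim_le DX] ext] G DG.
  have {}DX : res_dim (fun=> D_projective C) n X.
    by apply: (Ddim_ext_zero hC DX) => m B nm tB; apply/ext_zeroP; exact: ext.
  (* Every D_C-projective cover lowers the dimension by one, so the [n]-th syzygy has dimension
     0. *)
  have main k : (k <= n)%N -> res_dim (fun=> D_projective C) (n - k) (syzygy G k).
    elim: k => [|k IHk] kn; first by rewrite subn0.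
    have [f [g fg]] := syzygy_ses G k.
    by apply: (Ddim_cover hC fg (DG k)); rewrite -subSn // subSS; exact: IHk (ltnW kn).
  by have := main n (leqnn n); rewrite subnn.
- move=> syz t tn.
  have [P prP] := projective_resolution X.
  have DP k : D_projective C (P k) by apply: tP_D => //; have [] := prP k.
  (* Condition (4) for one projective resolution, read backwards from the [n]-th syzygy, bounds the
     dimension of [X]. *)
  have main k : (k <= n)%N -> res_dim (fun=> D_projective C) k (syzygy P (n - k)).
    elim: k => [|k IHk] kn; first by rewrite subn0; exact: syz.
    have [f [g fg]] := syzygy_ses P (n - k.+1).
    exists (syzygy P (n - k.+1).+1), (P (n - k.+1)%N), f, g; split=> //.
    by rewrite subnSK //; exact: IHk (ltnW kn).
  have := main n (leqnn n); rewrite subnn => /(Ddim_mixed hC tn)/res_dim_resolution[T [Tl TP]].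
  exists T; split=> // [|i /andP[ti iin]|i it].
  + by have := TP t tn; rewrite ltnn eqxx.
  + by have := TP i iin; rewrite ltnNge (ltnW ti) /= gtn_eqF.
  + by have := TP i (leq_trans (ltnW it) tn); rewrite it.
(* For [t = n] all terms before the last lie in tilde P, hence are D_C-projective. *)
- move=> /(_ n (leqnn n))[T [Tl DT _ PT]]; exists T; split=> // k kn.
  have [->|kn'] := eqVneq k n; first exact: DT.
  by apply: tP_D => //; apply: PT; rewrite ltn_neqAle kn'.
Qed.
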